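(* Let $\varepsilon\le1/d$ be a target accuracy, let $\alpha>0$, and let $\mathcal{C}\subset\mathbb{R}^d$ be a closed convex set with $\mathcal{C}\subseteq\mathcal{B}(1)$. Suppose the functions $(f_t)$ in the reduction algorithm of the context are such that $f_t(\cdot)=f(\cdot,\xi_t)$, where $\xi_1,\xi_2,\dots$ are i.i.d. random variables in some set $\Xi$, and for all $\xi\in\Xi$ the function $w\mapsto f(w,\xi)$ is $\alpha$-exp-concave and all of its subgradients with respect to $w$ have Euclidean norm at most $1$. Suppose the subroutine $\mathcal{A}$ of the reduction algorithm is set to Algorithm OQNS (also in the context) with parameters $B>0$, $\eta\ge11$, $c=1/4$, and $\beta=\frac18\wedge\frac\alpha2$. Further, suppose that either (a) $\rho(\cdot)$ in the reduction algorithm is set to $\|\cdot\|$ and $B=1$; or (b) $\rho(\cdot)$ is set to $\gamma_{\mathcal{C}}(\cdot)$, the set $\mathcal{C}$ is centrally symmetric ($\mathcal{C}=-\mathcal{C}$) with $\mathcal{B}(1/\sqrt d)\subseteq\mathcal{C}\subseteq\mathcal{B}(1)$, and $B=1+\sqrt d$. Then, for $T=\frac{d\ln(d/\varepsilon)}{\alpha\varepsilon}$ and $\bar u_T=\frac1T\sum_{t=1}^Tu_t$, where $(u_t)$ are the iterates played by the reduction algorithm, we have $$\mathbb{E}\left[f(\bar u_T)-\inf_{u\in\mathcal{C}}f(u)\right]\le O(\varepsilon),\qquad\text{where } f(\cdot)=\mathbb{E}[f(\cdot,\xi)]$$ and $\xi$ has the common distribution of the $\xi_t$. The computational costs in cases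 (a) and (b) are, respectively, $\widetilde O\left(\frac d\varepsilon(d^2+T_{\mathrm{proj}}(\mathcal{C}))\right)$ and $\widetilde O\left(\frac d\varepsilon(d^2+T_{\mathrm{sep}}(\mathcal{C}))\right)$.
   Context: $\|\cdot\|$ is the Euclidean norm, $\mathcal{B}(r)\subset\mathbb{R}^d$ the Euclidean ball of radius $r$ centered at $0$, $I$ the identity matrix, $a\wedge b=\min\{a,b\}$. A function $f:\mathcal{K}\to\mathbb{R}$ on a convex set $\mathcal{K}$ is $\alpha$-exp-concave if $x\mapsto e^{-\alpha f(x)}$ is concave on $\mathcal{K}$. $\gamma_{\mathcal{C}}(x)=\inf\{\lambda\ge0:x\in\lambda\mathcal{C}\}$ is the gauge function of $\mathcal{C}$. A Separation Oracle for $\mathcal{C}$, given $u\in\mathbb{R}^d$, either asserts $u\in\mathcal{C}$ or returns $w$ with $\langle w,u\rangle>\langle w,v\rangle$ for all $v\in\mathcal{C}$; $T_{\mathrm{sep}}(\mathcal{C})$ is the computational cost of one call. A Euclidean Projection Oracle for $\mathcal{C}$, given $u\in\mathbb{R}^d$, either asserts $u\in\mathcal{C}$ or returns $w\in\mathcal{C}$ with $\|w-u\|\le\|v-u\|$ for all $v\in\mathcal{C}$; $T_{\mathrm{proj}}(\mathcal{C})$ is the computational cost of one call. $\widetilde O(\cdot)$ hides poly-logarithmic factors in problem parameters. Reduction algorithm. Inputs: an online convex optimization algorithm $\mathcal{A}$ over $\mathcal{B}(1)\supseteq\mathcal{C}$, and a convex function $\rho:\mathbb{R}^d\to\mathbb{R}_{\ge0}\cup\{+\infty\}$.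 Let $w_1\in\mathcal{B}(1)$ be $\mathcal{A}$'s first output and let $S(w)=\inf_{x\in\mathcal{C}}\rho(w-x)$. For $t=1,2,\dots$: pick $\nu_t\in\partial S(w_t)$ and set $\gamma_t=\langle\nu_t,w_t\rangle$; play $u_t=w_t/\gamma_t$ if $\gamma_t\ge1$ and $u_t=w_t$ if $\gamma_t<1$; observe a subgradient $\zeta_t\in\partial f_t(u_t)$; set $g_t=\zeta_t-\mathbb{I}\{\langle\zeta_t,w_t\rangle<0\}\langle\zeta_t,u_t\rangle\nu_t$; set $\mathcal{A}$'s $t$-th loss to $\ell_t:w\mapsto\langle g_t,w\rangle$; let $w_{t+1}\in\mathcal{B}(1)$ be $\mathcal{A}$'s $(t+1)$-th output given the history $((w_i,\ell_i))_{i\le t}$. (The subgradients of $S$ are computed using a Euclidean Projection Oracle when $\rho=\|\cdot\|$, and a Separation Oracle with a binary search when $\rho=\gamma_{\mathcal{C}}$.) Algorithm OQNS with parameters $B,\eta,\beta,c>0$ and horizon $T$. Let $\Psi(x)=-\eta d\ln(1-\|x\|^2)$ and $\Phi_t(x)=\Psi(x)+\frac{d+B^2\eta}{2}\|x\|^2+\frac{\beta}{2}\sum_{s=1}^{t-1}\langle g_s,x-w_s\rangle^2+x^\top\sum_{s=1}^{t-1}g_s$. Set $m=\left\lceil-\log_c\left(\frac{12(4+32/\eta^2)^2(2\eta d+B^2\eta+(B+2\beta B^2)T)^2T}{1-c}\right)\right\rceil$, $v_1=w_1=0$ and $A_0=(2\eta d+d+\eta B^2)^{-1}I$. For $t=1,\dots,T$: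 output $w_t$ and observe $g_t\in\partial\ell_t(w_t)$; compute $A_t=\left(\frac{2\eta d}{1-\|v_t\|^2}I+(d+\eta B^2)I+\beta\sum_{s=1}^tg_sg_s^\top\right)^{-1}$, $H_t=\left(A_t^{-1}+\frac{4\eta d\,w_tw_t^\top}{(1-\|w_t\|^2)^2}\right)^{-1}$ and $\theta_t=\frac{2\eta d}{1-\|v_t\|^2}-\frac{2\eta d}{1-\|w_t\|^2}$; set $w_{t+1}=w_t-\sum_{k=1}^{m+1}\theta_t^{k-1}H_t^k\nabla\Phi_{t+1}(w_t)$; set $v_{t+1}=v_t$ if $|\|w_{t+1}\|^2-\|v_t\|^2|\le c\,(1-\|v_t\|^2)$ and $v_{t+1}=w_{t+1}$ otherwise. (Implementation: when $v_t=v_{t-1}$, $A_t$ is obtained from $A_{t-1}$ by a rank-one update of the inverse, and otherwise by a full matrix inversion; $H_t$ is obtained from $A_t$ by a rank-one update of the inverse; $w_{t+1}$ is computed by successive matrix-vector products.) *)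

(* Defs.v *)
From HB Require Import structures.
From mathcomp Require Import all_boot all_order all_algebra.
From mathcomp Require Import all_classical all_reals all_analysis.

Set Implicit Arguments.
Unset Strict Implicit.
Unset Printing Implicit Defensive.

Import Order.TTheory GRing.Theory Num.Theory.
Import numFieldNormedType.Exports.

Local Open Scope classical_set_scope.
Local Open Scope ring_scope.

(* The ambient space R^d, d >= 1, is 'cV[R]_n.+1 with d = n.+1. The library    *)
(* norm on matrices is the sup norm, hence the explicit Euclidean norm; both   *)
(* induce the same topology, so [closed] is unaffected. Rounds are numbered    *)
(* from 0.                                                                     *)

Section Euclidean.
Context {R : realType} {n : nat}.
Local Notation V := 'cV[R]_n.+1.
Implicit Types (x y u w z nu : V) (C : set V) (F : V -> \bar R).

Definition dot x y : R := \sum_i x i ord0 * y i ord0.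
Definition enorm x : R := Num.sqrt (dot x x).
Definition eball (r : R) : set V := [set x | enorm x <= r].

Definition gradient (phi : V -> R) x : V :=
  \col_i 'D_(delta_mx i ord0) phi x.

Definition subdiff F u : set V :=
  [set z | F u \is a fin_num /\
    forall v, (F u + (dot z (v - u))%:E <= F v)%E].

(* A function on K as an extended-real function on R^d: its subdifferential is *)
(* the one of f : K -> R.                                                      *)
Definition ext (K : set V) (f : V -> R) : V -> \bar R :=
  fun x => if x \in K then (f x)%:E else +oo%E.

Definition exp_concave (alpha : R) (K : set V) (f : V -> R) : Prop :=
  convex_function (E := V) K (fun x => - expR (- alpha * f x)).

Definition gauge C x : \bar R :=
  ereal_inf [set l%:E | l in
    [set l : R | 0 <= l /\ exists2 y, C y & x = l *: y]].

Definition inf_conv C (rho : V -> \bar R) w : \bar R :=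
  ereal_inf [set rho (w - x) | x in C].

(* Oracles answer [None] to assert membership of the query. *)
Definition projection_oracle C (O : V -> option V) : Prop :=
  forall u, match O u with
            | None => C u
            | Some w => C w /\ forall v, C v -> enorm (w - u) <= enorm (v - u)
            end.

Definition separation_oracle C (O : V -> option V) : Prop :=
  forall u, match O u with
            | None => C u
            | Some w => forall v, C v -> dot w v < dot w u
            end.

End Euclidean.

(* Only applied to nonnegative reals. *)
Definition nceil {R : realType} (x : R) : nat := `|Num.ceil x|%N.

Section Reduction.
Context {R : realType} {n : nat}.
Local Notation V := 'cV[R]_n.+1.

(* An online algorithm for linear losses l_t : x |-> <g_t, x>, given by the    *)
(* relation between its outputs (w_t) and the vectors (g_t).                   *)
Definition online_alg := (nat -> V) -> (nat -> V) -> Prop.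

Definition played (w nu : V) : V :=
  let gam := dot nu w in if 1 <= gam then gam^-1 *: w else w.

Definition surrogate (w nu zeta : V) : V :=
  zeta - (if dot zeta w < 0 then dot zeta (played w nu) else 0) *: nu.

(* [N w] is the set of vectors allowed as nu_t when w_t = w; the reduction     *)
(* proper has N = subdiff (inf_conv C rho). F t is the t-th loss.              *)
Definition reduction_run (alg : online_alg) (N : V -> set V)
    (F : nat -> V -> \bar R) (T : nat) (w nu zeta : nat -> V) : Prop :=
  alg w (fun t => surrogate (w t) (nu t) (zeta t)) /\
  forall t, (t < T)%N ->
    N (w t) (nu t) /\ subdiff (F t) (played (w t) (nu t)) (zeta t).

Definition average (T : nat) (u : nat -> V) : V :=
  T%:R^-1 *: \sum_(t < T) u t.

End Reduction.

Section OQNS.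
Context {R : realType} {n : nat}.
Local Notation V := 'cV[R]_n.+1.
Local Notation M := 'M[R]_n.+1.
Variables (B eta beta c : R) (T : nat).
Local Notation d := (n.+1%:R : R).

Definition barrier (x : V) : R := - eta * d * ln (1 - enorm x ^+ 2).

(* [Phi t] is the objective built from the first t losses. *)
Definition Phi (w g : nat -> V) (t : nat) (x : V) : R :=
  barrier x + (d + B ^+ 2 * eta) / 2 * enorm x ^+ 2
  + beta / 2 * (\sum_(s < t) dot (g s) (x - w s) ^+ 2)
  + dot x (\sum_(s < t) g s).

Definition oqns_terms : nat :=
  nceil (- (ln (12 * (4 + 32 / eta ^+ 2) ^+ 2
                * (2 * eta * d + B ^+ 2 * eta
                   + (B + 2 * beta * B ^+ 2) * T%:R) ^+ 2
                * T%:R / (1 - c)) / ln c)).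

Definition keep_landmark (w v : V) : bool :=
  `|enorm w ^+ 2 - enorm v ^+ 2| <= c * (1 - enorm v ^+ 2).

Fixpoint landmark (w : nat -> V) (t : nat) : V :=
  if t is s.+1 then
    if keep_landmark (w t) (landmark w s) then landmark w s else w t
  else 0.

Definition oqns_A (w g : nat -> V) (t : nat) : M :=
  invmx ((2 * eta * d / (1 - enorm (landmark w t) ^+ 2))%:M
         + (d + eta * B ^+ 2)%:M
         + beta *: \sum_(s < t.+1) g s *m (g s)^T).

Definition oqns_H (w g : nat -> V) (t : nat) : M :=
  invmx (invmx (oqns_A w g t)
         + (4 * eta * d / (1 - enorm (w t) ^+ 2) ^+ 2) *: (w t *m (w t)^T)).

Definition oqns_theta (w : nat -> V) (t : nat) : R :=
  2 * eta * d / (1 - enorm (landmark w t) ^+ 2)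
  - 2 * eta * d / (1 - enorm (w t) ^+ 2).

Definition oqns : online_alg := fun w g =>
  w 0%N = 0 /\
  forall t, (t < T)%N ->
    w t.+1 = w t - \sum_(1 <= k < oqns_terms.+2)
      oqns_theta w t ^+ k.-1
        *: (oqns_H w g t ^+ k *m gradient (Phi w g t.+1) (w t)).

End OQNS.

Section Stochastic.
Context {R : realType} {n : nat} (dX dO : measure_display)
  (Xi : measurableType dX) (Omega : measurableType dO).
Local Notation V := 'cV[R]_n.+1.
Variables (P : probability Omega R) (mu : probability Xi R).

Definition iid (xi : nat -> Omega -> Xi) : Prop :=
  [/\ forall t, measurable_fun setT (xi t),
      forall t A, measurable A -> P (xi t @^-1` A) = mu A &
      forall N (A : nat -> set Xi), (forall t, measurable (A t)) ->
        P (\bigcap_(t in `I_N) xi t @^-1` A t)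
        = (\prod_(t < N) P (xi t @^-1` A t))%E].

(* X is measurable with respect to the sigma-algebra of xi_0, ..., xi_(k-1). *)
Definition depends_on_first (xi : nat -> Omega -> Xi) (k : nat)
    (X : Omega -> V) : Prop :=
  forall i (A : set R), measurable A ->
    <<s [set E | exists s (D : set Xi),
           [/\ (s < k)%N, measurable D & E = xi s @^-1` D]] >>
      ((fun om => X om i ord0) @^-1` A).

(* The (possibly non-unique) subgradients do not anticipate future losses. *)
Definition nonanticipating (xi : nat -> Omega -> Xi) (T : nat)
    (nu zeta : nat -> Omega -> V) : Prop :=
  forall t, (t < T)%N ->
    depends_on_first xi t (nu t) /\ depends_on_first xi t.+1 (zeta t).

Definition risk (f : V -> Xi -> R) (u : V) : R := \int[mu]_x f u x.

Definition excess_risk (f : V -> Xi -> R) (C : set V) (u : V) : R :=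
  risk f u - inf [set risk f v | v in C].

(* Losses on the convex set K; the last clause makes [risk f] meaningful. *)
Definition loss_family (alpha : R) (K : set V) (f : V -> Xi -> R) : Prop :=
  [/\ forall x, exp_concave alpha K (f^~ x),
      forall x u z, subdiff (ext K (f^~ x)) u z -> enorm z <= 1 &
      forall u, K u -> mu.-integrable setT (EFin \o f u)].

End Stochastic.

(* Cost model: a computation returns its value, the number of arithmetic       *)
(* operations and comparisons on reals, and the number of oracle calls.        *)
(* Vector and matrix primitives carry their textbook costs, a full inversion   *)
(* being charged d ^ 3 operations; the parameters (n, B, eta, beta, c, T and   *)
(* [oqns_terms]) are known in advance.                                         *)
Record comp (X : Type) := Comp { value : X; ops : nat; calls : nat }.

Section Monad.
Context {X Y : Type}.

Definition tick (k : nat) (x : X) : comp X := Comp x k 0.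

Definition bind (a : comp X) (k : X -> comp Y) : comp Y :=
  let b := k (value a) in
  Comp (value b) (ops a + ops b) (calls a + calls b).

Definition query (O : X -> Y) (x : X) : comp Y := Comp (O x) 0 1.

Definition cost {R : realType} (Torc : R) (a : comp X) : R :=
  (ops a)%:R + (calls a)%:R * Torc.

End Monad.

Notation "'let*' x ':=' a 'in' b" := (bind a (fun x => b))
  (at level 200, x name, a at level 200, b at level 200).

Section Program.
Context {R : realType} {n : nat}.
Local Notation V := 'cV[R]_n.+1.
Local Notation M := 'M[R]_n.+1.
Local Notation d := (n.+1%:R : R).

Definition vadd (x y : V) := tick n.+1 (x + y).
Definition vsub (x y : V) := tick n.+1 (x - y).
Definition vscale (a : R) (x : V) := tick n.+1 (a *: x).
Definition vdot (x y : V) := tick (2 * n.+1)%N (dot x y).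
Definition mvmul (A : M) (x : V) := tick (2 * n.+1 ^ 2)%N (A *m x).
Definition outer (x y : V) := tick (n.+1 ^ 2)%N (x *m y^T).
Definition madd (A A' : M) := tick (n.+1 ^ 2)%N (A + A').
Definition mscale (a : R) (A : M) := tick (n.+1 ^ 2)%N (a *: A).
Definition scalar (a : R) := tick (n.+1 ^ 2)%N (a%:M : M).
Definition minv (A : M) := tick (n.+1 ^ 3)%N (invmx A).

(* Given the inverse A of a matrix S, the inverse of S + k x x^T. *)
Definition rank_one (A : M) (k : R) (x : V) : comp M :=
  let* y := mvmul A x in
  let* a := vdot x y in
  let* b := tick 4 (- (k / (1 + k * a))) in
  let* Y := outer y y in
  let* Z := mscale b Y in
  madd A Z.

(* acc + (theta H y + ... + (theta H)^j y) *)
Fixpoint neumann (j : nat) (theta : R) (H : M) (y acc : V) : comp V :=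
  if j is i.+1 then
    let* y1 := mvmul H y in
    let* y2 := vscale theta y1 in
    let* acc' := vadd acc y2 in
    neumann i theta H y2 acc'
  else tick 0 acc.

Section Subgradients.
Variable O : V -> option V.

(* Subgradient of the distance to C from a projection oracle. *)
Definition nu_projection (w : V) : comp V :=
  let* a := query O w in
  if a is Some p then
    let* z := vsub w p in
    let* q := vdot z z in
    let* s := tick 2 (Num.sqrt q) in
    if s == 0 then tick 0 0 else let* r := tick 1 s^-1 in vscale r z
  else tick 0 0.

(* Bisection for the gauge of w: w / hi is in C and y separates w / lo from C. *)
Fixpoint bisect (N : nat) (w : V) (lo hi : R) (y : V) : comp (R * V) :=
  if N is N'.+1 then
    let* mid := tick 2 ((lo + hi) / 2) in
    let* r := tick 1 mid^-1 in
    let* x := vscale r w in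
    let* a := query O x in
    if a is Some y' then bisect N' w mid hi y' else bisect N' w lo mid y
  else tick 0 (hi, y).

(* Approximate subgradient of inf_conv C (gauge C), normalised so that         *)
(* <nu, w> is the upper end of the bisection interval, whence w / <nu, w> is   *)
(* in C.                                                                       *)
Definition nu_separation (N : nat) (w : V) : comp V :=
  let* a := query O w in
  if a is Some y0 then
    let* top := tick 1 (Num.sqrt d) in
    let* r := bisect N w 1 top y0 in
    let* q := vdot r.2 w in
    let* k := tick 1 (r.1 / q) in
    vscale k r.2
  else tick 0 0.

End Subgradients.

(* At the start of round t: w_t, v_t, whether v_t = v_(t-1), A_(t-1), and the  *)
(* sums over s < t of g_s g_s^T, <g_s, w_s> g_s, g_s and u_s.                  *)
Record state := State {
  st_w : V; st_v : V; st_same : bool; st_A : M;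
  st_G : M; st_q : V; st_g : V; st_u : V }.

Variables (B eta beta c : R) (T : nat) (nu_prog : V -> comp V).

Definition init : comp state :=
  let* A := scalar (2 * eta * d + d + eta * B ^+ 2)^-1 in
  let* G := scalar 0 in
  tick (4 * n.+1)%N (State 0 0 true A G 0 0 0).

Definition play (w nu : V) : comp V :=
  let* gam := vdot nu w in
  let* far := tick 1 (1 <= gam) in
  if far then let* r := tick 1 gam^-1 in vscale r w else tick 0 w.

Definition feedback (w nu u zeta : V) : comp V :=
  let* a := vdot zeta w in
  let* neg := tick 1 (a < 0) in
  if neg then
    let* b := vdot zeta u in let* x := vscale b nu in vsub zeta x
  else tick 0 zeta.

Definition oqns_update (st : state) (u g : V) : comp state :=
  let w := st_w st in
  let* sum_u := vadd (st_u st) u in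
  let* gg := outer g g in
  let* G := madd (st_G st) gg in
  let* a := vdot g w in
  let* ag := vscale a g in
  let* q := vadd (st_q st) ag in
  let* sum_g := vadd (st_g st) g in
  let* vv := vdot (st_v st) (st_v st) in
  let* ww := vdot w w in
  let* kv := tick 4 (2 * eta * d / (1 - vv)) in
  let* kw := tick 4 (2 * eta * d / (1 - ww)) in
  let* reg := tick 3 (d + eta * B ^+ 2) in
  let* A :=
    if st_same st then rank_one (st_A st) beta g
    else
      let* r := tick 1 (kv + reg) in
      let* D := scalar r in
      let* bG := mscale beta G in
      let* S := madd D bG in
      minv S in
  let* kH := tick 5 (4 * eta * d / (1 - ww) ^+ 2) in
  let* H := rank_one A kH w in
  let* theta := tick 1 (kv - kw) in
  let* Gw := mvmul G w in
  let* x1 := vsub Gw q in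
  let* x2 := vscale beta x1 in
  let* kr := tick 1 (kw + reg) in
  let* x3 := vscale kr w in
  let* x4 := vadd x2 x3 in
  let* grad := vadd x4 sum_g in
  let* y := mvmul H grad in
  let* step := neumann (oqns_terms (n := n) B eta beta c T) theta H y y in
  let* w' := vsub w step in
  let* ww' := vdot w' w' in
  let* keep := tick 5 (`|ww' - vv| <= c * (1 - vv)) in
  tick 0 (State w' (if keep then st_v st else w') keep A G q sum_g sum_u).

(* zeta t is the subgradient revealed in round t after the t-th play. *)
Fixpoint program_state (zeta : nat -> V) (t : nat) : comp state :=
  if t is s.+1 then
    let* st := program_state zeta s in
    let* nu := nu_prog (st_w st) in
    let* u := play (st_w st) nu in
    let* g := feedback (st_w st) nu u (zeta s) in
    oqns_update st u g
  else init.

Definition program_w (zeta : nat -> V) (t : nat) : V :=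
  st_w (value (program_state zeta t)).

Definition program_nu (zeta : nat -> V) (t : nat) : V :=
  value (nu_prog (program_w zeta t)).

Definition program (zeta : nat -> V) : comp V :=
  let* st := program_state zeta T in
  let* r := tick 1 (T%:R^-1) in
  vscale r (st_u st).

End Program.

(* Main.v *)
(* A round of OQNS is a Newton step on [Phi] in which the inverse Hessian is
   replaced by a truncated Neumann series in [oqns_H]. The landmarks keep
   [oqns_theta] below a quarter of the curvature of the barrier, so the series
   contracts by 1/3 per term; by self-concordance of the barrier, each step divides
   by 6 the sum of the Newton decrement and of the local dual norm of the new gradient.
   Hence the iterates stay in the open ball and near the minimisers of [Phi], and
   the regret is controlled by the sum of the squared local norms of the gradients,
   that is, by the logarithm of a determinant.

   By exp-concavity, f_t(u_t) - f_t(v) <= a - beta a^2 / 2 for a = <zeta_t, u_t - v>.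
   This is at most the same expression at the surrogate gradient, w_t and the
   comparator (1 - tau) v, up to O(ep + tau): of nu_t one only needs that
   |<nu_t, v>| <= 1 + ep on C and that <nu_t, w_t - v> >= - ep on C when u_t = w_t,
   which also holds for the subgradients computed by bisection.

   As [f] need not be jointly measurable, expectations are taken after rounding u_t
   to a finite grid: on each cell the fluctuation of a loss at a fixed point is
   independent of the past, and the losses are 1-Lipschitz.

   A matrix is inverted only when the landmark moves. Each move forces a constant
   variation of ln (1 - |w_t|^2), and the total variation is at most the above
   potential plus T / (eta d); as d <= 1 / eps, the d^3 operations of an inversion
   fit in the budget. *)

(* The local dual norms of the gradients must meet two demands: the regret needs summable squares,
   while Newton convergence needs each norm to be at most 1/4. The quadratic part of the Hessian
   alone gives the first (leverages, summing to a log-determinant); barrier and regularisation give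
   the second. The minimum of the two bounds is used throughout. The second bound holds only inside
   the ball, so runs are studied by prefixes, [T] still fixing the number of Neumann terms. The
   rank-one inverse of the program needs the same fact, so its correctness and ball membership form
   one induction. The domain of the losses may have a boundary. There a normal vector could be added
   to any subgradient, so the norm bound on all subgradients at u_t forces u_t to be interior; at
   interior points subgradients exist and give the Lipschitz estimate. The comparator is shrunk by
   tau = eps / d because the barrier blows up on the sphere; this costs eta d ln (d / eps). If d /
   eps <= 2 the horizon may be zero, and the claim follows from an excess risk of at most 2 <= 4
   eps. *)
Require Import Defs.
From HB Require Import structures.
From mathcomp Require Import all_boot all_order all_algebra.
From mathcomp Require Import all_classical all_reals all_analysis.
From mathcomp Require Import perm measurable_realfun ring lra zify.

Set Implicit Arguments.
Unset Strict Implicit.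
Unset Printing Implicit Defensive.

Import Order.TTheory GRing.Theory Num.Theory.
Import numFieldNormedType.Exports.

Local Open Scope classical_set_scope.
Local Open Scope ring_scope.

(** * Euclidean inner product *)

Section InnerProduct.
Context {R : realType} {n : nat}.
Local Notation V := 'cV[R]_n.+1.
Implicit Types (x y z : V) (A : 'M[R]_n.+1).

Lemma dotE x y : dot x y = (x^T *m y) ord0 ord0.
Proof. by rewrite mxE; apply: eq_bigr => i _; rewrite mxE. Qed.

Lemma dotC x y : dot x y = dot y x.
Proof. by apply: eq_bigr => i _; rewrite mulrC. Qed.

Lemma dotDl x y z : dot (x + y) z = dot x z + dot y z.
Proof. by rewrite -big_split; apply: eq_bigr => i _; rewrite mxE mulrDl. Qed.

Lemma dotZl a x y : dot (a *: x) y = a * dot x y.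
Proof. by rewrite mulr_sumr; apply: eq_bigr => i _; rewrite mxE mulrA. Qed.

Lemma dotNl x y : dot (- x) y = - dot x y.
Proof. by rewrite -scaleN1r dotZl mulN1r. Qed.

Lemma dotBl x y z : dot (x - y) z = dot x z - dot y z.
Proof. by rewrite dotDl dotNl. Qed.

Lemma dot0l x : dot 0 x = 0.
Proof. by rewrite -(scale0r x) dotZl mul0r. Qed.

Lemma dotDr x y z : dot x (y + z) = dot x y + dot x z.
Proof. by rewrite dotC dotDl !(dotC x). Qed.

Lemma dotZr a x y : dot x (a *: y) = a * dot x y.
Proof. by rewrite dotC dotZl dotC. Qed.

Lemma dotNr x y : dot x (- y) = - dot x y.
Proof. by rewrite dotC dotNl dotC. Qed.

Lemma dotBr x y z : dot x (y - z) = dot x y - dot x z.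
Proof. by rewrite dotDr dotNr. Qed.

Lemma dot0r x : dot x 0 = 0.
Proof. by rewrite dotC dot0l. Qed.

Definition dotE_lin := (dotDl, dotDr, dotBl, dotBr, dotZl, dotZr, dotNl, dotNr, dot0l, dot0r).

Lemma dot_suml (I : Type) (r : seq I) (P : pred I) (F : I -> V) y :
  dot (\sum_(i <- r | P i) F i) y = \sum_(i <- r | P i) dot (F i) y.
Proof.
by apply: (big_morph (fun x => dot x y)); [move=> *; exact: dotDl | exact: dot0l].
Qed.

Lemma dot_delta x i : dot x (delta_mx i ord0) = x i ord0.
Proof.
rewrite /dot (bigD1 i)//= mxE !eqxx mulr1 big1 ?addr0// => j ji.
by rewrite mxE (negPf ji) mulr0.
Qed.

Lemma dot_mulmx A x y : dot (A *m x) y = dot x (A^T *m y).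
Proof. by rewrite !dotE trmx_mul mulmxA. Qed.

Lemma outer_mulmx x y z : (x *m y^T) *m z = dot y z *: x.
Proof.
rewrite -mulmxA; apply/colP => i; rewrite !mxE big_ord1 mulrC.
by rewrite dotE.
Qed.

Lemma dot_ge0 x : 0 <= dot x x.
Proof. by apply: sumr_ge0 => i _; rewrite -expr2 sqr_ge0. Qed.

Lemma dot_eq0 x : (dot x x == 0) = (x == 0).
Proof.
apply/idP/eqP => [|->]; last by rewrite dot0l.
rewrite psumr_eq0 => [/allP h|i _]; last by rewrite -expr2 sqr_ge0.
apply/colP => i; rewrite mxE.
by have /implyP/(_ isT) := h i (mem_index_enum _); rewrite mulf_eq0 orbb => /eqP.
Qed.

Lemma dot_gt0 x : (0 < dot x x) = (x != 0).
Proof. by rewrite lt_def dot_ge0 andbT dot_eq0. Qed.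

(** For [a > 0] the vertex decides; for [a < 0], or [a = 0] with [b] nonzero, some point makes the
    quadratic negative. *)
Lemma discriminant_le (a b c : R) :
  (forall s, 0 <= a * s ^+ 2 + 2 * b * s + c) -> b ^+ 2 <= a * c.
Proof.
move=> h; have c0 := h 0; rewrite expr0n !mulr0 !add0r in c0.
have [a0|a0|a0] := ltrgtP a 0.
(* This [x] makes [a * x] outweigh the linear and constant terms, so the quadratic is negative at
   [1 + x]. *)
- have [x hx] : exists x : R, x = (1 + 2 * `|b| + c) / (- a) by eexists.
  have Na0 : 0 < - a by rewrite oppr_gt0.
  have b0 := normr_ge0 b; have := ler_norm b => b1.
  have hx' : - a * x = 1 + 2 * `|b| + c.
    by rewrite hx mulrC divfK// gt_eqF.
  have x0 : 0 < x by rewrite hx divr_gt0//; lra.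
  have h1 := h x; have h2 := h (1 + x).
  have : 0 <= a * (1 + x) ^+ 2 + 2 * b * (1 + x) + c by [].
  have -> : a * (1 + x) ^+ 2 + 2 * b * (1 + x) + c = a + a*x - (1+2 * `|b|+c)*(1+x) + 2*b*(1+x)+c.
    by rewrite -hx'; ring.
  move=> h3; exfalso.
  have : (2 * b - 2 * `|b|) * (1 + x) <= 0 by apply: mulr_le0_ge0; lra.
  have : 0 <= c * x by apply: mulr_ge0; lra.
  nra.
- have := h (- b / a).
  have -> : a * (- b / a) ^+ 2 + 2 * b * (- b / a) + c = (a * c - b ^+ 2) / a.
    by field; rewrite gt_eqF.
  by rewrite pmulr_lge0 ?invr_gt0// subr_ge0.
- rewrite a0 mul0r; have [->|b0] := eqVneq b 0; first by rewrite expr0n.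
  (* At this point the affine function takes the value -1. *)
  have := h (- (c + 1) / (2 * b)); rewrite a0 mul0r add0r.
  have -> : 2 * b * (- (c + 1) / (2 * b)) = - (c + 1) by field.
  by move=> h1; exfalso; lra.
Qed.

Lemma dot_CS x y : dot x y ^+ 2 <= dot x x * dot y y.
Proof.
apply: discriminant_le => s; have := dot_ge0 (s *: x + y).
rewrite !dotE_lin (dotC y x); nra.
Qed.

Lemma enorm_ge0 x : 0 <= enorm x.
Proof. exact: sqrtr_ge0. Qed.

Lemma sqr_enorm x : enorm x ^+ 2 = dot x x.
Proof. by rewrite sqr_sqrtr// dot_ge0. Qed.

Lemma enorm0 : enorm (0 : V) = 0.
Proof. by rewrite /enorm dot0l sqrtr0. Qed.

Lemma enorm_eq0 x : (enorm x == 0) = (x == 0).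
Proof. by rewrite -dot_eq0 -sqr_enorm sqrf_eq0. Qed.

Lemma enormZ a x : enorm (a *: x) = `|a| * enorm x.
Proof. by rewrite /enorm dotZl dotZr mulrA -expr2 sqrtrM ?sqr_ge0// sqrtr_sqr. Qed.

Lemma enormN x : enorm (- x) = enorm x.
Proof. by rewrite -scaleN1r enormZ normrN1 mul1r. Qed.

Lemma enorm_le x r : 0 <= r -> (enorm x <= r) = (dot x x <= r ^+ 2).
Proof. by move=> r0; rewrite -sqr_enorm ler_sqr ?nnegrE ?enorm_ge0. Qed.

Lemma enorm_lt x r : 0 <= r -> (enorm x < r) = (dot x x < r ^+ 2).
Proof. by move=> r0; rewrite -sqr_enorm ltr_sqr ?nnegrE ?enorm_ge0. Qed.

Lemma dot_le_enorm x y : `|dot x y| <= enorm x * enorm y.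
Proof.
rewrite -ler_sqr ?nnegrE ?mulr_ge0 ?enorm_ge0// exprMn !sqr_enorm.
by rewrite -normrX ger0_norm ?sqr_ge0// dot_CS.
Qed.

Lemma enormD x y : enorm (x + y) <= enorm x + enorm y.
Proof.
have a0 := enorm_ge0 x; have b0 := enorm_ge0 y.
rewrite enorm_le ?addr_ge0// !dotE_lin -!sqr_enorm (dotC y).
have := ler_norm (dot x y); have := dot_le_enorm x y; nra.
Qed.

Lemma enormB x y : enorm (x - y) <= enorm x + enorm y.
Proof. by rewrite (le_trans (enormD _ _))// enormN. Qed.

End InnerProduct.

(** * Newton steps with a truncated Neumann series *)

Section QuadraticForms.
Context {R : realType} {n : nat}.
Local Notation V := 'cV[R]_n.+1.
Implicit Types (x y z : V) (A : 'M[R]_n.+1).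

(** The Loewner order $kI\preceq A$ for symmetric [A]; [k = 0] is positive semidefiniteness. *)
Definition coercive (k : R) A :=
  A^T = A /\ forall z, k * dot z z <= dot (A *m z) z.

Lemma dot_sym A x y : A^T = A -> dot (A *m x) y = dot (A *m y) x.
Proof. by move=> sA; rewrite dot_mulmx sA dotC. Qed.

Lemma coercive_form_ge0 k A z : 0 <= k -> coercive k A -> 0 <= dot (A *m z) z.
Proof. by move=> k0 [_ /(_ z)]; apply: le_trans; rewrite mulr_ge0 ?dot_ge0. Qed.

Lemma coercive_le k k' A : k' <= k -> coercive k A -> coercive k' A.
Proof.
move=> kk [sA hA]; split=> // z; apply: le_trans (hA z).
by rewrite ler_wpM2r ?dot_ge0.
Qed.

Lemma coercive_scalar k : coercive k (k%:M : 'M[R]_n.+1).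
Proof. by split=> [|z]; rewrite ?tr_scalar_mx// mul_scalar_mx dotZl. Qed.

Lemma coerciveD k k' A A' : coercive k A -> coercive k' A' -> coercive (k + k') (A + A').
Proof.
move=> [sA hA] [sA' hA']; split=> [|z]; first by rewrite linearD/= sA sA'.
by rewrite mulmxDl dotDl mulrDl lerD.
Qed.

Lemma coercive_outer c x : 0 <= c -> coercive 0 (c *: (x *m x^T)).
Proof.
move=> c0; split=> [|z]; first by rewrite linearZ/= trmx_mul trmxK.
rewrite mul0r -scalemxAl outer_mulmx !dotZl -expr2 mulr_ge0// sqr_ge0//.
Qed.

Lemma coercive_sum (I : Type) (r : seq I) (F : I -> 'M[R]_n.+1) :
  (forall i, coercive 0 (F i)) -> coercive 0 (\sum_(i <- r) F i).
Proof.
move=> h; elim/big_rec: _ => [|i B _ hB].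
  by split=> [|z]; rewrite ?trmx0// mul0mx dot0l mul0r.
by rewrite -[0]addr0; apply: coerciveD.
Qed.

Lemma coercive_unit k A : 0 < k -> coercive k A -> A \in unitmx.
Proof.
move=> k0 [sA hA]; rewrite -row_free_unit -kermx_eq0; apply/eqP/row_matrixP => i; rewrite row0.
have : row i (kermx A) *m A = 0 by rewrite -row_mul mulmx_ker row0.
move: (row i _) => u uA.
have : dot (A *m u^T) u^T <= 0.
  by rewrite -[in A *m _]sA -trmx_mul uA trmx0 dot0l.
move/(le_trans (hA u^T)); rewrite pmulr_rle0// => h.
have /eqP : dot u^T u^T == 0 by rewrite eq_le h dot_ge0.
move/eqP; rewrite dot_eq0 => /eqP h'; by rewrite -[u]trmxK h' trmx0.
Qed.

Lemma form_CS A x y : coercive 0 A ->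
  dot (A *m x) y ^+ 2 <= dot (A *m x) x * dot (A *m y) y.
Proof.
move=> cA; have [sA _] := cA; apply: discriminant_le => s.
have := coercive_form_ge0 (s *: x + y) (lexx 0) cA.
by rewrite !mulmxDr -!scalemxAr !dotE_lin (dot_sym y x sA); nra.
Qed.

Lemma sym_invmx A : A^T = A -> (invmx A)^T = invmx A.
Proof. by move=> sA; rewrite trmx_inv sA. Qed.

End QuadraticForms.

Section NewtonStep.
Context {R : realType} {n : nat}.
Local Notation V := 'cV[R]_n.+1.
Variables (k theta : R) (Q : 'M[R]_n.+1).
Hypotheses (k_gt0 : 0 < k) (theta_k : 4 * `|theta| <= k) (cQ : coercive k Q).
Let P := Q + theta%:M.
Let H := invmx P.

Lemma shifted_coercive : coercive (3 / 4 * k) P.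
Proof.
split=> [|z]; first by rewrite /P linearD/= tr_scalar_mx cQ.1.
rewrite mulmxDl dotDl mul_scalar_mx dotZl.
have := cQ.2 z; have := dot_ge0 z; have := ler_normr theta (- theta).
have : - `|theta| <= theta by rewrite lerNl ler_normr lexx orbT.
move: theta_k; nra.
Qed.

Let P_unit : P \in unitmx.
Proof. by apply: coercive_unit shifted_coercive; rewrite mulr_gt0. Qed.

(** On an eigenvector of [Q] with eigenvalue $\lambda\ge k$, [theta H] acts as
    $\theta/(\lambda+\theta)$, of modulus at most $(k/4)/(3k/4)=1/3$. Without diagonalising, one
    writes [z = P y] and compares the moments of [Q] at [y], using [k * c <= b] and [k * b <= a]. *)
Lemma shifted_inv_contract (z : V) :
  dot (Q *m (theta *: (H *m z))) (theta *: (H *m z)) <= (1 / 3) ^+ 2 * dot (Q *m z) z.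
Proof.
have [y ->] : exists y, z = P *m y by exists (H *m z); rewrite mulmxA mulmxV// mul1mx.
rewrite (mulmxA H) mulVmx// mul1mx /P mulmxDl mul_scalar_mx.
have [sQ hQ] := cQ; set c := dot (Q *m y) y.
have c0 : 0 <= c by apply: (coercive_form_ge0 _ _ cQ); exact: ltW.
set b := dot (Q *m y) (Q *m y); set a := dot (Q *m (Q *m y)) (Q *m y).
have ab : k * b <= a by exact: hQ.
have bc : k * c <= b.
  have [y0|y0] := eqVneq y 0.
    by rewrite /b /c y0 mulmx0 !dot0l mulr0.
  have y1 : 0 < dot y y by rewrite dot_gt0.
  have h1 := dot_CS (Q *m y) y; rewrite -/c -/b in h1.
  have h2 : k * dot y y <= c := hQ y.
  rewrite -(ler_pM2r y1); apply: le_trans h1.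
  by rewrite expr2 mulrAC ler_wpM2r.
have -> : dot (Q *m (theta *: y)) (theta *: y) = theta ^+ 2 * c.
  by rewrite -scalemxAr dotZl dotZr mulrA.
have -> : dot (Q *m (Q *m y + theta *: y)) (Q *m y + theta *: y)
    = a + 2 * theta * b + theta ^+ 2 * c.
  rewrite mulmxDr -scalemxAr !dotE_lin (dot_sym (Q *m y) y sQ) -/a -/b -/c; ring.
have t1 : - `|theta| <= theta by rewrite lerNl ler_normr lexx orbT.
have t0 := normr_ge0 theta; have tk := theta_k.
rewrite -[theta ^+ 2]real_normK ?num_real//.
have b0 : 0 <= b by apply: dot_ge0.
have e1 : 0 <= b * (theta + `|theta|) by apply: mulr_ge0 => //; lra.
have e2 : (k - 2 * `|theta|) * (k * c) <= (k - 2 * `|theta|) * b.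
  by rewrite ler_wpM2l//; lra.
have e3 : 8 * `|theta| ^+ 2 * c <= (k - 2 * `|theta|) * (k * c).
  rewrite mulrA ler_wpM2r//.
  have : 0 <= (k - 4 * `|theta|) * (k + 2 * `|theta|).
    by rewrite mulr_ge0// ?subr_ge0// addr_ge0 ?(ltW k_gt0)// mulr_ge0.
  lra.
lra.
Qed.

(** As [Q = P - theta], each term telescopes: $QH^{j+1}=H^j-\theta H^{j+1}$. *)
Lemma newton_residual (m : nat) (g : V) :
  Q *m (\sum_(1 <= j < m.+1) theta ^+ j.-1 *: (H ^+ j *m g))
  = g - theta ^+ m *: (H ^+ m *m g).
Proof.
elim: m => [|m IH]; first by rewrite big_geq// mulmx0 !expr0 mul1mx scale1r subrr.
rewrite big_nat_recr//= mulmxDr IH -scalemxAr.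
have -> : Q *m (H ^+ m.+1 *m g) = H ^+ m *m g - theta *: (H ^+ m.+1 *m g).
  have -> : Q = P - theta%:M by rewrite addrK.
  rewrite mulmxBl mul_scalar_mx; congr (_ - _).
  by rewrite exprS -mulmxE !mulmxA mulmxV// mul1mx.
by rewrite scalerBr scalerA -exprSr addrA subrK.
Qed.

(** The dual norm for [Q] is expressed by test vectors, which avoids [invmx Q]. Since [H] is
    symmetric, each factor [theta H] moves to the test vector, where it contracts. *)
Lemma dual_bound_contract (r : R) (g : V) (m : nat) :
  (forall z, dot g z ^+ 2 <= r ^+ 2 * dot (Q *m z) z) ->
  forall z, dot (theta ^+ m *: (H ^+ m *m g)) z ^+ 2
    <= ((1 / 3) ^+ m * r) ^+ 2 * dot (Q *m z) z.
Proof.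
move=> hg; elim: m => [|m IH] z; first by rewrite !expr0 mul1mx scale1r mul1r.
have -> : dot (theta ^+ m.+1 *: (H ^+ m.+1 *m g)) z
        = dot (theta ^+ m *: (H ^+ m *m g)) (theta *: (H *m z)).
  have sH : H^T = H by apply: sym_invmx; exact: shifted_coercive.1.
  rewrite exprS [H ^+ _]exprS -mulmxE -mulmxA !dotZl dotZr dot_mulmx sH; ring.
apply: (le_trans (IH _)); have h := shifted_inv_contract z.
have -> : ((1 / 3) ^+ m.+1 * r) ^+ 2 * dot (Q *m z) z
    = ((1 / 3) ^+ m * r) ^+ 2 * ((1 / 3) ^+ 2 * dot (Q *m z) z) by rewrite [(1 / 3) ^+ m.+1]exprS; ring.
by rewrite ler_wpM2l// sqr_ge0.
Qed.

End NewtonStep.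

(** * The logarithmic barrier *)

Section BarrierReals.
Context {R : realType}.
Implicit Types q s k u m sz qz : R.

Lemma sqr_le_abs (x y : R) : 0 <= y -> x ^+ 2 <= y ^+ 2 -> `|x| <= y.
Proof.
by move=> y0; rewrite -[x ^+ 2]real_normK ?num_real// ler_sqr ?nnegrE ?normr_ge0.
Qed.

(** With $D=1-\|x\|^2$, [q] is $\|h\|^2/D$ and [s] is $\langle x,h\rangle/D$. Then
    $1-\|x+h\|^2=D(1-(2s+q))$, and the Hessian form of the barrier at [h] is $2e(q+2s^2)$. The bound
    1/220 is 1/10 divided by 2 * 11. *)
Lemma barrier_kappa_sqr q s : 0 <= q -> q + 2 * s ^+ 2 <= 1 / 220 ->
  (2 * s + q) ^+ 2 <= 2 * (q + 2 * s ^+ 2) - q.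
Proof.
move=> q0 h; have s1 : `|s| <= 1 / 20.
  by apply: sqr_le_abs; [lra|have := sqr_ge0 s; nra].
have s2 : s <= 1 / 20 by apply: le_trans s1; exact: ler_norm.
have s3 := sqr_ge0 s.
have h1 : q * (4 * s + q) <= q * 1 by rewrite ler_wpM2l//; nra.
nra.
Qed.

Lemma barrier_kappa_small q s : 0 <= q -> q + 2 * s ^+ 2 <= 1 / 220 ->
  `|2 * s + q| <= 1 / 10.
Proof.
move=> q0 h; apply: sqr_le_abs; first lra.
by have := barrier_kappa_sqr q0 h; lra.
Qed.

(** Up to the factor $2e$, the squared quantity is the Taylor remainder of the barrier gradient
    tested on [z]; [sz], [qz], [m] are $\langle x,z\rangle/D$, $\|z\|^2/D$, $\langle h,z\rangle/D$.
    A weighted Cauchy-Schwarz inequality separates [z] from [h]. *)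
Lemma barrier_error_real q s u sz qz m :
  let k := 2 * s + q in let b2 := q + 2 * s ^+ 2 in
  0 <= q -> b2 <= 1 / 220 -> 0 <= qz -> m ^+ 2 <= q * qz ->
  u * (1 - k) = 1 ->
  (sz * (k ^+ 2 * u + q) + m * (k * u)) ^+ 2
    <= (2 * sz ^+ 2 + qz) * (300 / 81 * b2 ^+ 2).
Proof.
move=> k b2 q0 hb qz0 hm hu.
have k1 := barrier_kappa_small q0 hb; have k2 := barrier_kappa_sqr q0 hb.
rewrite -/k -/b2 in k1 k2.
have [kl ku] : - (1/10) <= k /\ k <= 1/10 by apply/andP; rewrite -ler_norml.
have u0 : 0 < u.
  rewrite ltNge; apply/negP => u0; have : u * (1 - k) <= 0 by apply: mulr_le0_ge0 => //; lra.
  by rewrite hu ler10.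
have u1 : u <= 10 / 9.
  have : u * (9 / 10) <= u * (1 - k) by rewrite ler_pM2l//; lra.
  by rewrite hu; lra.
set A := k ^+ 2 * u + q.
have kk := sqr_ge0 k.
have A0 : 0 <= A by rewrite addr_ge0// mulr_ge0// ltW.
have A1 : A <= 10 / 9 * (k ^+ 2 + q).
  have : k ^+ 2 * u <= k ^+ 2 * (10 / 9) by rewrite ler_wpM2l.
  by rewrite /A; lra.
have qk : q * (k * u) ^+ 2 <= 100 / 81 * (q * k ^+ 2).
  have : u ^+ 2 <= 100 / 81 by nra.
  move=> u2; rewrite exprMn mulrA [leRHS]mulrC ler_wpM2l// mulr_ge0//.
(* The factor 100/81 bounds $u^2$. With $k^2\le 2b_2-q$, what is left is at most
   $2b_2^2+2b_2q-q^2\le 3b_2^2$. *)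
have bd : A ^+ 2 / 2 + q * (k * u) ^+ 2 <= 300 / 81 * b2 ^+ 2.
  have A2 : A ^+ 2 <= 100 / 81 * (k ^+ 2 + q) ^+ 2.
    have -> : 100 / 81 * (k ^+ 2 + q) ^+ 2 = (10 / 9 * (k ^+ 2 + q)) ^+ 2 by field.
    by rewrite ler_sqr// nnegrE//; nra.
  have qb : q <= b2 by rewrite /b2 lerDl mulr_ge0// sqr_ge0.
  set K := k ^+ 2 in k2 kk qk A2 *.
  have h1 : K ^+ 2 <= (2 * b2 - q) ^+ 2 by rewrite ler_sqr// nnegrE; lra.
  have h2 : K * q <= (2 * b2 - q) * q by rewrite ler_wpM2r.
  have h3 : 0 <= (b2 - q) ^+ 2 by rewrite sqr_ge0.
  nra.
have [q1|q1] := eqVneq q 0.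
  have m0 : m = 0.
    by apply/eqP; rewrite -sqrf_eq0 eq_le sqr_ge0 andbT (le_trans hm)// q1 mul0r.
  rewrite m0 mul0r addr0 exprMn.
  have := sqr_ge0 sz; rewrite q1 mul0r addr0 in bd.
  move=> s0; have : sz ^+ 2 * (A ^+ 2 / 2) <= sz ^+ 2 * (300 / 81 * b2 ^+ 2) by rewrite ler_wpM2l.
  have : 0 <= qz * (300 / 81 * b2 ^+ 2) by rewrite mulr_ge0// mulr_ge0 ?sqr_ge0//; clear; lra.
  lra.
have q2 : 0 < q by rewrite lt_def q1.
set w := m * (k * u).
have hw : w ^+ 2 <= qz * (q * (k * u) ^+ 2).
  have -> : qz * (q * (k * u) ^+ 2) = (q * qz) * (k * u) ^+ 2 by ring.
  by rewrite /w [in leLHS]exprMn ler_wpM2r ?sqr_ge0.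
set Y := q * (k * u) ^+ 2 in bd hw.
have Y0 : 0 <= Y by rewrite mulr_ge0// sqr_ge0.
have s0 := sqr_ge0 sz.
have cs : (sz * A + w) ^+ 2 <= (2 * sz ^+ 2 + qz) * (A ^+ 2 / 2 + Y).
  have [Y1|Y1] := eqVneq Y 0.
    have w0 : w = 0 by apply/eqP; rewrite -sqrf_eq0 eq_le sqr_ge0 andbT (le_trans hw)// Y1 mulr0.
    rewrite w0 Y1 !addr0 exprMn; have : 0 <= qz * (A ^+ 2 / 2) by rewrite mulr_ge0// divr_ge0// sqr_ge0.
    lra.
  have Y2 : 0 < Y by rewrite lt_def Y1.
  have h1 : 0 <= (2 * sz * Y - w * A) ^+ 2 by rewrite sqr_ge0.
  have h2 : w ^+ 2 * (A ^+ 2 / 2 + Y) <= qz * Y * (A ^+ 2 / 2 + Y).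
    by rewrite ler_wpM2r// addr_ge0// divr_ge0// sqr_ge0.
  rewrite -(ler_pM2r Y2); nra.
apply: (le_trans cs); rewrite ler_wpM2l//; lra.
Qed.

(** From $u\ge 10/11$ the diagonal terms lose little; the cross term [sz * m] is absorbed by the
    square of [15 / 100 * sz + m], as $m^2\le q_z/220$. *)
Lemma barrier_hessian_real q s u sz qz m :
  let k := 2 * s + q in
  0 <= q -> q + 2 * s ^+ 2 <= 1 / 220 -> 0 <= qz -> m ^+ 2 <= q * qz ->
  u * (1 - k) = 1 ->
  7 / 10 * (qz + 2 * sz ^+ 2) <= u * qz + 2 * (u * (sz + m)) ^+ 2.
Proof.
move=> k q0 hb qz0 hm hu; have k1 := barrier_kappa_small q0 hb.
rewrite -/k in k1.
have [kl ku] : - (1/10) <= k /\ k <= 1/10 by apply/andP; rewrite -ler_norml.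
have u0 : 0 < u.
  rewrite ltNge; apply/negP => u0; have : u * (1 - k) <= 0 by apply: mulr_le0_ge0 => //; lra.
  by rewrite hu ler10.
have u1 : 10 / 11 <= u.
  have : u * (1 - k) <= u * (11 / 10) by rewrite ler_pM2l//; lra.
  by rewrite hu; lra.
have u2 : 100 / 121 <= u ^+ 2 by nra.
have s2 := sqr_ge0 s.
have m1 : m ^+ 2 <= 1 / 220 * qz by apply: le_trans hm _; rewrite ler_wpM2r//; lra.
have h1 : 100 / 121 * (sz + m) ^+ 2 <= (u * (sz + m)) ^+ 2.
  by rewrite exprMn ler_wpM2r// sqr_ge0.
have h2 : 10 / 11 * qz <= u * qz by rewrite ler_wpM2r.
have h3 : 0 <= (15 / 100 * sz + m) ^+ 2 by rewrite sqr_ge0.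
have h4 := sqr_ge0 sz; have h5 := sqr_ge0 m.
nra.
Qed.

End BarrierReals.

Section BarrierStep.
Context {R : realType} {n : nat}.
Local Notation V := 'cV[R]_n.+1.
Variables (e : R) (e_ge : 11 <= e).
Implicit Types x h z : V.

(** Gradient and Hessian of $-e\ln(1-\|x\|^2)$; in the application [e] is [eta * d]. *)
Definition bgrad x : V := (2 * e / (1 - dot x x)) *: x.
Definition bhess x : 'M[R]_n.+1 :=
  (2 * e / (1 - dot x x))%:M + (4 * e / (1 - dot x x) ^+ 2) *: (x *m x^T).

Lemma bhess_form x z : dot (bhess x *m z) z
  = 2 * e * (dot z z / (1 - dot x x) + 2 * (dot x z / (1 - dot x x)) ^+ 2).
Proof.
rewrite mulmxDl dotDl mul_scalar_mx dotZl -scalemxAl outer_mulmx !dotZl expr_div_n.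
ring.
Qed.

Lemma bhess_coercive x : dot x x < 1 -> coercive (2 * e / (1 - dot x x)) (bhess x).
Proof.
move=> x1; rewrite /bhess -[X in coercive X _]addr0; apply: coerciveD.
  exact: coercive_scalar.
by apply: coercive_outer; rewrite divr_ge0 ?sqr_ge0// mulr_ge0//; have := e_ge; lra.
Qed.

Section Step.
Variables x h : V.
Hypotheses (x1 : dot x x < 1) (hh : dot (bhess x *m h) h <= 1 / 10).
Let D := 1 - dot x x.
Let q := dot h h / D.
Let s := dot x h / D.
Let k := 2 * s + q.
Let D0 : 0 < D. Proof. by rewrite subr_gt0. Qed.
Let q0 : 0 <= q. Proof. by rewrite divr_ge0 ?dot_ge0// ltW. Qed.

Let form_h : dot (bhess x *m h) h = 2 * e * (q + 2 * s ^+ 2).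
Proof. exact: bhess_form. Qed.

Let b2 : q + 2 * s ^+ 2 <= 1 / 220.
Proof.
have := hh; rewrite form_h => h1.
have h0 : 0 <= q + 2 * s ^+ 2 by rewrite addr_ge0// mulr_ge0// sqr_ge0.
have : 22 * (q + 2 * s ^+ 2) <= 2 * e * (q + 2 * s ^+ 2).
  rewrite ler_wpM2r//. have := e_ge; lra.
lra.
Qed.

(** The size of [k'] keeps [x + h] in the open ball; the bound on [e * k' ^+ 2] later controls the
    variation of $\ln(1-\|x\|^2)$. *)
Lemma barrier_ratio : exists k',
  [/\ 1 - dot (x + h) (x + h) = (1 - dot x x) * (1 - k'), `|k'| <= 1 / 10
    & e * k' ^+ 2 <= dot (bhess x *m h) h].
Proof.
exists k; split; last 2 first.
- exact: barrier_kappa_small.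
- rewrite form_h; have := barrier_kappa_sqr q0 b2; rewrite -/k => h1.
  have h2 : e * k ^+ 2 <= e * (2 * (q + 2 * s ^+ 2)) by rewrite ler_wpM2l//; have := e_ge; have := q0; lra.
  by apply: le_trans h2 _; rewrite mulrCA mulrA.
- rewrite !dotE_lin (dotC h x) /k /s /q -/D mulrBr mulrDr mulr1.
  have -> : D * (2 * (dot x h / D)) = 2 * dot x h by field; rewrite gt_eqF.
  have -> : D * (dot h h / D) = dot h h by field; rewrite gt_eqF.
  rewrite /D; ring.
Qed.

Let D'E : 1 - dot (x + h) (x + h) = D * (1 - k).
Proof.
rewrite !dotE_lin (dotC h x) /k /s /q -/D mulrBr mulrDr mulr1.
have -> : D * (2 * (dot x h / D)) = 2 * dot x h by field; rewrite gt_eqF.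
have -> : D * (dot h h / D) = dot h h by field; rewrite gt_eqF.
rewrite /D; ring.
Qed.

Let k1 : 0 < 1 - k.
Proof. by have := barrier_kappa_small q0 b2; rewrite -/k ler_norml => /andP[]; lra. Qed.

Let m_le z : (dot h z / D) ^+ 2 <= q * (dot z z / D).
Proof.
have -> : q * (dot z z / D) = (dot h h * dot z z) * (D^-1 ^+ 2) by rewrite /q; ring.
by rewrite exprMn ler_wpM2r ?sqr_ge0// dot_CS.
Qed.

(** Self-concordance: in the dual norm at [x], the remainder of the gradient is quadratic in the
    local norm of [h]. *)
Lemma barrier_gradient_error z :
  dot (bgrad (x + h) - bgrad x - bhess x *m h) z ^+ 2
    <= 17 / 100 * dot (bhess x *m h) h ^+ 2 * dot (bhess x *m z) z.
Proof.
set u := (1 - k)^-1; have hu : u * (1 - k) = 1 by rewrite mulVf// gt_eqF.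
set sz := dot x z / D; set qz := dot z z / D; set m := dot h z / D.
have qz0 : 0 <= qz by rewrite divr_ge0 ?dot_ge0// ltW.
have -> : dot (bgrad (x + h) - bgrad x - bhess x *m h) z
    = 2 * e * (sz * (k ^+ 2 * u + q) + m * (k * u)).
  rewrite /bgrad D'E /bhess mulmxDl mul_scalar_mx -scalemxAl outer_mulmx !dotE_lin -/D.
  rewrite /sz /m /u.
  have Dn0 : D != 0 by rewrite gt_eqF.
  have kn0 : 1 - k != 0 by rewrite gt_eqF.
  have -> : dot x h = s * D by rewrite /s divfK.
  have -> : q = k - 2 * s by rewrite /k; ring.
  by field; rewrite Dn0 kn0.
rewrite form_h bhess_form -/D -/qz -/sz.
have e0 : 0 < e by have := e_ge; lra.
have := @barrier_error_real _ q s u sz qz m q0 b2 qz0 (m_le z) hu.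
rewrite -/k => h1; set E := sz * _ + _ in h1 *; set b := q + _ in h1 *.
set z2 := 2 * sz ^+ 2 + qz in h1.
have -> : qz + 2 * sz ^+ 2 = z2 by rewrite addrC.
have z20 : 0 <= z2 by rewrite addr_ge0// mulr_ge0// sqr_ge0.
have -> : (2 * e * E) ^+ 2 = 4 * e ^+ 2 * E ^+ 2 by ring.
have h2 : 4 * e ^+ 2 * E ^+ 2 <= 4 * e ^+ 2 * (z2 * (300 / 81 * b ^+ 2)).
  by rewrite ler_wpM2l// mulr_ge0// sqr_ge0.
apply: (le_trans h2).
have -> : 4 * e ^+ 2 * (z2 * (300 / 81 * b ^+ 2)) = (300 / 81 * 4) * (e ^+ 2 * z2 * b ^+ 2) by ring.
have -> : 17 / 100 * (2 * e * b) ^+ 2 * (2 * e * z2) = (17 / 100 * 8 * e) * (e ^+ 2 * z2 * b ^+ 2) by ring.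
(* It remains to see [300 / 81 * 4 <= 17 / 100 * 8 * e], which [e >= 11] gives. *)
rewrite ler_wpM2r//; last by have := e_ge; lra.
by rewrite mulr_ge0 ?sqr_ge0// mulr_ge0 ?sqr_ge0.
Qed.

Lemma barrier_hessian_le z :
  7 / 10 * dot (bhess x *m z) z <= dot (bhess (x + h) *m z) z.
Proof.
set u := (1 - k)^-1; have hu : u * (1 - k) = 1 by rewrite mulVf// gt_eqF.
set sz := dot x z / D; set qz := dot z z / D; set m := dot h z / D.
have qz0 : 0 <= qz by rewrite divr_ge0 ?dot_ge0// ltW.
have e0 : 0 < e by have := e_ge; lra.
rewrite !bhess_form D'E -/D -/qz -/sz.
have -> : dot z z / (D * (1 - k)) = u * qz.
  by rewrite /qz /u invfM; ring.
have -> : dot (x + h) z / (D * (1 - k)) = u * (sz + m).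
  by rewrite dotDl /sz /m /u invfM; ring.
rewrite [leLHS]mulrCA ler_pM2l; last by rewrite mulr_gt0.
exact: (@barrier_hessian_real _ q s u sz qz m q0 b2 qz0 (m_le z) hu).
Qed.

End Step.

(** From $\ln r\le r-1$ at $r=D'/D$ and the convexity of the squared norm. *)
Lemma barrier_convex x y : dot x x < 1 -> dot y y < 1 ->
  dot (bgrad x) (y - x) <= - e * ln (1 - dot y y) - - e * ln (1 - dot x x).
Proof.
move=> x1 y1; set D := 1 - dot x x; set D' := 1 - dot y y.
have D0 : 0 < D by rewrite subr_gt0.
have D'0 : 0 < D' by rewrite subr_gt0.
have h1 : ln (D' / D) <= D' / D - 1.
  have := @le_ln1Dx R (D' / D - 1).
  have -> : 1 + (D' / D - 1) = D' / D by ring.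
  by apply; rewrite ltrBrDl subrr divr_gt0.
rewrite ln_div ?posrE// in h1.
have h2 : D' / D - 1 <= - (2 * dot x (y - x)) / D.
  rewrite ler_pdivlMr// mulrBl divfK ?gt_eqF// mul1r.
  have := dot_ge0 (y - x); rewrite /D /D' !dotE_lin (dotC y x); lra.
rewrite /bgrad dotZl -/D.
have e0 : 0 < e by have := e_ge; lra.
have : e * (ln D' - ln D) <= e * (- (2 * dot x (y - x)) / D).
  by rewrite ler_pM2l//; lra.
have -> : 2 * e / D * dot x (y - x) = - (e * (- (2 * dot x (y - x)) / D)) by ring.
lra.
Qed.

End BarrierStep.

(** * The OQNS objective *)

Section Objective.
Context {R : realType} {n : nat}.
Local Notation V := 'cV[R]_n.+1.
Local Notation d := (n.+1%:R : R).
Implicit Types (x z v : V) (w g : nat -> V) (t : nat).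

(** On a line [Phi] is the logarithm of a quadratic plus a quadratic, so its partial derivatives
    reduce to one real variable. *)
Lemma derive_line (f : V -> R) x v :
  'D_v f x = 'D_1 (fun s : R => f (s *: v + x)) 0.
Proof.
have E h : h^-1 *: ((f \o shift x) (h *: v) - f x) = h^-1 *:
    (((fun s : R => f (s *: v + x)) \o shift 0) (h *: (1 : R)) - f (0 *: v + x)).
  by rewrite /= addr0 scale0r add0r; congr (_ *: (f (_ *: v + x) - _)); rewrite [RHS]mulr1.
by rewrite /derive; under eq_fun do rewrite E.
Qed.

Lemma is_derive_quad (p0 p1 p2 : R) :
  is_derive (0 : R) 1 (fun s => p0 + p1 * s + p2 * s ^+ 2) p1.
Proof.
have -> : (fun s => p0 + p1 * s + p2 * s ^+ 2)
    = horner (p0%:P + p1 *: 'X + p2 *: 'X^2).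
  by apply/funext => s; rewrite !hornerE.
have := is_derive_poly (p0%:P + p1 *: 'X + p2 *: 'X^2) (0 : R).
by rewrite !derivD !derivZ derivC derivX derivXn !hornerE.
Qed.

Lemma is_derive_ln_quad (e a b c p0 p1 p2 : R) : a < 1 ->
  is_derive (0 : R) 1 (fun s => - e * ln (1 - (a + 2 * b * s + c * s ^+ 2))
    + (p0 + p1 * s + p2 * s ^+ 2)) (2 * e / (1 - a) * b + p1).
Proof.
move=> a1.
have q1 := is_derive_quad (1 - a) (- (2 * b)) (- c).
have q2 := is_derive_quad p0 p1 p2.
pose G s : R := (1 - a) + - (2 * b) * s + - c * s ^+ 2.
have E0 : G 0 = 1 - a by rewrite /G expr0n !(mulr0, addr0).
have l1 : is_derive (G 0) 1 (@ln R) (1 - a)^-1.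
  by rewrite E0; apply: is_derive1_ln; rewrite subr_gt0.
have q3 := is_deriveZ (- e) (is_derive1_comp l1 q1).
have := is_deriveD q3 q2.
have -> : (- e) \*: (@ln R \o (fun s => 1 - a + - (2 * b) * s + - c * s ^+ 2))
   + (fun s => p0 + p1 * s + p2 * s ^+ 2)
  = (fun s => - e * ln (1 - (a + 2 * b * s + c * s ^+ 2)) + (p0 + p1 * s + p2 * s ^+ 2)).
  apply/funext => s.
  change (- e * ln (1 - a + - (2 * b) * s + - c * s ^+ 2) + (p0 + p1 * s + p2 * s ^+ 2)
    = - e * ln (1 - (a + 2 * b * s + c * s ^+ 2)) + (p0 + p1 * s + p2 * s ^+ 2)).
  by congr (_ * ln _ + _); ring.
have -> // : - e *: ((1 - a)^-1 * - (2 * b)) + p1 = 2 * e / (1 - a) * b + p1.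
by rewrite /GRing.scale/=; ring.
Qed.

Variables (B eta beta : R).
Let e := eta * d.
Let reg := d + eta * B ^+ 2.

Definition pgrad w g t x : V :=
  bgrad e x + reg *: x + beta *: (\sum_(s < t) dot (g s) (x - w s) *: g s)
  + \sum_(s < t) g s.

(** Hessian of [Phi] without the barrier. It does not depend on the point, and its determinant
    serves as the potential. *)
Definition pform (g : nat -> V) t : 'M[R]_n.+1 :=
  reg%:M + beta *: \sum_(s < t) g s *m (g s)^T.

Definition phess g t x : 'M[R]_n.+1 := bhess e x + pform g t.

Lemma PhiE w g t x : Phi B eta beta w g t x =
  - e * ln (1 - dot x x) + (reg / 2 * dot x x
  + beta / 2 * (\sum_(s < t) dot (g s) (x - w s) ^+ 2) + dot x (\sum_(s < t) g s)).
Proof.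
rewrite /Phi /barrier sqr_enorm /e /reg (mulrC eta (B ^+ 2)) mulNr -!addrA; ring.
Qed.

Lemma Phi_line w g t x v s : Phi B eta beta w g t (s *: v + x) =
  - e * ln (1 - (dot x x + 2 * dot x v * s + dot v v * s ^+ 2)) +
  ((reg / 2 * dot x x + beta / 2 * (\sum_(j < t) dot (g j) (x - w j) ^+ 2)
    + dot x (\sum_(j < t) g j))
  + (reg * dot x v + beta * (\sum_(j < t) dot (g j) (x - w j) * dot (g j) v)
    + dot v (\sum_(j < t) g j)) * s
  + (reg / 2 * dot v v + beta / 2 * (\sum_(j < t) dot (g j) v ^+ 2)) * s ^+ 2).
Proof.
rewrite PhiE.
have -> : dot (s *: v + x) (s *: v + x) = dot x x + 2 * dot x v * s + dot v v * s ^+ 2.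
  rewrite !dotE_lin (dotC v x); ring.
have -> : \sum_(j < t) dot (g j) (s *: v + x - w j) ^+ 2
  = \sum_(j < t) dot (g j) (x - w j) ^+ 2
    + 2 * s * (\sum_(j < t) dot (g j) (x - w j) * dot (g j) v)
    + s ^+ 2 * (\sum_(j < t) dot (g j) v ^+ 2).
  rewrite !mulr_sumr -!big_split/=; apply: eq_bigr => j _.
  have -> : s *: v + x - w j = s *: v + (x - w j) by rewrite addrA.
  by rewrite [dot (g j) (s *: v + _)]dotDr dotZr; ring.
rewrite dotDl dotZl; congr (_ + _).
move: (\sum_(_ < t) _) (\sum_(_ < t) _) (\sum_(_ < t) dot _ _ ^+ 2) => S1 S2 S3.
by field.
Qed.

Lemma dot_pgrad w g t x v : dot (pgrad w g t x) v =
  2 * e / (1 - dot x x) * dot x v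
  + (reg * dot x v + beta * (\sum_(j < t) dot (g j) (x - w j) * dot (g j) v)
    + dot v (\sum_(j < t) g j)).
Proof.
rewrite /pgrad /bgrad !dotDl !dotZl (dotC v) dot_suml -!addrA; congr (_ + (_ + (_ * _ + _))).
by apply: eq_bigr => j _; rewrite dotZl.
Qed.

Lemma gradient_Phi w g t x : dot x x < 1 ->
  gradient (Phi B eta beta w g t) x = pgrad w g t x.
Proof.
move=> x1; apply/colP => i; rewrite mxE -dot_delta dot_pgrad derive_line.
under eq_fun do rewrite Phi_line.
exact: (@derive_val _ _ _ _ _ _ _ (is_derive_ln_quad _ _ _ _ _ _ x1)).
Qed.

(** Only the barrier leaves a remainder, all other terms of [Phi] being quadratic. *)
Lemma pgrad_expand w g t x h :
  pgrad w g t (x + h)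
  = pgrad w g t x + phess g t x *m h + (bgrad e (x + h) - bgrad e x - bhess e x *m h).
Proof.
rewrite /pgrad /phess /pform; move: (bhess e x) => b3.
rewrite !mulmxDl mul_scalar_mx -scalemxAl mulmx_suml.
have -> : \sum_(s < t) dot (g s) (x + h - w s) *: g s
   = \sum_(s < t) dot (g s) (x - w s) *: g s + \sum_(s < t) g s *m (g s)^T *m h.
  rewrite -big_split/=; apply: eq_bigr => s _.
  by rewrite outer_mulmx addrAC [dot (g s) (x - w s + h)]dotDr scalerDl.
rewrite !scalerDr; move: (bgrad e _) (bgrad e x) (b3 *m h) (\sum_(_ < t) g _).
move: (reg *: x) (reg *: h) (beta *: _) (beta *: _) => a b c1 c2 b1 b2 b4 S.
by apply/colP => i; rewrite !mxE; ring.
Qed.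

Hypotheses (e_ge : 11 <= e) (reg_ge0 : 0 <= reg) (beta_ge0 : 0 <= beta).

Lemma pform_coercive g t : coercive reg (pform g t).
Proof.
rewrite /pform -[X in coercive X _]addr0; apply: coerciveD.
  exact: coercive_scalar.
rewrite scaler_sumr; apply: coercive_sum => s; exact: coercive_outer.
Qed.

Lemma phess_coercive g t x : dot x x < 1 ->
  coercive (2 * e / (1 - dot x x) + reg) (phess g t x).
Proof. by move=> x1; apply: coerciveD (pform_coercive _ _); exact: bhess_coercive. Qed.

Lemma phess_formE g t x z : dot (phess g t x *m z) z
  = dot (bhess e x *m z) z + dot (pform g t *m z) z.
Proof. by rewrite -dotDl -mulmxDl. Qed.

Lemma phess_ge_bhess g t x z : dot (bhess e x *m z) z <= dot (phess g t x *m z) z.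
Proof.
rewrite phess_formE lerDl; apply: (coercive_form_ge0 (k := 0)) => //.
exact: (coercive_le reg_ge0 (pform_coercive g t)).
Qed.

Lemma phess_form_ge0 g t x z : dot x x < 1 -> 0 <= dot (phess g t x *m z) z.
Proof.
move=> x1; apply: (coercive_form_ge0 (k := 0)) => //.
apply: coercive_le (phess_coercive g t x1); rewrite addr_ge0// divr_ge0//; have := e_ge; lra.
Qed.

Lemma phessS g t x z :
  dot (phess g t.+1 x *m z) z = dot (phess g t x *m z) z + beta * dot (g t) z ^+ 2.
Proof.
have E : pform g t.+1 = pform g t + beta *: (g t *m (g t)^T).
  by rewrite /pform big_ord_recr/= scalerDr addrA.
rewrite !phess_formE E [(pform g t + _) *m z]mulmxDl [dot (_ + _) z]dotDl addrA.
by rewrite -scalemxAl outer_mulmx !dotZl expr2.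
Qed.

Lemma pgradS w g t : pgrad w g t.+1 (w t) = pgrad w g t (w t) + g t.
Proof.
rewrite /pgrad !big_ord_recr/= subrr dot0r scale0r addr0.
by rewrite !addrA.
Qed.

Lemma PhiS w g t :
  Phi B eta beta w g t.+1 (w t) = Phi B eta beta w g t (w t) + dot (g t) (w t).
Proof.
rewrite !PhiE !big_ord_recr/= subrr dot0r expr0n addr0 dotDr (dotC (g t)).
by rewrite !addrA.
Qed.

Lemma Phi_convex w g t x y : dot x x < 1 -> dot y y < 1 ->
  Phi B eta beta w g t x + dot (pgrad w g t x) (y - x) <= Phi B eta beta w g t y.
Proof.
move=> x1 y1; have [h yE] : exists h, y = 1 *: h + x.
  by exists (y - x); rewrite scale1r subrK.
have hE : y - x = h by rewrite yE scale1r addrK.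
have := barrier_convex e_ge x1 y1; rewrite hE.
have -> : ln (1 - dot y y) = ln (1 - (dot x x + 2 * dot x h * 1 + dot h h * 1 ^+ 2)).
  by congr (ln (1 - _)); rewrite yE !dotE_lin (dotC h x); ring.
rewrite yE Phi_line dot_pgrad PhiE /bgrad dotZl.
have : 0 <= reg / 2 * dot h h + beta / 2 * (\sum_(j < t) dot (g j) h ^+ 2).
  rewrite addr_ge0// mulr_ge0 ?dot_ge0 ?divr_ge0//.
  by apply: sumr_ge0 => j _; rewrite sqr_ge0.
lra.
Qed.

Lemma dual_bound_add (x y Q l m : R) : 0 <= l -> 0 <= m -> 0 <= Q ->
  x ^+ 2 <= l ^+ 2 * Q -> y ^+ 2 <= m ^+ 2 * Q -> (x + y) ^+ 2 <= (l + m) ^+ 2 * Q.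
Proof.
move=> l0 m0 Q0; rewrite -(sqr_sqrtr Q0) -!exprMn.
set r := Num.sqrt Q; have r0 : 0 <= r by exact: sqrtr_ge0.
move=> /(sqr_le_abs (mulr_ge0 l0 r0)) h1 /(sqr_le_abs (mulr_ge0 m0 r0)) h2.
rewrite -[(x + y) ^+ 2]real_normK ?num_real// ler_sqr ?nnegrE ?normr_ge0//.
  by apply: (le_trans (ler_normD _ _)); lra.
by rewrite mulr_ge0// addr_ge0.
Qed.

(** If [u] is near [x] in the local norm, first-order convexity suffices. Otherwise stop on the
    segment at squared local distance 1/10: the slope along [h] there is at least 1/10 - 2/100 -
    2/100, so [Phi] cannot drop any further towards [u]. *)
Lemma Phi_near_min w g t x u l : dot x x < 1 -> dot u u < 1 -> 0 <= l -> l <= 1 / 20 ->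
  (forall z, dot (pgrad w g t x) z ^+ 2 <= l ^+ 2 * dot (phess g t x *m z) z) ->
  Phi B eta beta w g t x - 1 <= Phi B eta beta w g t u.
Proof.
move=> x1 u1 l0 l1 hG; set N := dot (phess g t x *m (u - x)) (u - x).
have N0 : 0 <= N by exact: phess_form_ge0.
have [N1|N1] := leP N (1 / 10).
  have h1 := Phi_convex w g t x1 u1.
  have h2 : `|dot (pgrad w g t x) (u - x)| <= 1.
    apply: sqr_le_abs => //; apply: (le_trans (hG _)); rewrite -/N expr1n; nra.
  by move: h2; rewrite ler_norml => /andP[h2 _]; lra.
have N2 : 0 < N by lra.
(* Chosen so that [h] has squared local norm exactly 1/10. *)
set tau := Num.sqrt (1 / (10 * N)).
have tau0 : 0 < tau by rewrite sqrtr_gt0 divr_gt0// mulr_gt0.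
have tau2 : tau ^+ 2 * N = 1 / 10.
  by rewrite sqr_sqrtr ?divr_ge0 ?mulr_ge0//; field; rewrite gt_eqF.
have tau1 : tau <= 1.
  rewrite -(@ler_sqr _ tau 1) ?nnegrE ?(ltW tau0)// expr1n -(ler_pM2r N2); lra.
set h := tau *: (u - x).
have Qh : dot (phess g t x *m h) h = 1 / 10.
  by rewrite /h -scalemxAr dotZl dotZr mulrA -expr2 -tau2.
have bh : dot (bhess e x *m h) h <= 1 / 10 by rewrite -Qh phess_ge_bhess.
have [k [k1 k2 _]] := barrier_ratio e_ge x1 bh.
have y1 : dot (x + h) (x + h) < 1.
  move: k2; rewrite ler_norml => /andP[_ k2]; rewrite -subr_gt0 k1 mulr_gt0// ?subr_gt0//; lra.
have Gh : `|dot (pgrad w g t x) h| <= 2 / 100.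
  apply: sqr_le_abs; first lra.
  by apply: (le_trans (hG h)); rewrite Qh; nra.
have eh : `|dot (bgrad e (x + h) - bgrad e x - bhess e x *m h) h| <= 2 / 100.
  apply: sqr_le_abs; first lra.
  apply: (le_trans (barrier_gradient_error e_ge x1 bh h)).
  set b := dot (bhess e x *m h) h in bh *.
  have b0 : 0 <= b.
    apply: (coercive_form_ge0 (k := 0)) => //.
    by apply: coercive_le (bhess_coercive e_ge x1); rewrite divr_ge0//; have := e_ge; lra.
  have bb : b * b <= 1 / 10 * (1 / 10) by apply: ler_pM.
  rewrite !expr2; have : 0 <= b * b * b by rewrite !mulr_ge0.
  have : b * b * b <= 1 / 10 * (1 / 10) * (1 / 10) by apply: ler_pM => //; rewrite mulr_ge0.
  lra.
have g2 : 0 <= dot (pgrad w g t (x + h)) h.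
  rewrite pgrad_expand; move: (_ - _ - _) eh => err eh; rewrite 2!dotDl Qh.
  by move: Gh eh; rewrite !ler_norml => /andP[? ?] /andP[? ?]; lra.
have uy : u - (x + h) = ((1 - tau) / tau) *: h.
  rewrite /h scalerA divfK ?gt_eqF// scalerBl scale1r opprD addrA.
  by [].
have := Phi_convex w g t y1 u1; rewrite uy dotZr => c1.
have c2 := Phi_convex w g t x1 y1.
have xh : x + h - x = h by rewrite addrC addKr.
rewrite xh in c2.
have c3 : 0 <= (1 - tau) / tau * dot (pgrad w g t (x + h)) h.
  by rewrite mulr_ge0// divr_ge0 ?subr_ge0// ltW.
by move: Gh; rewrite ler_norml => /andP[? ?]; lra.
Qed.

End Objective.

(** * The OQNS trajectory *)

Section StepReals.
Context {R : realType}.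

(** Arithmetic of the contraction by 6: [a] is the Neumann residual, [33 / 80] exceeds the square
    root of 17/100 from the gradient error, and 7/10 is the price of passing to the Hessian at the
    new point. *)
Lemma decrement_ratio (a P r : R) : 0 <= a -> 0 <= P -> a <= 1 / 243 * r -> P <= 121 / 400 * r ->
  (a + 33 / 80 * P) ^+ 2 <= (r / 6) ^+ 2 * (7 / 10).
Proof.
move=> a0 P0 ar Pr; have h : a + 33 / 80 * P <= 13 / 100 * r by lra.
have h0 : 0 <= a + 33 / 80 * P by lra.
have := ler_pM h0 h0 h h; have := sqr_ge0 r; rewrite !expr2; lra.
Qed.

(** As $|\ln(1-k)|\le\frac{10}{9}|k|$, the square $(|k|e-10/9)^2/e\ge0$ splits the bound into a
    multiple of $ek^2$, which is summable, and $1/e$ per round. *)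
Lemma ln_ratio_le (k e q : R) : `|k| <= 1 / 10 -> 0 < e ->
  e * k ^+ 2 <= 244 / 243 * (244 / 243) * q ^+ 2 -> `|ln (1 - k)| <= q ^+ 2 + e^-1.
Proof.
move=> k1 e0 h1; have [kl ku] : - (1 / 10) <= k /\ k <= 1 / 10 by apply/andP; rewrite -ler_norml.
have kp : 0 < 1 - k by lra.
have lnk : `|ln (1 - k)| <= 10 / 9 * `|k|.
  have u1 : ln (1 - k) <= - k by apply: le_ln1Dx; lra.
  have u2 : - ln (1 - k) <= k / (1 - k).
    rewrite -lnV ?posrE//; have := @le_ln1Dx R (k / (1 - k)).
    have -> : 1 + k / (1 - k) = (1 - k)^-1 by field; rewrite gt_eqF.
    by apply; rewrite ltr_pdivlMr//; lra.
  have u3 : k / (1 - k) <= 10 / 9 * `|k|.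
    rewrite ler_pdivrMr//; have := ler_norm k; have := normr_ge0 k; nra.
  rewrite ler_norml; have : - k <= `|k| by rewrite -normrN ler_norm.
  have := normr_ge0 k; move=> *; apply/andP; split; lra.
apply: (le_trans lnk).
have h2 : 0 <= (`|k| * e - 10 / 9) ^+ 2 / e by rewrite divr_ge0 ?sqr_ge0// ltW.
have : (`|k| * e - 10 / 9) ^+ 2 / e = e * k ^+ 2 - 20 / 9 * `|k| + 100 / 81 * e^-1.
  rewrite -[k ^+ 2]real_normK ?num_real//; field; rewrite gt_eqF//.
have : 0 < e^-1 by rewrite invr_gt0.
have := sqr_ge0 q; lra.
Qed.

End StepReals.

Section Trajectory.
Context {R : realType} {n : nat}.
Local Notation V := 'cV[R]_n.+1.
Local Notation d := (n.+1%:R : R).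
Variables (B eta beta c : R) (T : nat).
Let e := eta * d.
Let reg := d + eta * B ^+ 2.
Local Notation terms := (oqns_terms (n := n) B eta beta c T).
Local Notation pg := (pgrad B eta beta).
Local Notation ph := (phess B eta beta).
Local Notation Phi := (Phi B eta beta).
Hypotheses (e_ge : 11 <= e) (reg_ge0 : 0 <= reg) (beta_ge0 : 0 <= beta).
Hypotheses (cE : c = 1 / 4) (termsP : (1 / 3 : R) ^+ terms.+1 <= 1 / 243).
Implicit Types (w g : nat -> V) (t : nat).

Lemma landmark_close w t : w 0%N = 0 ->
  (forall s, (s <= t)%N -> dot (w s) (w s) < 1) ->
  let v := landmark c w t in
  dot v v < 1 /\ `|dot (w t) (w t) - dot v v| <= c * (1 - dot v v).
Proof.
move=> w0; elim: t => [|t IH] hw /=.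
  by rewrite w0 dot0l subrr normr0 subr0 mulr1 cE; split=> //; lra.
have [v1 _] := IH (fun s st => hw s (leqW st)).
rewrite /keep_landmark !sqr_enorm; case: ifPn => // _.
have w1 := hw _ (leqnn t.+1); split=> //.
by rewrite subrr normr0 mulr_ge0 ?subr_ge0 ?(ltW w1)// cE; lra.
Qed.

(** [oqns_theta] is the scalar curvature at [w t] times $(\|v\|^2-\|w\|^2)/(1-\|v\|^2)$, and the
    landmark rule bounds the latter by [c]. *)
Lemma theta_le w t : dot (w t) (w t) < 1 ->
  let v := landmark c w t in
  dot v v < 1 -> `|dot (w t) (w t) - dot v v| <= c * (1 - dot v v) ->
  4 * `|oqns_theta eta c w t| <= 2 * e / (1 - dot (w t) (w t)).
Proof.
move=> w1 v v1 h; rewrite /oqns_theta !sqr_enorm -/v.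
have Dw : 0 < 1 - dot (w t) (w t) by rewrite subr_gt0.
have Dv : 0 < 1 - dot v v by rewrite subr_gt0.
have -> : 2 * eta * d / (1 - dot v v) - 2 * eta * d / (1 - dot (w t) (w t))
  = 2 * e / (1 - dot (w t) (w t)) * ((dot v v - dot (w t) (w t)) / (1 - dot v v)).
  by rewrite /e; field; rewrite !gt_eqF.
have k0 : 0 <= 2 * e / (1 - dot (w t) (w t)).
  by apply: divr_ge0; [have := e_ge; lra|exact: ltW].
rewrite normrM (ger0_norm k0) mulrCA -[leRHS]mulr1 ler_wpM2l//.
rewrite normrM normfV (gtr0_norm Dv) distrC mulrA ler_pdivrMr// mul1r.
by move: h; rewrite cE; lra.
Qed.

(** [oqns_theta] is exactly the difference between the scalar barrier coefficients at the landmark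
    and at [w t]. *)
Lemma oqns_HE w g t :
  oqns_H B eta beta c w g t
  = invmx (ph g t.+1 (w t) + (oqns_theta eta c w t)%:M).
Proof.
rewrite /oqns_H /oqns_A invmxK /oqns_theta !sqr_enorm /phess /bhess /pform.
have E2 a : 2 * eta * d / a = 2 * e / a by rewrite /e mulrA.
have E4 a : 4 * eta * d / a = 4 * e / a by rewrite /e mulrA.
rewrite !E2 !E4 raddfB/=; congr invmx.
set a := 2 * _ / _; set b := 2 * _ / _.
move: (a%:M) (b%:M) (_ *: _) (_ *: _) => M1 M2 M3 M4.
apply/matrixP => i j; rewrite !mxE; ring.
Qed.

(** [l] controls the gradient of the old objective at [w t] and [dl] the incoming [g t], both in
    dual local norms, so the step starts from a gradient of dual norm at most [r]. *)
Lemma oqns_step w g t (l dl : R) :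
  dot (w t) (w t) < 1 ->
  let v := landmark c w t in
  dot v v < 1 -> `|dot (w t) (w t) - dot v v| <= c * (1 - dot v v) ->
  0 <= l <= 1 / 20 -> 0 <= dl <= 1 / 4 ->
  (forall z, dot (pg w g t (w t)) z ^+ 2 <= l ^+ 2 * dot (ph g t (w t) *m z) z) ->
  (forall z, dot (g t) z ^+ 2 <= dl ^+ 2 * dot (ph g t.+1 (w t) *m z) z) ->
  w t.+1 = w t - \sum_(1 <= k < terms.+2)
      oqns_theta eta c w t ^+ k.-1
        *: (oqns_H B eta beta c w g t ^+ k *m gradient (Phi w g t.+1) (w t)) ->
  let r := l + dl in
  [/\ dot (w t.+1) (w t.+1) < 1,
      forall z, dot (pg w g t.+1 (w t.+1)) z ^+ 2
        <= (r / 6) ^+ 2 * dot (ph g t.+1 (w t.+1) *m z) z,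
      Phi w g t.+1 (w t) - Phi w g t.+1 (w t.+1) <= 2 * r ^+ 2
    & `|ln (1 - dot (w t.+1) (w t.+1)) - ln (1 - dot (w t) (w t))| <= r ^+ 2 + e^-1].
Proof.
have e0 : 0 < e by apply: lt_le_trans e_ge.
move=> w1 v v1 hv /andP[l0 l1] /andP[d0 d1] hl hd wE r.
have th := theta_le w1 v1 hv.
set Q := ph g t.+1 (w t) in hd *.
have Q0 z : 0 <= dot (Q *m z) z by apply: phess_form_ge0.
set G := pg w g t.+1 (w t).
have r0 : 0 <= r by rewrite addr_ge0.
have r1 : r <= 3 / 10 by rewrite /r; lra.
have hG z : dot G z ^+ 2 <= r ^+ 2 * dot (Q *m z) z.
  rewrite /G pgradS dotDl; apply: dual_bound_add => //.
  apply: (le_trans (hl z)); rewrite ler_wpM2l ?sqr_ge0//.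
  by rewrite /Q phessS lerDl mulr_ge0// sqr_ge0.
set k := 2 * e / (1 - dot (w t) (w t)) in th.
have k0 : 0 < k by apply: divr_gt0; [have := e_ge; lra|rewrite subr_gt0].
have cQ : coercive k Q.
  by apply: coercive_le (phess_coercive B e_ge beta_ge0 g t.+1 w1); rewrite lerDl.
rewrite gradient_Phi// oqns_HE -/Q -/G in wE.
set st := \sum_(_ <= _ < _) _ in wE.
have resE := newton_residual k0 th cQ terms.+1 G.
have resb := dual_bound_contract k0 th cQ terms.+1 hG.
rewrite -/st in resE; set rv := _ *: _ in resE resb.
have termsP' := termsP.
set ep := (1 / 3) ^+ terms.+1 in resb termsP'.
have ep0 : 0 <= ep by rewrite exprn_ge0//; lra.
pose p := (1 + ep) * r.
have p0 : 0 <= p by rewrite mulr_ge0// addr_ge0.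
have er : ep * r <= 1 / 243 * r by rewrite ler_wpM2r.
have pr : p <= 244 / 243 * r by rewrite /p mulrDl mul1r; lra.
have Qst : dot (Q *m st) st <= p ^+ 2.
  set N := dot (Q *m st) st; have N0 : 0 <= N by exact: Q0.
  (* The residual equation is tested on the step itself. *)
  have : N ^+ 2 <= p ^+ 2 * N.
    have -> : N = dot G st + dot (- rv) st by rewrite -dotDl -resE.
    rewrite /p mulrDl mul1r; rewrite -dotDl -resE -/N.
    have -> : N ^+ 2 = (dot G st + dot (- rv) st) ^+ 2 by rewrite -dotDl -resE.
    by apply: dual_bound_add; rewrite ?mulr_ge0// dotNl sqrrN.
  have [->|N1] := eqVneq N 0; first by rewrite sqr_ge0.
  by rewrite expr2 ler_pM2r// lt_def N1.
have wE' : w t.+1 = w t + - st := wE.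
set h := - st in wE'.
have Qh : dot (Q *m h) h = dot (Q *m st) st by rewrite /h mulmxN dotNl dotNr opprK.
have p2 : p ^+ 2 <= 244 / 243 * (244 / 243) * r ^+ 2.
  have := ler_pM p0 p0 pr pr; rewrite !expr2; lra.
have pp : p ^+ 2 <= 121 / 400 * r.
  have : r ^+ 2 <= 3 / 10 * r by rewrite expr2 ler_wpM2r.
  lra.
set b := dot (bhess e (w t) *m h) h.
have bQ : b <= p ^+ 2 by apply: le_trans Qst; rewrite -Qh; exact: phess_ge_bhess.
have b1 : b <= 1 / 10 by lra.
have b0 : 0 <= b.
  apply: (coercive_form_ge0 (k := 0)) => //.
  by apply: coercive_le (bhess_coercive e_ge w1); exact: ltW.
have [kk [k1 k2 k3]] := barrier_ratio e_ge w1 b1.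
have k3' := le_trans k3 (le_trans bQ p2).
have Dw : 0 < 1 - dot (w t) (w t) by rewrite subr_gt0.
have [kl ku] : - (1 / 10) <= kk /\ kk <= 1 / 10 by apply/andP; rewrite -ler_norml.
have kp : 0 < 1 - kk by rewrite subr_gt0 (le_lt_trans ku)// ltr_pdivrMr// mul1r ltr1n.
have w1' : dot (w t.+1) (w t.+1) < 1 by rewrite wE' -subr_gt0 k1 mulr_gt0.
split=> //.
- move=> z.
  (* The linear part of the step cancels the gradient up to the Neumann residual, so only that
     residual and the barrier remainder survive. *)
  have E : pg w g t.+1 (w t.+1)
      = rv + (bgrad e (w t + h) - bgrad e (w t) - bhess e (w t) *m h).
    rewrite wE' pgrad_expand -/Q -/G /h mulmxN resE opprB [G + _]addrC addrNK.
    by [].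
  set err := _ - _ - _ in E.
  have herr : dot err z ^+ 2 <= (33 / 80 * p ^+ 2) ^+ 2 * dot (Q *m z) z.
    apply: (le_trans (barrier_gradient_error e_ge w1 b1 z)); rewrite -/b.
    apply: ler_pM; rewrite ?phess_ge_bhess//.
    + by rewrite mulr_ge0 ?sqr_ge0// divr_ge0.
    + apply: (coercive_form_ge0 (k := 0)) => //.
      by apply: coercive_le (bhess_coercive e_ge w1); exact: ltW.
    + have : b ^+ 2 <= (p ^+ 2) ^+ 2 by rewrite ler_sqr ?nnegrE ?sqr_ge0.
      have := sqr_ge0 (p ^+ 2); rewrite exprMn; lra.
  have h1 : dot (pg w g t.+1 (w t.+1)) z ^+ 2
      <= (ep * r + 33 / 80 * p ^+ 2) ^+ 2 * dot (Q *m z) z.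
    rewrite E dotDl; apply: dual_bound_add => //; first by rewrite mulr_ge0.
    by rewrite mulr_ge0 ?sqr_ge0// divr_ge0.
  apply: (le_trans h1).
  have h2 : 7 / 10 * dot (Q *m z) z <= dot (ph g t.+1 (w t.+1) *m z) z.
    have := barrier_hessian_le e_ge w1 b1 z; rewrite -wE' /Q !phess_formE.
    have : 0 <= dot (pform B eta beta g t.+1 *m z) z.
      apply: (coercive_form_ge0 (k := 0)) => //.
      exact: coercive_le (pform_coercive B eta beta_ge0 g t.+1).
    move=> pf0 bh; rewrite mulrDr; apply: lerD bh _.
    by rewrite ler_piMl// ler_pdivrMr// mul1r ler_nat.
  have h5 := ler_wpM2l (sqr_ge0 (r / 6)) h2.
  apply: le_trans h5; rewrite [leRHS]mulrA ler_wpM2r//.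
  by apply: decrement_ratio => //; [rewrite mulr_ge0|rewrite sqr_ge0].
- have := Phi_convex e_ge reg_ge0 beta_ge0 w g t.+1 w1 w1'.
  have -> : w t.+1 - w t = - st by rewrite wE' addrC addKr.
  rewrite dotNr -/G => h1.
  have : `|dot G st| <= r * p.
    apply: sqr_le_abs; first by rewrite mulr_ge0.
    apply: (le_trans (hG st)); rewrite exprMn ler_wpM2l ?sqr_ge0//.
  have : r * p <= r * (244 / 243 * r) by rewrite ler_wpM2l.
  have := ler_norm (dot G st); have := sqr_ge0 r; rewrite expr2; lra.
- rewrite wE' k1 lnM ?posrE// addrAC subrr add0r.
  exact: ln_ratio_le k3'.
Qed.

(* [oqns] run for [N] rounds only; [T] still determines the number of terms. *)
Definition oqns_upto (N : nat) w g := w 0%N = 0 /\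
  forall t, (t < N)%N ->
    w t.+1 = w t - \sum_(1 <= k < terms.+2)
      oqns_theta eta c w t ^+ k.-1
        *: (oqns_H B eta beta c w g t ^+ k *m gradient (Phi w g t.+1) (w t)).

Fixpoint decrement (dl : nat -> R) (t : nat) : R :=
  if t is s.+1 then (decrement dl s + dl s) / 6 else 0.

Lemma decrement_bound dl t : (forall s, (s < t)%N -> 0 <= dl s <= 1 / 4) ->
  0 <= decrement dl t <= 1 / 20.
Proof.
elim: t => [|t IH] h /=; first by lra.
have /andP[h1 h2] := IH (fun s st => h s (leqW st)).
by have /andP[h3 h4] := h t (leqnn _); lra.
Qed.

(** [3 * decrement ^+ 2] acts as a potential: $\frac{13}{12}(l+x)^2\le3l^2+3x^2$ at each round. *)
Lemma decrement_sum dl t :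
  \sum_(s < t) (decrement dl s + dl s) ^+ 2 + 3 * decrement dl t ^+ 2
    <= 3 * \sum_(s < t) dl s ^+ 2.
Proof.
elim: t => [|t IH]; first by rewrite !big_ord0 /= expr0n !mulr0 addr0.
rewrite !big_ord_recr/=.
have := sqr_ge0 (decrement dl t - dl t); move: IH.
move: (\sum_(_ < _) _) (\sum_(_ < _) _) (decrement _ _) (dl _) => A1 A2 l x; nra.
Qed.

Section Run.
Variables (N : nat) (w g : nat -> V) (dl : nat -> R).
Hypothesis run : oqns_upto N w g.
Hypothesis dl_bound : forall t, (t < N)%N -> 0 <= dl t <= 1 / 4.
Hypothesis dlP : forall t, (t < N)%N -> (forall s, (s <= t)%N -> dot (w s) (w s) < 1) ->
  forall z, dot (g t) z ^+ 2 <= dl t ^+ 2 * dot (ph g t.+1 (w t) *m z) z.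
Let lam := decrement dl.

(** The bound on [g t] may use that the iterates up to [t] lie in the ball, which is what the
    induction provides when [g t] arrives. *)
Lemma oqns_invariant t : (t <= N)%N ->
  (forall s, (s <= t)%N -> dot (w s) (w s) < 1) /\
  forall z, dot (pg w g t (w t)) z ^+ 2 <= lam t ^+ 2 * dot (ph g t (w t) *m z) z.
Proof.
have [w0 wS] := run.
elim: t => [|t IH] tT.
  split=> [s|z]; first by rewrite leqn0 => /eqP ->; rewrite w0 dot0l.
  rewrite /pgrad w0 !big_ord0 /bgrad !scaler0 !addr0 dot0l expr0n/=.
  by rewrite mul0r.
have [h1 h2] := IH (ltnW tT).
have [v1 v2] := landmark_close w0 h1.
have lb : 0 <= lam t <= 1 / 20.
  by apply: decrement_bound => s st; apply: dl_bound; exact: ltn_trans tT.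
have [s1 s2 _ _] := oqns_step (h1 t (leqnn _)) v1 v2 lb (dl_bound tT) h2
  (dlP tT h1) (wS t tT).
split=> // s; rewrite leq_eqVlt => /orP[/eqP -> //|]; rewrite ltnS; exact: h1.
Qed.

Lemma oqns_in_ball t : (t <= N)%N -> dot (w t) (w t) < 1.
Proof. by move=> tT; have [h _] := oqns_invariant tT; exact: h. Qed.

Lemma oqns_run_step t : (t < N)%N -> let r := lam t + dl t in
  Phi w g t.+1 (w t) - Phi w g t.+1 (w t.+1) <= 2 * r ^+ 2 /\
  `|ln (1 - dot (w t.+1) (w t.+1)) - ln (1 - dot (w t) (w t))| <= r ^+ 2 + e^-1.
Proof.
move=> tT; have [w0 wS] := run.
have [h1 h2] := oqns_invariant (ltnW tT).
have [v1 v2] := landmark_close w0 h1.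
have lb : 0 <= lam t <= 1 / 20.
  by apply: decrement_bound => s st; apply: dl_bound; exact: ltn_trans tT.
by have [] := oqns_step (h1 t (leqnn _)) v1 v2 lb (dl_bound tT) h2
  (dlP tT h1) (wS t tT).
Qed.

(** Be-the-leader argument: [PhiS] adds the loss of round [t] to the objective, and moving to
    [w t.+1] lowers it by at most $2r_t^2$. The final iterate is within 1 of the infimum, and
    [decrement_sum] turns the 2 into 6. *)
Lemma oqns_regret u : dot u u < 1 ->
  \sum_(t < N) dot (g t) (w t)
    <= Phi w g N u + 1 + 6 * \sum_(t < N) dl t ^+ 2.
Proof.
move=> u1; have [h1 h2] := oqns_invariant (leqnn N).
have lb : 0 <= lam N <= 1 / 20 by apply: decrement_bound.
have [l0 l1] := andP lb.
have := Phi_near_min e_ge reg_ge0 beta_ge0 (h1 N (leqnn _)) u1 l0 l1 h2.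
have : forall t, (t <= N)%N -> \sum_(s < t) dot (g s) (w s)
    <= Phi w g t (w t) + 2 * \sum_(s < t) (lam s + dl s) ^+ 2.
  elim=> [|t IH] tT.
    rewrite !big_ord0 PhiE !big_ord0 run.1 !dot0l subr0 ln1.
    by rewrite !(mulr0, addr0).
  rewrite !big_ord_recr/=; have := IH (ltnW tT); have [] := oqns_run_step tT.
  rewrite PhiS; lra.
move=> /(_ N (leqnn N)); have := decrement_sum dl N; rewrite -/lam.
have := sqr_ge0 (lam N); lra.
Qed.

Lemma landmark_changes :
  (\sum_(t < N) ~~ keep_landmark c (w t.+1) (landmark c w t))%N%:R / 5
    <= 3 * \sum_(t < N) dl t ^+ 2 + N%:R / e.
Proof.
have w0 : w 0%N = 0 := run.1.
pose L (x : V) : R := ln (1 - dot x x).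
(* The distance from the landmark, in the scale of [L], is kept on the left: it has grown to 1/5
   when the landmark moves, and the move resets it to zero. *)
have : forall t, (t <= N)%N ->
  (\sum_(s < t) ~~ keep_landmark c (w s.+1) (landmark c w s))%N%:R / 5
    + `|L (w t) - L (landmark c w t)|
    <= \sum_(s < t) (lam s + dl s) ^+ 2 + t%:R / e.
  elim=> [|t IH] tT; first by rewrite !big_ord0 /= w0 subrr normr0 !mul0r addr0.
  rewrite !big_ord_recr/= natrD [in leRHS]mulrSr mulrDl [in leRHS]mulrDl mul1r.
  have := IH (ltnW tT); have [_] := oqns_run_step tT; rewrite -/(L (w t.+1)) -/(L (w t)).
  have [v1 _] := landmark_close w0 (fun s st => oqns_in_ball (leq_trans st (ltnW tT))).
  set v := landmark c w t in v1 *.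
  set r := (lam t + dl t) ^+ 2.
  have tri : `|L (w t.+1) - L v| <= `|L (w t.+1) - L (w t)| + `|L (w t) - L v|.
    have -> : L (w t.+1) - L v = (L (w t.+1) - L (w t)) + (L (w t) - L v) by ring.
    exact: ler_normD.
  case: ifPn => keep /=; first by rewrite mul0r; lra.
  (* A move means that the ratio of the two values of $1-\|x\|^2$ is below 3/4 or above 5/4; $\ln
     r\le r-1$, applied to the ratio or its inverse, gives 1/4 or 1/5. *)
  suff : 1 / 5 <= `|L (w t.+1) - L v| by rewrite subrr normr0; lra.
  have wt1 : dot (w t.+1) (w t.+1) < 1 by exact: oqns_in_ball.
  move: keep; rewrite /keep_landmark !sqr_enorm -ltNge cE => keep.
  have Dv : 0 < 1 - dot v v by rewrite subr_gt0.
  have Dw : 0 < 1 - dot (w t.+1) (w t.+1) by rewrite subr_gt0.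
  rewrite /L -ln_div ?posrE//.
  set D := 1 - dot (w t.+1) _ in Dw *; set D' := 1 - dot v v in Dv keep *.
  have DD : dot (w t.+1) (w t.+1) - dot v v = D' - D by rewrite /D /D'; ring.
  rewrite DD in keep.
  have q0 : 0 < D / D' by rewrite divr_gt0.
  have [le|le] := leP D D'.
    have : ln (D / D') <= D / D' - 1.
      by have := @le_ln1Dx R (D / D' - 1); rewrite [1 + _]addrC subrK; apply; lra.
    move: keep; rewrite ger0_norm ?subr_ge0// => keep.
    have : D / D' < 3 / 4 by rewrite ltr_pdivrMr//; lra.
    have : - ln (D / D') <= `|ln (D / D')| by rewrite -normrN ler_norm.
    lra.
  have q1 : 0 < D' / D by rewrite divr_gt0.
  have : ln (D' / D) <= D' / D - 1.
    by have := @le_ln1Dx R (D' / D - 1); rewrite [1 + _]addrC subrK; apply; lra.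
  have -> : D' / D = (D / D')^-1 by rewrite invf_div.
  rewrite lnV ?posrE//.
  move: keep; rewrite ltr0_norm ?subr_lt0// => keep.
  have : (D / D')^-1 < 4 / 5 by rewrite invf_div ltr_pdivrMr//; lra.
  have := ler_norm (ln (D / D')); lra.
move=> /(_ N (leqnn N)); have := decrement_sum dl N; rewrite -/lam.
have := sqr_ge0 (lam N); have := normr_ge0 (L (w N) - L (landmark c w N)); lra.
Qed.

End Run.
End Trajectory.

(** * The elliptical potential *)

Section Determinants.
Context {R : realType}.

(** One block matrix factors in two ways into block-triangular matrices. *)
Lemma det_sub_outer n (u v : 'cV[R]_n.+1) : \det (1%:M - u *m v^T) = 1 - dot v u.
Proof.
pose A := block_mx (1%:M : 'M[R]_1) v^T u 1%:M.
have A1 : A = block_mx 1%:M 0 u 1%:M *m block_mx 1%:M v^T 0 (1%:M - u *m v^T).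
  by rewrite mulmx_block !(mul1mx, mulmx1, mul0mx, mulmx0, addr0) addrC subrK.
have A2 : A = block_mx 1%:M v^T 0 1%:M *m block_mx (1%:M - v^T *m u) 0 u 1%:M.
  by rewrite mulmx_block !(mul1mx, mulmx1, mul0mx, mulmx0, addr0, add0r) subrK.
have := congr1 determinant A1; rewrite A2 !det_mulmx !det_lblock !det_ublock !det1.
rewrite !mul1r mulr1 => <-; rewrite det_mx11 !mxE eqxx; congr (1 - _).
by apply: eq_bigr => i _; rewrite mxE.
Qed.

Lemma fact_le_exp N k : (k <= N)%N -> (k`! <= N ^ k)%N.
Proof.
elim: k => [//|k IH] kN; rewrite factS expnS leq_mul//.
by apply: IH; exact: ltnW.
Qed.

(** The Leibniz expansion gives $d!\,m^d\le(dm)^d$. This is cruder than Hadamard's bound, but only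
    its logarithm enters. *)
Lemma det_le n (A : 'M[R]_n.+1) (m : R) : 0 <= m -> (forall i j, `|A i j| <= m) ->
  `|\det A| <= (n.+1%:R * m) ^+ n.+1.
Proof.
move=> m0 hA; apply: (le_trans (ler_norm_sum _ _ _)).
apply: (@le_trans _ _ (\sum_(s : 'S_n.+1) m ^+ n.+1)).
  apply: ler_sum => s _; rewrite normrM normrX normrN1 expr1n mul1r normr_prod.
  rewrite -[X in m ^+ X](card_ord n.+1) -prodr_const.
  by apply: ler_prod => i _; rewrite normr_ge0 hA.
rewrite sumr_const exprMn -[leLHS]mulr_natl ler_wpM2r ?exprn_ge0//.
rewrite -natrX ler_nat.
rewrite card_Sn.
exact: fact_le_exp.
Qed.

End Determinants.

Section EllipticalPotential.
Context {R : realType} {n : nat}.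
Local Notation V := 'cV[R]_n.+1.
Local Notation d := (n.+1%:R : R).
Variables (B eta beta : R) (g : nat -> V).
Let reg := d + eta * B ^+ 2.
Local Notation pf := (pform B eta beta g).
Hypotheses (reg_gt0 : 0 < reg) (beta_gt0 : 0 < beta).

(** Squared dual norm of [g t] for the quadratic part of the Hessian that already includes round
    [t]. *)
Definition leverage (t : nat) : R := dot (g t) (invmx (pf t.+1) *m g t).

Let pf_coercive t : coercive reg (pf t).
Proof. by apply: pform_coercive; exact: ltW. Qed.

Let pf_unit t : pf t \in unitmx.
Proof. exact: coercive_unit (pf_coercive t). Qed.

Let y t := invmx (pf t.+1) *m g t.
Let pfy t : pf t.+1 *m y t = g t.
Proof. by rewrite /y mulmxA mulmxV// mul1mx. Qed.

Let pfS t : pf t.+1 = pf t + beta *: (g t *m (g t)^T).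
Proof. by rewrite /pform big_ord_recr/= scalerDr addrA. Qed.

Lemma leverage_ge0 t : 0 <= leverage t.
Proof.
rewrite /leverage -/(y t) -{1}(pfy t); apply: (coercive_form_ge0 (k := reg)) => //.
exact: ltW.
Qed.

Lemma leverage_dual t z : dot (g t) z ^+ 2 <= leverage t * dot (pf t.+1 *m z) z.
Proof.
rewrite /leverage -/(y t) -{1 2}(pfy t); apply: form_CS.
by apply: coercive_le (pf_coercive _); exact: ltW.
Qed.

(** With [y = invmx (pf t.+1) *m g t], the leverage $\ell$ satisfies $\ell=\langle
    P_ty,y\rangle+\beta\ell^2$, whose first term is positive unless [y = 0]. *)
Lemma leverage_lt t : beta * leverage t < 1.
Proof.
have [y0|y0] := eqVneq (y t) 0; first by rewrite /leverage -/(y t) y0 dot0r mulr0 ltr01.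
have L0 := leverage_ge0 t.
have : leverage t = dot (pf t *m y t) (y t) + beta * leverage t ^+ 2.
  rewrite {1}/leverage -/(y t) -{1}(pfy t) pfS mulmxDl dotDl -scalemxAl.
  by rewrite outer_mulmx !dotZl expr2.
have : 0 < dot (pf t *m y t) (y t).
  by apply: lt_le_trans ((pf_coercive t).2 _); rewrite mulr_gt0// dot_gt0.
set L := leverage t in L0 *; move=> h1 h2.
have L1 : 0 < L.
  rewrite h2; have := sqr_ge0 L; have := beta_gt0; nra.
rewrite -(ltr_pM2r L1) mul1r -mulrA -expr2; lra.
Qed.

Lemma det_pformS t : \det (pf t) = \det (pf t.+1) * (1 - beta * leverage t).
Proof.
have -> : pf t = pf t.+1 *m (1%:M - (beta *: y t) *m (g t)^T).
  rewrite mulmxBr mulmx1 mulmxA -scalemxAr pfy pfS -scalemxAl addrK.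
  by [].
by rewrite det_mulmx det_sub_outer dotZr.
Qed.

Lemma det_pform_gt0 t : 0 < \det (pf t).
Proof.
elim: t => [|t IH].
  by rewrite /pform big_ord0 scaler0 addr0 det_scalar exprn_gt0.
have := IH; rewrite det_pformS pmulr_lgt0// subr_gt0; exact: leverage_lt.
Qed.

(** [1 - beta * leverage t] is the ratio of consecutive determinants, so $\ln(1-x)\le-x$ telescopes;
    [det_le] bounds the last determinant. *)
Lemma leverage_sum T : (forall t, (t < T)%N -> dot (g t) (g t) <= reg) ->
  beta * \sum_(t < T) leverage t <= d * ln (d * (1 + beta * T%:R)).
Proof.
move=> hg.
have d0 : 0 < d by rewrite ltr0n.
have step : forall t, beta * \sum_(s < t) leverage s
    <= ln (\det (pf t)) - ln (\det (pf 0%N)).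
  elim=> [|t IH]; first by rewrite big_ord0 mulr0 subrr.
  rewrite big_ord_recr/= mulrDr.
  have p1 : 0 < 1 - beta * leverage t by rewrite subr_gt0 leverage_lt.
  have h : ln (\det (pf t)) = ln (\det (pf t.+1)) + ln (1 - beta * leverage t).
    by rewrite det_pformS lnM ?posrE// det_pform_gt0.
  have : ln (1 - beta * leverage t) <= - (beta * leverage t).
    by apply: le_ln1Dx; rewrite ltrN2 leverage_lt.
  lra.
apply: (le_trans (step T)).
have m0 : 0 <= reg * (1 + beta * T%:R).
  apply: mulr_ge0; first exact: ltW.
  by apply: addr_ge0 => //; apply: mulr_ge0 => //; exact: ltW.
have h1 : \det (pf T) <= (d * (reg * (1 + beta * T%:R))) ^+ n.+1.
  apply: (le_trans (ler_norm _)); apply: det_le => // i j.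
  rewrite !mxE summxE; apply: (le_trans (ler_normD _ _)).
  rewrite [leRHS]mulrDr mulr1; apply: lerD.
    have r0 := ltW reg_gt0.
    by case: (i == j); rewrite ?mulr1n ?mulr0n ?normr0// ger0_norm.
  rewrite normrM (gtr0_norm beta_gt0) mulrCA ler_pM2l//.
  apply: (le_trans (ler_norm_sum _ _ _)).
  apply: (@le_trans _ _ (\sum_(t < T) reg)); last first.
    by rewrite sumr_const card_ord -[_ *+ T]mulr_natr.
  apply: ler_sum => t _; apply: le_trans (hg t (ltn_ord t)).
  rewrite mxE big_ord1 !mxE normrM -(@ler_sqr _ (_ * _)) ?nnegrE ?mulr_ge0 ?dot_ge0//.
  rewrite exprMn !real_normK ?num_real//.
  have coord k : g t k ord0 ^+ 2 <= dot (g t) (g t).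
    rewrite /dot (bigD1 k)//= -expr2 lerDl; apply: sumr_ge0 => l _.
    by rewrite -expr2 sqr_ge0.
  by rewrite [leRHS]expr2; apply: ler_pM; rewrite ?sqr_ge0 ?coord.
have dp := det_pform_gt0 T.
have h2 : ln (\det (pf T)) <= ln ((d * (reg * (1 + beta * T%:R))) ^+ n.+1).
  by rewrite ler_ln ?posrE// (lt_le_trans dp).
have E0 : \det (pf 0%N) = reg ^+ n.+1 by rewrite /pform big_ord0 scaler0 addr0 det_scalar.
have c0 : 0 < 1 + beta * T%:R by rewrite ltr_pwDl// mulr_ge0// ltW.
rewrite E0 lnXn//.
rewrite lnXn ?mulr_gt0// in h2.
have -> : d * ln (d * (1 + beta * T%:R))
    = ln (d * (reg * (1 + beta * T%:R))) *+ n.+1 - ln reg *+ n.+1.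
  rewrite -[ln (d * _) *+ _]mulr_natl -[ln reg *+ _]mulr_natl.
  by rewrite !lnM ?posrE ?mulr_gt0//; ring.
lra.
Qed.

End EllipticalPotential.

(** * Regret and landmark moves of OQNS with the prescribed parameters *)

Section Guarantee.
Context {R : realType} {n : nat}.
Local Notation V := 'cV[R]_n.+1.
Local Notation d := (n.+1%:R : R).
Variables (B eta beta : R) (T : nat).
Let e := eta * d.
Let reg := d + eta * B ^+ 2.
Local Notation c := (1 / 4 : R).

Lemma nceil_ge (x : R) : x <= (nceil x)%:R.
Proof.
rewrite /nceil; apply: (le_trans (Num.Theory.ceil_ge x)).
by rewrite pmulrn ler_int abszE ler_norm.
Qed.

Hypotheses (eta_ge : 11 <= eta) (beta_gt0 : 0 < beta).

Let d1 : 1 <= d. Proof. by rewrite ler1n. Qed.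

Let e_ge : 11 <= e.
Proof. by have := eta_ge; have := d1; rewrite /e; nra. Qed.

Let reg_gt0 : 0 < reg.
Proof.
have := eta_ge; have := d1 => h1 h2; apply: ltr_pwDl; first lra.
by rewrite mulr_ge0 ?sqr_ge0//; lra.
Qed.

(** The two squares are at least 16 and 4, and 12 / (1 - 1/4) is 16, so the product is at least
    1024. *)
Lemma oqns_terms_arg_ge : 0 <= B -> (0 < T)%N ->
  4 ^+ 4 <= 12 * (4 + 32 / eta ^+ 2) ^+ 2
      * (2 * eta * d + B ^+ 2 * eta + (B + 2 * beta * B ^+ 2) * T%:R) ^+ 2
      * T%:R / (1 - c).
Proof.
move=> B0 T0.
have T1 : (1 : R) <= T%:R by rewrite ler1n.
have a1 : 16 <= (4 + 32 / eta ^+ 2) ^+ 2.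
  have : 0 <= 32 / eta ^+ 2 by rewrite divr_ge0 ?sqr_ge0.
  move: (32 / _) => q q0; nra.
have a2 : 4 <= (2 * eta * d + B ^+ 2 * eta + (B + 2 * beta * B ^+ 2) * T%:R) ^+ 2.
  have b1 : 0 <= B ^+ 2 * eta by rewrite mulr_ge0 ?sqr_ge0//; have := eta_ge; lra.
  have b2 : 0 <= (B + 2 * beta * B ^+ 2) * T%:R.
    rewrite mulr_ge0// addr_ge0// mulr_ge0 ?sqr_ge0//; have := beta_gt0; lra.
  have b3 : 2 <= 2 * eta * d by have := e_ge; rewrite /e; lra.
  move: (2 * eta * d) (B ^+ 2 * eta) (_ * T%:R) b1 b2 b3 => p q r ? ? ?; nra.
have a3 : 64 <= (4 + 32 / eta ^+ 2) ^+ 2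
    * (2 * eta * d + B ^+ 2 * eta + (B + 2 * beta * B ^+ 2) * T%:R) ^+ 2.
  have -> : 64 = 16 * 4 :> R by ring.
  exact: ler_pM.
rewrite -[12 * _ * _]mulrA; move: (_ ^+ 2 * _ ^+ 2) a3 => p p1.
have : 64 * 1 <= p * T%:R by apply: ler_pM.
rewrite -[12 * p * _]mulrA; move: (p * _) => q q1.
have -> : 12 * q / (1 - 1 / 4) = 16 * q by field.
lra.
Qed.

Lemma oqns_terms_ge : 0 <= B -> (0 < T)%N ->
  (4 <= oqns_terms (n := n) B eta beta c T)%N.
Proof.
move=> B0 T0; rewrite -(ler_nat R); apply: le_trans (nceil_ge _).
have X1 := oqns_terms_arg_ge B0 T0; set X := 12 * _ * _ * _ / _ in X1 *.
have l4 : 0 < ln (4 : R) by rewrite ln_gt0//; lra.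
have -> : ln (1 / 4 : R) = - ln 4 by rewrite div1r lnV// posrE.
rewrite invrN mulrN opprK ler_pdivlMr//.
have : ln ((4 : R) ^+ 4) <= ln X by rewrite ler_ln ?posrE ?exprn_gt0// (lt_le_trans _ X1)// exprn_gt0.
by rewrite lnXn// mulr_natl.
Qed.

(** The truncated series has one term more than [oqns_terms], hence at least five, and 243 is the
    fifth power of 3. *)
Lemma oqns_termsP : 0 <= B -> (0 < T)%N ->
  (1 / 3 : R) ^+ (oqns_terms (n := n) B eta beta c T).+1 <= 1 / 243.
Proof.
move=> B0 T0; apply: (@le_trans _ _ ((1 / 3) ^+ 5)).
  by apply: ler_wiXn2l; [lra|lra|rewrite ltnS; exact: oqns_terms_ge].
rewrite !exprS expr0; lra.
Qed.

Section Run.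
Hypotheses (B_ge0 : 0 <= B) (T_gt0 : (0 < T)%N).
Variables (N : nat) (w g : nat -> V).
Hypothesis run : oqns_upto B eta beta c T N w g.
Hypothesis g_le : forall t, (t < N)%N -> (forall s, (s <= t)%N -> dot (w s) (w s) < 1) ->
  dot (g t) (g t) <= reg /\ 16 * dot (g t) (g t) <= 2 * e / (1 - dot (w t) (w t)) + reg.

(** The leverage ignores the barrier and is summable; 1/16 comes from barrier and regularisation and
    keeps every step in the Newton region. *)
Let dl t := Num.sqrt (Num.min (leverage B eta beta g t) (1 / 16)).

Let dl2 t : dl t ^+ 2 = Num.min (leverage B eta beta g t) (1 / 16).
Proof. by rewrite sqr_sqrtr// le_min leverage_ge0//; lra. Qed.

Let dl_bound t : (t < N)%N -> 0 <= dl t <= 1 / 4.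
Proof.
move=> _; rewrite sqrtr_ge0/=; apply: (le_trans (ler_norm _)).
apply: sqr_le_abs; first lra.
rewrite dl2 ge_min; apply/orP; right; lra.
Qed.

Let dlP t : (t < N)%N -> (forall s, (s <= t)%N -> dot (w s) (w s) < 1) ->
  forall z, dot (g t) z ^+ 2 <= dl t ^+ 2 * dot (phess B eta beta g t.+1 (w t) *m z) z.
Proof.
move=> tT hw z; have w1 := hw t (leqnn _); have [g1 g2] := g_le tT hw.
have [b0 b1] := (ltW reg_gt0, ltW beta_gt0).
rewrite dl2 minEle; case: ifPn => _.
  apply: (le_trans (leverage_dual g reg_gt0 beta_gt0 t z)).
  rewrite ler_wpM2l ?leverage_ge0// phess_formE lerDr.
  apply: (coercive_form_ge0 (k := 0)) => //.
  apply: coercive_le (bhess_coercive e_ge w1); rewrite divr_ge0//.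
    by have := e_ge; lra.
  by rewrite subr_ge0 ltW.
apply: (le_trans (dot_CS _ _)).
have := (phess_coercive B e_ge b1 g t.+1 w1).2 z; rewrite -/e -/reg => h1.
have h2 : 16 * dot (g t) (g t) * dot z z
    <= (2 * e / (1 - dot (w t) (w t)) + reg) * dot z z.
  by rewrite ler_wpM2r ?dot_ge0.
lra.
Qed.

Let ln_d := ln (d * (1 + beta * N%:R)).

Let tP := oqns_termsP B_ge0 T_gt0.
Let cE : c = 1 / 4. Proof. by []. Qed.

Lemma guarantee_in_ball t : (t <= N)%N -> dot (w t) (w t) < 1.
Proof. exact: (oqns_in_ball e_ge (ltW reg_gt0) (ltW beta_gt0) cE tP run dl_bound dlP). Qed.

Let dl_sum : \sum_(t < N) dl t ^+ 2 <= d / beta * ln_d.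
Proof.
apply: (@le_trans _ _ (\sum_(t < N) leverage B eta beta g t)).
  by apply: ler_sum => t _; rewrite dl2 ge_min lexx.
rewrite -(ler_pM2l beta_gt0).
have -> : beta * (d / beta * ln_d) = d * ln_d by field; rewrite gt_eqF.
apply: leverage_sum => // t tT; apply: (g_le tT _).1 => s st.
exact: guarantee_in_ball (leq_trans st (ltnW tT)).
Qed.

(** The quadratic terms of [Phi w g N u] are moved to the left, where they match the curvature
    granted by exp-concavity. *)
Lemma guarantee_regret u : dot u u < 1 ->
  \sum_(t < N) (dot (g t) (w t - u) - beta / 2 * dot (g t) (w t - u) ^+ 2)
    <= - e * ln (1 - dot u u) + reg / 2 + 1 + 6 * (d / beta * ln_d).
Proof.
move=> u1.
have := oqns_regret e_ge (ltW reg_gt0) (ltW beta_gt0) cE tP run dl_bound dlP u1.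
rewrite PhiE -/e -/reg (dotC u (\sum_(s < N) g s)) => h.
have E : dot (\sum_(s < N) g s) u = \sum_(t < N) dot (g t) u by rewrite dot_suml.
rewrite E in h.
have -> : \sum_(t < N) (dot (g t) (w t - u) - beta / 2 * dot (g t) (w t - u) ^+ 2)
  = \sum_(t < N) dot (g t) (w t) - \sum_(t < N) dot (g t) u
    - beta / 2 * \sum_(t < N) dot (g t) (u - w t) ^+ 2.
  rewrite mulr_sumr -!sumrB; apply: eq_bigr => t _.
  by rewrite !dotBr; ring.
have : reg / 2 * dot u u <= reg / 2 * 1.
  by rewrite ler_wpM2l ?(ltW u1)// divr_ge0// ltW.
have := dl_sum; lra.
Qed.

Lemma guarantee_changes :
  (\sum_(t < N) ~~ keep_landmark c (w t.+1) (landmark c w t))%N%:R / 5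
    <= 3 * (d / beta * ln_d) + N%:R / e.
Proof.
apply: (le_trans (landmark_changes e_ge (ltW reg_gt0) (ltW beta_gt0) cE tP run dl_bound dlP)).
by rewrite -/e lerD2r ler_pM2l// dl_sum.
Qed.

End Run.
End Guarantee.

(** * Exp-concave functions *)

Section ExpConcave.
Context {R : realType}.

(** Stands for the limit [s] to 0 in first-order arguments. *)
Lemma le_of_small_slope (x y s0 : R) : 0 < s0 ->
  (forall s, 0 < s -> s < s0 -> x <= s * y) -> x <= 0.
Proof.
move=> s00 h; rewrite leNgt; apply/negP => x0.
have y0 : 0 <= `|y| by [].
have q0 : 0 < x / (2 * (`|y| + 1)) by rewrite divr_gt0// mulr_gt0//; lra.
set s := Num.min (s0 / 2) (x / (2 * (`|y| + 1))).
have s1 : 0 < s by rewrite lt_min q0 divr_gt0.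
have s2 : s < s0 by rewrite gt_min; apply/orP; left; lra.
have s3 : s <= x / (2 * (`|y| + 1)) by rewrite ge_min lexx orbT.
have := h s s1 s2.
have : s * y <= x / (2 * (`|y| + 1)) * (`|y| + 1).
  apply: (@le_trans _ _ (s * (`|y| + 1))).
    by rewrite ler_pM2l//; have := ler_norm y; lra.
  by rewrite ler_pM2r//; lra.
have -> : x / (2 * (`|y| + 1)) * (`|y| + 1) = x / 2.
  by field; rewrite gt_eqF//; lra.
lra.
Qed.

Lemma expR_le_inv (y : R) : y < 1 -> expR y <= (1 - y)^-1.
Proof.
move=> y1; rewrite -[y]opprK expRN opprK lef_pV2 ?posrE ?expR_gt0 ?subr_gt0//.
exact: expR_ge1Dx.
Qed.

(** Powers of $e^y\ge1+y$. For [z > 0] the fourth power of [1 + y / 4] is used: its quadratic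
    coefficient 3/8 beats 1/4 even after [y >= 7 / 8 * z]. For [z <= 0] squaring suffices. *)
Lemma ln1D_le_quad (z : R) : `|z| <= 1 / 2 -> 1 + z <= expR (z - z ^+ 2 / 4).
Proof.
rewrite ler_norml => /andP[z1 z2].
have [z0|z0] := leP 0 z.
  set y := z - z ^+ 2 / 4.
  have y0 : 7 / 8 * z <= y by rewrite /y; nra.
  have -> : expR y = expR (y / 4) ^+ 4.
    by rewrite -expRM_natl; congr expR; field.
  have h : 1 + y / 4 <= expR (y / 4) by exact: expR_ge1Dx.
  apply: (@le_trans _ _ ((1 + y / 4) ^+ 4)); last first.
    by rewrite lerXn2r ?nnegrE ?expR_ge0//; lra.
  have -> : (1 + y / 4) ^+ 4 = 1 + y + 3 / 8 * y ^+ 2 + y ^+ 3 / 16 + y ^+ 4 / 256 by field.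
  have y3 : 0 <= y ^+ 3 by rewrite exprn_ge0//; lra.
  have y4 : 0 <= y ^+ 4 by rewrite exprn_ge0//; lra.
  have : (7 / 8 * z) * (7 / 8 * z) <= y * y by apply: ler_pM => //; lra.
  have : 0 <= z ^+ 2 by rewrite sqr_ge0.
  have := erefl y; rewrite {2}/y; rewrite !expr2 => h1 h2 h3; lra.
set u := - z; set q := u + u ^+ 2 / 4.
have u0 : 0 < u by rewrite oppr_gt0.
have uu : u <= 1 / 2 by rewrite /u; lra.
have q0 : q <= 3 / 4 by rewrite /q; nra.
have -> : z - z ^+ 2 / 4 = - q by rewrite /q /u sqrrN; ring.
have -> : expR (- q) = expR (- (q / 2)) ^+ 2.
  by rewrite -expRM_natl; congr expR; field.
have h : 1 - q / 2 <= expR (- (q / 2)) by exact: expR_ge1Dx.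
apply: (@le_trans _ _ ((1 - q / 2) ^+ 2)); last first.
  by rewrite lerXn2r ?nnegrE ?expR_ge0//; lra.
have q1 : u <= q by rewrite /q lerDl divr_ge0 ?sqr_ge0.
have : u * u <= q * q by apply: ler_pM => //; exact: ltW.
have -> : (1 - q / 2) ^+ 2 = 1 - q + q * q / 4 by field.
rewrite /u in q1 *; have : q = - z + (- z) * (- z) / 4 by rewrite /q /u expr2.
lra.
Qed.

(** Lowers the exp-concavity parameter. Two tangent inequalities for exp, weighted by [alpha - gam]
    and [gam], are added so that the terms linear in [D] cancel. *)
Lemma exp_mixable (alpha gam D a : R) : 0 < gam -> gam <= alpha ->
  expR (alpha * D) <= 1 + alpha * a -> expR (gam * D) <= 1 + gam * a.
Proof.
move=> g0 ga h; have a0 : 0 < alpha by apply: lt_le_trans ga.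
have E := expR_gt0 (gam * D).
have h1 : expR (gam * D) * (1 - gam * D) <= 1.
  rewrite -[leRHS](expRxMexpNx_1 (gam * D)) ler_pM2l//.
  exact: expR_ge1Dx.
have h2 : expR (gam * D) * (1 + (alpha - gam) * D) <= expR (alpha * D).
  have -> : alpha * D = gam * D + (alpha - gam) * D by ring.
  by rewrite expRD ler_pM2l// expR_ge1Dx.
rewrite -(ler_pM2l a0).
have h3 : (alpha - gam) * (expR (gam * D) * (1 - gam * D)) <= (alpha - gam) * 1.
  by rewrite ler_wpM2l// subr_ge0.
have h4 : gam * (expR (gam * D) * (1 + (alpha - gam) * D)) <= gam * (1 + alpha * a).
  by rewrite ler_pM2l// (le_trans h2).
nra.
Qed.

Context {n : nat}.
Local Notation V := 'cV[R]_n.+1.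

Lemma ext_dom (K : set V) (f : V -> R) x z :
  subdiff (ext K f) x z -> K x.
Proof. by rewrite /ext => -[]; case: ifPn => // /set_mem. Qed.

Lemma subdiff_ext (K : set V) (f : V -> R) x z y :
  subdiff (ext K f) x z -> K y -> f x + dot z (y - x) <= f y.
Proof.
move=> hz Ky; have Kx := ext_dom hz; have [_ /(_ y)] := hz.
by rewrite /ext !mem_set// -EFinD lee_fin.
Qed.

Lemma conv_seg (t : {i01 R}) (s : R) (x y : convex_lmodType V) :
  t%:num = 1 - s -> conv t x y = x + s *: (y - x) :> V.
Proof.
move=> tE; rewrite /conv/= /unstable.onem tE subKr scalerBl scale1r scalerBr addrA.
by rewrite addrAC.
Qed.

Lemma convex_set_seg (K : set V) x y (s : R) : convex_set K -> K x -> K y ->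
  0 <= s -> s <= 1 -> K (x + s *: (y - x)).
Proof.
move=> cK Kx Ky s0 s1.
have t01 : 0 <= 1 - s <= 1 by apply/andP; split; lra.
have := cK x y (Itv01 (andP t01).1 (andP t01).2) (mem_set Kx) (mem_set Ky).
by move=> /set_mem; rewrite (@conv_seg _ s).
Qed.

Lemma exp_concave_seg (K : set V) (f : V -> R) alpha x y (s : R) :
  exp_concave alpha K f -> K x -> K y -> 0 <= s -> s <= 1 ->
  (1 - s) * expR (- alpha * f x) + s * expR (- alpha * f y)
    <= expR (- alpha * f (x + s *: (y - x))).
Proof.
move=> cf Kx Ky s0 s1.
have t01 : 0 <= 1 - s <= 1 by apply/andP; split; lra.
have := cf (Itv01 (andP t01).1 (andP t01).2) x y (mem_set Kx) (mem_set Ky).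
rewrite (@conv_seg _ s)// convRE/= /unstable.onem subKr; lra.
Qed.

(** The parameter is lowered to [2 * beta]; then $|2\beta a|\le1/2$, and $\ln(1+z)\le z-z^2/4$ at
    $z=2\beta a$ is the claim multiplied by $2\beta$. *)
Lemma exp_concave_regret (K : set V) (f : V -> R) alpha beta x y z :
  convex_set K -> exp_concave alpha K f -> 0 < beta -> beta <= 1 / 8 ->
  beta <= alpha / 2 -> subdiff (ext K f) x z -> K y -> `|dot z (x - y)| <= 2 ->
  f x - f y <= dot z (x - y) - beta / 2 * dot z (x - y) ^+ 2.
Proof.
move=> cK cf b0 b1 ba hz Ky; set a := dot z (x - y) => a2.
have Kx := ext_dom hz.
have al0 : 0 < alpha by lra.
set D := f x - f y.
(* First-order condition for the concave function $e^{-\alpha f}$ at [x]: the subgradient bounds [f]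
   from below along the segment, and only the order [s] is kept. *)
have key : expR (alpha * D) <= 1 + alpha * a.
  set r := expR (alpha * D).
  suff : r - 1 - alpha * a <= 0 by lra.
  have A0 : 0 < (2 * (alpha * `|a| + 1))^-1.
    by rewrite invr_gt0 mulr_gt0// ltr_wpDl// mulr_ge0// ltW.
  set s0 := Num.min 1 (2 * (alpha * `|a| + 1))^-1.
  have s00 : 0 < s0 by rewrite lt_min ltr01 A0.
  apply: (@le_of_small_slope _ ((r - 1) * (alpha * a)) _ s00) => s sp ss.
  have s1 : s < 1 by apply: lt_le_trans ss _; rewrite ge_min lexx.
  have sa : s * (alpha * `|a|) < 1.
    have : s < (2 * (alpha * `|a| + 1))^-1.
      by apply: lt_le_trans ss _; rewrite ge_min lexx orbT.
    have B0 : 0 < alpha * `|a| + 1 by rewrite ltr_wpDl// mulr_ge0// ltW.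
    rewrite -[X in s < X]mul1r ltr_pdivlMr; last by rewrite mulr_gt0.
    nra.
  have sal : s * (alpha * a) < 1.
    apply: le_lt_trans sa; rewrite ler_pM2l// ler_pM2l//; exact: ler_norm.
  have h1 := exp_concave_seg cf Kx Ky (ltW sp) (ltW s1).
  have h2 := subdiff_ext hz (convex_set_seg cK Kx Ky (ltW sp) (ltW s1)).
  rewrite addrAC subrr add0r dotZr in h2.
  have za : dot z (y - x) = - a by rewrite /a -dotNr opprB.
  rewrite za in h2.
  have h3 : expR (- alpha * f (x + s *: (y - x)))
      <= expR (- alpha * f x) * expR (s * (alpha * a)).
    rewrite -expRD ler_expR; nra.
  have h4 := le_trans h1 h3.
  have Ex := expR_gt0 (- alpha * f x).
  have rE : expR (- alpha * f y) = expR (- alpha * f x) * r.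
    by rewrite /r -expRD; congr expR; rewrite /D; ring.
  rewrite rE in h4.
  have h5 : (1 - s) + s * r <= expR (s * (alpha * a)).
    by rewrite -(ler_pM2l Ex); lra.
  have h6 := le_trans h5 (expR_le_inv sal).
  have q0 : 0 < 1 - s * (alpha * a) by rewrite subr_gt0.
  rewrite -[X in _ <= X]mul1r ler_pdivlMr// in h6.
  rewrite -(ler_pM2l sp); nra.
have g0 : 0 < 2 * beta by rewrite mulr_gt0.
have ga : 2 * beta <= alpha by lra.
have h := exp_mixable g0 ga key.
have za : `|2 * beta * a| <= 1 / 2.
  rewrite normrM (gtr0_norm g0); have := normr_ge0 a; nra.
have := le_trans h (ln1D_le_quad za).
rewrite ler_expR => h2.
rewrite -(ler_pM2l g0); nra.
Qed.

End ExpConcave.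

(** * Surrogate losses *)

Section Surrogate.
Context {R : realType} {n : nat}.
Local Notation V := 'cV[R]_n.+1.
Implicit Types (w nu zeta v : V) (C : set V).

(* [ep = 0] for exact subgradients of [inf_conv C rho]; bisection needs [ep > 0]. *)
Definition admissible C (ep : R) w nu :=
  (forall v, C v -> `|dot nu v| <= 1 + ep) /\
  (dot nu w < 1 -> forall v, C v -> - ep <= dot nu (w - v)).

Lemma played_le w nu : enorm (played w nu) <= enorm w.
Proof.
rewrite /played; case: ifPn => // h.
rewrite enormZ ger0_norm ?invr_ge0 ?(le_trans ler01)//.
by rewrite ler_piMl ?enorm_ge0// invf_le1// (lt_le_trans ltr01).
Qed.

(** The factor [enorm w], inherited from the played point, matters for the gauge, where [b] is of
    order $\sqrt d$. *)
Lemma surrogate_norm w nu zeta b : enorm zeta <= 1 -> enorm w <= 1 -> enorm nu <= b ->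
  enorm (surrogate w nu zeta) <= 1 + enorm w * b.
Proof.
move=> z1 w1 nb; have w0 := enorm_ge0 w; have n0 := enorm_ge0 nu.
have b0 : 0 <= b := le_trans n0 nb.
rewrite /surrogate; apply: (le_trans (enormB _ _)); apply: lerD => //.
rewrite enormZ; case: ifPn => _; last by rewrite normr0 mul0r mulr_ge0.
apply: ler_pM => //; apply: (le_trans (dot_le_enorm _ _)).
have p0 := enorm_ge0 (played w nu); have := played_le w nu; have := enorm_ge0 zeta.
nra.
Qed.

(** On the relevant range $x\mapsto x-\beta x^2/2$ is increasing with slope at most 2, since the two
    arguments sum to at most 10 in absolute value. *)
Lemma quadratic_transfer (a m q ep tau beta : R) : `|a| <= 2 -> `|m| <= 5 -> `|q| <= 3 ->
  a <= m + ep -> 0 <= ep <= 1 -> 0 <= tau <= 1 -> 0 <= beta <= 1 / 8 ->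
  a - beta / 2 * a ^+ 2
    <= m + tau * q - beta / 2 * (m + tau * q) ^+ 2 + 2 * (ep + 3 * tau).
Proof.
move=> ha hm hq h1 /andP[e0 e1] /andP[t0 t1] /andP[b0 b1].
have tq : `|tau * q| <= 3 * tau by rewrite normrM (ger0_norm t0) mulrC ler_wpM2r.
move: tq hm ha; rewrite !ler_norml => /andP[tq tq'] /andP[h2 h2'] /andP[a2 a2'].
have [b8 b8'] : - 8 <= m + tau * q /\ m + tau * q <= 8 by split; lra.
have : a - (m + tau * q) <= ep + 3 * tau by lra.
move: (m + tau * q) b8 b8' => b b8 b8' ab; clear tq tq' h1 h2 h2' hq.
have [le|le] := leP a b.
  have : 0 <= (b - a) * (1 - beta / 2 * (a + b)).
    rewrite mulr_ge0 ?subr_ge0//.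
    have : beta / 2 * (a + b) <= beta / 2 * 10 by rewrite ler_wpM2l//; lra.
    lra.
  rewrite expr2; lra.
have : (a - b) * (1 - beta / 2 * (a + b)) <= (a - b) * 2.
  rewrite ler_wpM2l ?subr_ge0 ?(ltW le)//.
  have : beta / 2 * (- 10) <= beta / 2 * (a + b) by rewrite ler_wpM2l//; lra.
  lra.
rewrite !expr2; lra.
Qed.

Lemma surrogate_regret C ep tau beta w nu zeta v :
  C `<=` eball 1 -> enorm w <= 1 -> admissible C ep w nu -> enorm zeta <= 1 ->
  0 <= ep <= 1 -> 0 <= tau <= 1 -> 0 <= beta <= 1 / 8 -> C v ->
  let a := dot zeta (played w nu - v) in
  let b := dot (surrogate w nu zeta) (w - (1 - tau) *: v) in
  `|a| <= 2 /\ a - beta / 2 * a ^+ 2 <= b - beta / 2 * b ^+ 2 + 2 * (ep + 3 * tau).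
Proof.
move=> CB w1 [N2 N3] z1 /andP[e0 e1] /andP[t0 t1] /andP[b0 b1] Cv a b.
have v1 : enorm v <= 1 := CB v Cv.
have bnd x : enorm x <= 1 -> `|dot zeta x| <= 1.
  move=> x1; apply: (le_trans (dot_le_enorm _ _)).
  by have := enorm_ge0 x; have := enorm_ge0 zeta; nra.
have zw := bnd w w1; have zv := bnd v v1.
have zu := bnd _ (le_trans (played_le w nu) w1).
have nv := N2 v Cv.
have aE : a = dot zeta (played w nu) - dot zeta v by rewrite /a dotBr.
have bE : b = dot (surrogate w nu zeta) (w - v) + tau * dot (surrogate w nu zeta) v.
  rewrite /b -dotZr -dotDr scalerBl scale1r opprB addrA; congr dot.
  by rewrite addrAC.
have gv : `|dot (surrogate w nu zeta) v| <= 3.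
  rewrite /surrogate dotBl dotZl; case: ifPn => _; last by rewrite mul0r subr0; lra.
  apply: (le_trans (ler_normB _ _)); rewrite normrM.
  have := normr_ge0 (dot zeta (played w nu)); have := normr_ge0 (dot nu v); nra.
have [h1 h2] : a <= dot (surrogate w nu zeta) (w - v) + ep
    /\ `|dot (surrogate w nu zeta) (w - v)| <= 5.
  have := N3; rewrite aE /surrogate /played.
  move: zu; rewrite /played; set gam := dot nu w => zu N3'.
  move: zw zv zu nv; rewrite !ler_norml => /andP[zw zw'] /andP[zv zv'] /andP[zu zu'] /andP[nv nv'].
  case: (leP 1 gam) zu zu' N3' => g1; rewrite /= ?dotZr => zu zu' N3'.
    have g0 : 0 < gam by lra.
    (* With rescaling and correction, [gam * dot zeta u = dot zeta w], so the surrogate is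
       orthogonal to [w]; the loss is at most [ep] by the polar bound on [nu]. *)
    case: ifPn => zw0.
      rewrite !dotBl !dotZl !dotBr -/gam.
      have E : gam^-1 * dot zeta w * gam = dot zeta w by field; rewrite gt_eqF.
      have q0 : gam^-1 * dot zeta w <= 0 by rewrite mulr_ge0_le0 ?invr_ge0// ltW.
      move: (gam^-1 * dot zeta w) zu zu' E q0 => q zu zu' E q0.
      have -> : q * (gam - dot nu v) = dot zeta w - q * dot nu v by rewrite mulrBr E.
      have p1 : `|q * dot nu v| <= 2.
        rewrite normrM; have : `|q| <= 1 by rewrite ler_norml zu zu'.
        have : `|dot nu v| <= 1 + ep by rewrite ler_norml nv nv'.
        have := normr_ge0 q; have := normr_ge0 (dot nu v); nra.
      move: p1; rewrite !ler_norml => /andP[p1 p2]; split.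
        have : - q * (dot nu v - 1) <= 1 * ep.
          have : - q * (dot nu v - 1) <= - q * ep by rewrite ler_wpM2l//; lra.
          have : - q * ep <= 1 * ep by rewrite ler_wpM2r//; lra.
          lra.
        lra.
      by apply/andP; split; lra.
    (* When [dot zeta w >= 0], shrinking [w] to the played point only helps. *)
    have q0 : gam^-1 * dot zeta w <= dot zeta w.
      by rewrite ler_piMl ?invf_le1//; rewrite leNgt.
    rewrite scale0r subr0 !dotBr; split; first lra.
    by apply/andP; split; lra.
  (* Here the played point is [w], and the approximate monotonicity of [nu] makes the correction
     cost at most [ep]. *)
  have := N3' isT v Cv; rewrite dotBr -/gam => N3v.
  case: ifPn => zw0.
    rewrite !dotBl !dotZl !dotBr -/gam.
    have p1 : - dot zeta w * (- ep) <= - dot zeta w * (gam - dot nu v).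
      by rewrite ler_wpM2l//; lra.
    have p2 : - dot zeta w * ep <= 1 * ep by rewrite ler_wpM2r//; lra.
    have p3 : - dot zeta w * (gam - dot nu v) <= 1 * 3.
      have : - dot zeta w * (gam - dot nu v) <= - dot zeta w * 3 by rewrite ler_wpM2l//; lra.
      lra.
    split; first lra.
    by apply/andP; split; lra.
  rewrite scale0r subr0 !dotBr; split; first lra.
  by apply/andP; split; lra.
have a2 : `|a| <= 2.
  rewrite aE; apply: (le_trans (ler_normB _ _)); lra.
split=> //; rewrite bE.
by apply: (quadratic_transfer a2 h2 gv h1); rewrite ?e0 ?t0 ?b0.
Qed.

End Surrogate.

(** * Subgradients of the inf-convolution of [rho] with [C] *)

Section InfConvolution.
Context {R : realType} {n : nat}.
Local Notation V := 'cV[R]_n.+1.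
Implicit Types (w nu zeta v x y : V) (C : set V) (rho : V -> \bar R).

Lemma inf_conv_le C rho w x (r : R) : C x -> (rho (w - x)%R <= r%:E)%E ->
  (inf_conv C rho w <= r%:E)%E.
Proof. by move=> Cx; apply: le_trans; apply: ereal_inf_lbound; exists x. Qed.

Lemma inf_conv_ge0 C rho w : (forall x, 0 <= rho x)%E -> (0 <= inf_conv C rho w)%E.
Proof. by move=> h; apply: le_ereal_inf_tmp => _ [x _ <-]. Qed.

(** Test the subgradient at [w + v]. The infimum may not be attained, hence a near-minimiser with
    slack below half of a supposed violation. *)
Lemma subdiff_inf_conv_shift C rho w nu v (k : R) :
  (forall y (r : R), (rho y <= r%:E)%E -> (rho (y + v)%R <= (r + k)%:E)%E) ->
  subdiff (inf_conv C rho) w nu -> dot nu v <= k.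
Proof.
move=> hr [fw /(_ (w + v))]; rewrite addrAC subrr add0r -(fineK fw).
set s := fine _ => h; rewrite leNgt; apply/negP => kv.
set dl := (dot nu v - k) / 2.
have dl0 : 0 < dl by rewrite divr_gt0// subr_gt0.
have : (inf_conv C rho w < (s + dl)%:E)%E by rewrite -(fineK fw) lte_fin ltrDl.
case/ereal_inf_lt => _ [x Cx <-] hx.
have : (inf_conv C rho (w + v)%R <= (s + dl + k)%:E)%E.
  apply: (inf_conv_le Cx); rewrite addrAC; apply: hr; exact: ltW.
move/(le_trans h); rewrite -EFinD lee_fin /dl; lra.
Qed.

Lemma subdiff_inf_conv_monotone C rho w nu v : (forall x, 0 <= rho x)%E ->
  (rho 0%R <= 0)%E -> subdiff (inf_conv C rho) w nu -> C v -> 0 <= dot nu (w - v).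
Proof.
move=> r0 r00 [fw /(_ v) h] Cv.
have : (inf_conv C rho v <= 0%:E)%E by apply: (inf_conv_le Cv); rewrite subrr.
move/(le_trans h); have := inf_conv_ge0 C w r0; rewrite -(fineK fw).
rewrite -EFinD !lee_fin -opprB dotNr; lra.
Qed.

Lemma gauge_le C x y (l : R) : 0 <= l -> C y -> x = l *: y -> (gauge C x <= l%:E)%E.
Proof. by move=> l0 Cy xE; apply: ereal_inf_lbound; exists l => //; split=> //; exists y. Qed.

Lemma gauge_ge0 C x : (0 <= gauge C x)%E.
Proof. by apply: le_ereal_inf_tmp => _ [l [l0 _] <-]; rewrite lee_fin. Qed.

Lemma gauge0 C : C !=set0 -> (gauge C 0%R <= 0)%E.
Proof. by move=> [y Cy]; apply: (gauge_le (y := y)) => //; rewrite scale0r. Qed.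

(** If [y = l *: x], then [y + v] is [l + 1] times a convex combination of [x] and [v]. *)
Lemma gauge_shift C v y (r : R) : convex_set C -> C v ->
  (gauge C y <= r%:E)%E -> (gauge C (y + v)%R <= (r + 1)%:E)%E.
Proof.
move=> cC Cv hy; apply/lee_addgt0Pr => e e0.
have : (gauge C y < (r + e)%:E)%E by apply: le_lt_trans hy _; rewrite lte_fin ltrDl.
case/ereal_inf_lt => _ [l [l0 [x Cx yE]] <-]; rewrite lte_fin => le.
apply: (@le_trans _ _ (l + 1)%:E); last by rewrite -EFinD lee_fin; lra.
have l1 : 0 < l + 1 by rewrite ltr_wpDl.
apply: (@gauge_le C _ (x + (l + 1)^-1 *: (v - x))); first exact: ltW.
  apply: convex_set_seg => //; first by rewrite invr_ge0 ltW.
  by rewrite invf_le1// lerDr.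
rewrite yE scalerDr scalerA divff ?gt_eqF// scale1r scalerDl scale1r -addrA.
by congr (_ + _); rewrite addrC subrK.
Qed.

Section Symmetric.
Variable C : set V.
Local Notation d := (n.+1%:R : R).
Hypotheses (cC : convex_set C) (C0 : C !=set0).

Lemma subdiff_gauge_polar w nu v : subdiff (inf_conv C (gauge C)) w nu ->
  C v -> dot nu v <= 1.
Proof. by move=> h Cv; apply: subdiff_inf_conv_shift h => y r; exact: gauge_shift. Qed.

Hypotheses (sC : C = -%R @` C) (bC : eball (1 / Num.sqrt d) `<=` C).

Lemma symmetric_opp v : C v -> C (- v).
Proof. by move=> Cv; rewrite sC; exists v. Qed.

(** Tested on the point of the inscribed ball in the direction of [nu]. *)
Lemma polar_norm (k : R) nu : 0 <= k -> (forall v, C v -> dot nu v <= k) ->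
  enorm nu <= k * Num.sqrt d.
Proof.
move=> k0 h; have [->|nu0] := eqVneq nu 0.
  by rewrite enorm0 mulr_ge0 ?sqrtr_ge0.
have m0 : 0 < enorm nu by rewrite lt_def enorm_eq0 nu0 enorm_ge0.
have s0 : 0 < Num.sqrt d by rewrite sqrtr_gt0 ltr0n.
have := h ((Num.sqrt d * enorm nu)^-1 *: nu).
have -> : dot nu ((Num.sqrt d * enorm nu)^-1 *: nu) = enorm nu / Num.sqrt d.
  by rewrite dotZr -sqr_enorm; field; rewrite !gt_eqF.
rewrite ler_pdivrMr//; apply; apply: bC.
rewrite /eball/= enormZ ger0_norm ?invr_ge0 ?mulr_ge0 ?enorm_ge0 ?sqrtr_ge0//.
by rewrite invfM mulfVK ?gt_eqF// div1r.
Qed.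

Lemma subdiff_gauge_admissible w nu : subdiff (inf_conv C (gauge C)) w nu ->
  admissible C 0 w nu /\ enorm nu <= Num.sqrt d.
Proof.
move=> h; split; last by rewrite -[leRHS]mul1r; apply: polar_norm => // v; exact: subdiff_gauge_polar h.
split=> [v Cv|_ v Cv].
  rewrite addr0 ler_norml (subdiff_gauge_polar h Cv) andbT lerNl -dotNr.
  exact: subdiff_gauge_polar h (symmetric_opp Cv).
rewrite oppr0; apply: subdiff_inf_conv_monotone h Cv; first exact: gauge_ge0.
exact: gauge0.
Qed.

End Symmetric.

Lemma subdiff_dist_admissible C w nu : C `<=` eball 1 ->
  subdiff (inf_conv C (fun x => (enorm x)%:E)) w nu ->
  admissible C 0 w nu /\ enorm nu <= 1.
Proof.
move=> CB h.
have n1 v : dot nu v <= enorm v.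
  apply: subdiff_inf_conv_shift h => y r; rewrite !lee_fin => yr.
  by rewrite (le_trans (enormD _ _))// lerD2r.
have nu1 : enorm nu <= 1.
  have := n1 nu; rewrite -sqr_enorm; have := enorm_ge0 nu; nra.
split=> //; split=> [v Cv|_ v Cv].
  rewrite addr0; apply: (le_trans (dot_le_enorm _ _)).
  by have := CB v Cv; rewrite /eball/=; have := enorm_ge0 nu; have := enorm_ge0 v; nra.
rewrite oppr0; apply: subdiff_inf_conv_monotone h Cv => [x|].
  by rewrite lee_fin enorm_ge0.
by rewrite enorm0.
Qed.

End InfConvolution.

(** * Subgradients at interior points *)

Section Subgradients.
Context {R : realType} {n : nat}.
Local Notation V := 'cV[R]_n.+1.
Implicit Types (x y u v z h : V) (K : set V) (f : V -> R).

Definition convex_fun_on K f := forall x y (s : R), K x -> K y -> 0 <= s -> s <= 1 ->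
  f (x + s *: (y - x)) <= (1 - s) * f x + s * f y.

Definition interior_point K u :=
  exists2 r : R, 0 < r & forall v, enorm (v - u) <= r -> K v.

Lemma enorm_delta i (a : R) : enorm (a *: (delta_mx i ord0 : V)) = `|a|.
Proof. by rewrite enormZ /enorm dot_delta mxE !eqxx sqrtr1 mulr1. Qed.

(** One coordinate of a finite-dimensional Hahn-Banach extension. The slope along [i] must exceed
    the quotients [D v / c v] with [c v < 0] and stay below those with [c v > 0]; the supremum of
    the former works. Both sides are nonempty since [u] is interior. *)
Lemma subgradient_extend K f u z (i : 'I_n.+1) : convex_set K -> convex_fun_on K f ->
  interior_point K u ->
  (forall v, K v -> (forall j : 'I_n.+1, (i <= j)%N -> (v - u) j ord0 = 0) ->
     f u + dot z (v - u) <= f v) ->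
  exists z', forall v, K v -> (forall j : 'I_n.+1, (i < j)%N -> (v - u) j ord0 = 0) ->
     f u + dot z' (v - u) <= f v.
Proof.
move=> cK cf [r r0 hr] hz.
pose D v := f v - f u - dot z (v - u).
pose P v := K v /\ forall j : 'I_n.+1, (i < j)%N -> (v - u) j ord0 = 0.
pose c v := (v - u) i ord0.
(* The segment from [v] to [v'] meets [c = 0], where [hz] applies; convexity of [f] carries the
   inequality to the end points. *)
have cross v v' : P v -> P v' -> 0 < c v -> c v' < 0 -> D v' / c v' <= D v / c v.
  move=> [Kv Pv] [Kv' Pv'] cv cv'.
  have cc : 0 < c v - c v' by rewrite subr_gt0 (lt_trans cv').
  set s := c v / (c v - c v').
  have s0 : 0 <= s by rewrite divr_ge0 ?ltW.
  have s1 : s <= 1 by rewrite ler_pdivrMr// mul1r; lra.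
  set p := v + s *: (v' - v).
  have pE : p - u = (1 - s) *: (v - u) + s *: (v' - u).
    by rewrite /p; apply/colP => j; rewrite !mxE; ring.
  have Kp : K p by apply: convex_set_seg.
  have pj j : (p - u) j ord0 = (1 - s) * (v - u) j ord0 + s * (v' - u) j ord0.
    by rewrite pE !mxE; ring.
  have sc : (1 - s) * c v + s * c v' = 0 by rewrite /s; field; rewrite gt_eqF.
  have pz : forall j : 'I_n.+1, (i <= j)%N -> (p - u) j ord0 = 0.
    move=> j; rewrite leq_eqVlt => /orP[/eqP/val_inj <-|ij]; rewrite pj//.
    by rewrite Pv// Pv'// !mulr0 addr0.
  have h1 := hz p Kp pz.
  have h2 := cf v v' s Kv Kv' s0 s1; rewrite -/p in h2.
  have h3 : 0 <= (1 - s) * D v + s * D v'.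
    rewrite pE !dotE_lin in h1; rewrite /D !dotE_lin; lra.
  have h4 : 0 <= (- c v') * D v + c v * D v'.
    have -> : (- c v') * D v + c v * D v' = (c v - c v') * ((1 - s) * D v + s * D v').
      by rewrite /s; field; rewrite gt_eqF.
    by rewrite mulr_ge0// ltW.
  rewrite ler_ndivrMr// mulrAC ler_pdivrMr//; lra.
pose e := delta_mx i ord0 : V.
have Pe a : `|a| <= r -> P (u + a *: e) /\ c (u + a *: e) = a.
  move=> ar; have uE : u + a *: e - u = a *: e by rewrite addrC addKr.
  split; last by rewrite /c uE !mxE !eqxx mulr1.
  split; first by apply: hr; rewrite uE enorm_delta.
  move=> j ij; have /negPf ji : j != i by apply: contraTneq ij => ->; rewrite ltnn.
  by rewrite uE !mxE ji mulr0.
have [Pp cp] := Pe r (eq_ind_r (fun q => q <= r) (lexx r) (ger0_norm (ltW r0))).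
have [Pm cm] : P (u + (- r) *: e) /\ c (u + (- r) *: e) = - r.
  by apply: Pe; rewrite normrN ger0_norm// ltW.
pose A := [set D v / c v | v in [set v | P v /\ c v < 0]].
have A0 : A !=set0.
  by exists (D (u + (- r) *: e) / c (u + (- r) *: e)); exists (u + (- r) *: e) => //; split=> //; rewrite cm oppr_lt0.
have Aub v : P v -> 0 < c v -> ubound A (D v / c v).
  by move=> Pv cv _ [v' [Pv' cv'] <-]; exact: cross.
have hA : has_sup A.
  by split=> //; exists (D (u + r *: e) / c (u + r *: e)); apply: Aub; rewrite ?cp.
exists (z + sup A *: e) => v Kv Pv.
rewrite dotDl dotZl (dotC e) dot_delta -/(c v).
suff : sup A * c v <= D v by rewrite /D; lra.
have [cv|cv|cv] := ltrgtP (c v) 0.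
- rewrite -ler_ndivrMr//; apply: ub_le_sup; first by case: hA.
  by exists v.
- by rewrite -ler_pdivlMr//; apply: ge_sup => //; apply: Aub.
- rewrite cv mulr0 /D subr_ge0 lerBrDl; apply: hz => // j.
  by rewrite leq_eqVlt => /orP[/eqP/val_inj <-//|]; exact: Pv.
Qed.

Lemma convex_subgradient K f u : convex_set K -> convex_fun_on K f ->
  interior_point K u -> exists z, forall v, K v -> f u + dot z (v - u) <= f v.
Proof.
move=> cK cf iu.
have : forall k, (k <= n.+1)%N -> exists z, forall v, K v ->
    (forall j : 'I_n.+1, (k <= j)%N -> (v - u) j ord0 = 0) -> f u + dot z (v - u) <= f v.
  elim=> [|k IH] kn.
    exists 0 => v _ h; suff -> : v = u by rewrite subrr dot0r addr0.
    by apply/eqP; rewrite -subr_eq0; apply/eqP/colP => j; rewrite h// mxE.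
  have [z hz] := IH (ltnW kn).
  exact: (@subgradient_extend K f u z (Ordinal kn)).
move=> /(_ n.+1 (leqnn _)) [z hz]; exists z => v Kv; apply: hz => // j.
by rewrite leqNgt ltn_ord.
Qed.

(** Tangent of exp at [- alpha * m], where [m] is the chord value: the linear terms average to
    zero. *)
Lemma exp_concave_convex K f alpha : 0 < alpha -> exp_concave alpha K f ->
  convex_fun_on K f.
Proof.
move=> a0 cf x y s Kx Ky s0 s1; have := exp_concave_seg cf Kx Ky s0 s1.
set p := x + _; set m := (1 - s) * f x + s * f y => h.
have tangent t : expR (- alpha * m) * (1 + (- alpha * t - - alpha * m)) <= expR (- alpha * t).
  have -> : expR (- alpha * t) = expR (- alpha * m) * expR (- alpha * t - - alpha * m).
    by rewrite -expRD; congr expR; ring.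
  by rewrite ler_pM2l ?expR_gt0// expR_ge1Dx.
have h1 : (1 - s) * (expR (- alpha * m) * (1 + (- alpha * f x - - alpha * m)))
    <= (1 - s) * expR (- alpha * f x) by rewrite ler_wpM2l// subr_ge0.
have h2 : s * (expR (- alpha * m) * (1 + (- alpha * f y - - alpha * m)))
    <= s * expR (- alpha * f y) by rewrite ler_wpM2l.
have h3 : expR (- alpha * m) <= expR (- alpha * f p).
  apply: le_trans h.
  have -> : expR (- alpha * m) = (1 - s) * (expR (- alpha * m) * (1 + (- alpha * f x - - alpha * m)))
     + s * (expR (- alpha * m) * (1 + (- alpha * f y - - alpha * m))) by rewrite /m; ring.
  exact: lerD.
rewrite ler_expR in h3; rewrite -(ler_pM2l a0); lra.
Qed.

Lemma lipschitz_interior K f u v :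
  convex_set K -> convex_fun_on K f -> interior_point K u -> K v ->
  (forall w z, subdiff (ext K f) w z -> enorm z <= 1) ->
  f u - enorm (v - u) <= f v.
Proof.
move=> cK cf iu Kv hz; have [z h] := convex_subgradient cK cf iu.
have Ku : K u by case: iu => r r0; apply; rewrite subrr enorm0 ltW.
have z1 : enorm z <= 1.
  apply: (hz u); split=> [|w]; rewrite /ext mem_set//; case: ifPn => [/set_mem Kw|_].
    by rewrite -EFinD lee_fin h.
  by rewrite leey.
have := h v Kv; have := dot_le_enorm z (v - u); rewrite ler_norml => /andP[h1 _].
have := enorm_ge0 (v - u); nra.
Qed.

(** If [u] were not interior, a subgradient [q] at [u] of the Minkowski functional [g] of [K] would
    be a nonzero outward normal, and [z + M *: q] a subgradient of [f] for every [M >= 0]. *)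
Lemma subdiff_interior K f u z (r0 : R) : convex_set K -> 0 < r0 -> eball r0 `<=` K ->
  subdiff (ext K f) u z -> (forall z', subdiff (ext K f) u z' -> enorm z' <= 1) ->
  interior_point K u.
Proof.
move=> cK r00 rK uz hz.
pose S x := [set l : R | 0 < l /\ K (l^-1 *: x)].
pose g x := inf (S x).
have S_lb x : lbound (S x) 0 by move=> l [l0 _]; exact: ltW.
have S_ne x : S x !=set0.
  exists ((enorm x + 1) / r0); have x0 := enorm_ge0 x; split.
    by rewrite divr_gt0// ltr_wpDl.
  apply: rK; rewrite /eball/= enormZ invf_div ger0_norm ?divr_ge0 ?(ltW r00)//; last lra.
  by rewrite mulrAC ler_pdivrMr ?ler_pM2l//; lra.
have S_inf x : has_inf (S x) by split=> //; exists 0.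
have g_le x l : 0 < l -> K (l^-1 *: x) -> g x <= l.
  by move=> l0 Kl; apply: ge_inf; [exists 0|split].
have cg : convex_fun_on setT g.
  move=> x y s _ _ s0 s1; apply/ler_addgt0Pr => e e0.
  have [lx [lx0 Kx] hx] := inf_adherent e0 (S_inf x).
  have [ly [ly0 Ky] hy] := inf_adherent e0 (S_inf y).
  rewrite -/(g x) in hx; rewrite -/(g y) in hy.
  set L := (1 - s) * lx + s * ly.
  have L0 : 0 < L.
    rewrite /L; have [s2|s2] := leP s (1 / 2).
      by apply: ltr_pwDl; [rewrite mulr_gt0//; lra|rewrite mulr_ge0// ltW].
    by apply: ltr_wpDl; [rewrite mulr_ge0 ?subr_ge0// ltW|rewrite mulr_gt0//; lra].
  apply: (@le_trans _ _ L).
    apply: g_le => //.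
    have -> : L^-1 *: (x + s *: (y - x))
      = lx^-1 *: x + (s * ly / L) *: (ly^-1 *: y - lx^-1 *: x).
      apply/colP => j; rewrite !mxE /L; field.
      by rewrite !gt_eqF// -/L.
    apply: convex_set_seg => //; first by apply: divr_ge0; [apply: mulr_ge0 => //|]; exact: ltW.
    rewrite ler_pdivrMr// mul1r /L lerDr mulr_ge0 ?subr_ge0// ltW//.
  have : (1 - s) * lx <= (1 - s) * (g x + e) by rewrite ler_wpM2l ?subr_ge0// ltW.
  have : s * ly <= s * (g y + e) by rewrite ler_wpM2l// ltW.
  rewrite /L; lra.
have K0 : K 0 by apply: rK; rewrite /eball/= enorm0 ltW.
have [g1|g1] := ltP (g u) 1.
  have e0 : 0 < 1 - g u by rewrite subr_gt0.
  have [l [l0 Kl]] := inf_adherent e0 (S_inf u).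
  rewrite -/(g u) addrC subrK => l1.
  exists ((1 - l) * r0) => [|v hv]; first by rewrite mulr_gt0// subr_gt0.
  have -> : v = l^-1 *: u + (1 - l) *: ((1 - l)^-1 *: (v - u) - l^-1 *: u).
    apply/colP => j; rewrite !mxE; field; rewrite gt_eqF// gt_eqF// subr_gt0//.
  apply: convex_set_seg => //; [|lra|lra].
  apply: rK; rewrite /eball/= enormZ ger0_norm ?invr_ge0 ?subr_ge0 ?(ltW l1)//.
  by rewrite mulrC ler_pdivrMr ?subr_gt0// mulrC.
have iu : interior_point setT u by exists 1.
have cT : convex_set ([set: V] : set (convex_lmodType V)) by move=> *; rewrite inE.
have [q hq] := convex_subgradient cT cg iu.
have qK v : K v -> dot q (v - u) <= 0.
  move=> Kv; have := hq v I; have : g v <= 1 by apply: g_le; rewrite ?invr1 ?scale1r.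
  lra.
have q0 : 0 < enorm q.
  rewrite lt_def enorm_ge0 andbT enorm_eq0; apply/eqP => q0.
  have := hq 0 I; rewrite q0 dot0l.
  have : g 0 <= 1 / 2 by apply: g_le; rewrite ?scaler0//; lra.
  lra.
(* Two vectors of norm at most 1 cannot differ by one of norm 3. *)
exfalso; pose M := 3 / enorm q.
have Ku := ext_dom uz.
have M0 : 0 < M by rewrite divr_gt0.
have : enorm (z + M *: q) <= 1.
  apply: hz; split=> [|w]; rewrite /ext mem_set//; case: ifPn => [/set_mem Kw|_].
    rewrite -EFinD lee_fin dotDl dotZl.
    have := subdiff_ext uz Kw; have := qK w Kw; nra.
  by rewrite leey.
have := hz z uz.
have : enorm (M *: q) = 3 by rewrite enormZ gtr0_norm// divfK// gt_eqF.
have := enormB (z + M *: q) z; rewrite [z + _]addrC addrK; lra.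
Qed.

End Subgradients.

(** * From regret to expected excess risk *)

Section Independence.
Context {R : realType} {n : nat} (dX dO : measure_display)
  (Xi : measurableType dX) (Omega : measurableType dO).
Local Notation V := 'cV[R]_n.+1.
Variables (P : probability Omega R) (mu : probability Xi R).
Variable xi : nat -> Omega -> Xi.
Hypothesis xi_iid : iid P mu xi.
Local Open Scope ereal_scope.

Definition past (k : nat) : set (set Omega) :=
  <<s [set E | exists s (D : set Xi),
         [/\ (s < k)%N, measurable D & E = xi s @^-1` D]] >>.

Let xi_meas t : measurable_fun setT (xi t). Proof. by case: xi_iid. Qed.

Let xi_preimage t A : measurable A -> measurable (xi t @^-1` A).
Proof. by move=> mA; rewrite -[X in measurable X]setTI; exact: xi_meas. Qed.

Lemma past_measurable k E : past k E -> measurable E.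
Proof.
apply: smallest_sub; first exact: sigma_algebra_measurable.
by move=> _ [s [D [_ mD ->]]]; exact: xi_preimage.
Qed.

(** The finite measures $E\mapsto P(E\cap\{\xi_t\in A\})$ and $E\mapsto\mu(A)P(E)$ agree on finite
    intersections of past events, a pi-system generating the past. *)
Lemma past_independent t E A : past t E -> measurable A ->
  P (E `&` xi t @^-1` A) = P E * mu A.
Proof.
move=> tE mA.
pose G := [set E | exists2 D : nat -> set Xi, (forall s, measurable (D s))
  & E = \bigcap_(s in `I_t) xi s @^-1` D s].
pose H := [set X | G X /\ X `<=` [set: Omega]].
have mF : measurable (xi t @^-1` A) by exact: xi_preimage.
have muA : 0 <= mu A by [].
have muAfin : mu A \is a fin_num by exact: fin_num_measure.
pose k := NngNum (fine_ge0 muA).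
have Gm : H `<=` measurable.
  move=> _ [[D mD ->] _]; apply: fin_bigcap_measurable; first exact: finite_II.
  by move=> s _; exact: xi_preimage.
have GI : setI_closed H.
  move=> _ _ [[D mD ->] _] [[D' mD' ->] _]; split=> //.
  exists (fun s => D s `&` D' s) => [s|]; first exact: measurableI.
  by rewrite -bigcapI; apply: eq_bigcapr => s _; rewrite preimage_setI.
have GE : forall X, H X -> mrestr P mF X = mscale k P X.
  move=> _ [[D mD ->] _]; rewrite /mrestr /mscale/= fineK//.
  have [_ marg indep] := xi_iid.
  pose D' s := if s == t then A else D s.
  have mD' s : measurable (D' s) by rewrite /D'; case: ifP.
  have eqD s : (s < t)%N -> D' s = D s by move=> st; rewrite /D' ltn_eqF.
  have -> : (\bigcap_(s in `I_t) xi s @^-1` D s) `&` xi t @^-1` A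
      = \bigcap_(s in `I_t.+1) xi s @^-1` D' s.
    apply/seteqP; split=> om.
      move=> [h hA] s /=; rewrite ltnS leq_eqVlt => /orP[/eqP ->|st].
        by rewrite /D' eqxx.
      by rewrite eqD//; exact: h.
    move=> h; split; last by have := h t (ltnSn t); rewrite /= /D' eqxx.
    by move=> s /= st; have := h s (leqW st); rewrite /= eqD.
  rewrite indep// indep// big_ord_recr/= muleC marg// /D' eqxx; congr (_ * _).
  by apply: eq_bigr => s _; rewrite ltn_eqF.
have := @g_sigma_algebra_measure_unique_trace _ _ _ G setT measurableT Gm GI
  (mrestr P mF) (mscale k P).
have HT : H setT.
  split=> //; exists (fun=> setT) => //.
  by apply/seteqP; split.
move=> /(_ (GE _ HT) GE) uniq.
have fin : mrestr P mF setT < +oo.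
  by rewrite /mrestr setTI; apply: le_lt_trans (probability_le1 P mF) (ltry 1).
have {}uniq := uniq fin (fun _ _ => @subsetT _ _).
have := uniq E; rewrite /= /mrestr /mscale/= fineK// muleC; apply.
apply: smallest_sub tE; first exact: smallest_sigma_algebra.
move=> _ [s [D [st mD ->]]]; apply: sub_sigma_algebra; split=> //.
exists (fun s' => if s' == s then D else setT) => [s'|]; first by case: ifP.
apply/seteqP; split=> om; last by move=> /(_ s st); rewrite /= eqxx.
by move=> h s' _ /=; case: eqP => [->|].
Qed.

Lemma past_setT k : past k setT.
Proof.
have [p0 pC _] := smallest_sigma_algebra setT [set E | exists s (D : set Xi), [/\ (s < k)%N, measurable D & E = xi s @^-1` D]].
by have := pC _ p0; rewrite setD0.
Qed.

(** The image under [xi t] of [P] restricted to [E] is [P E] times [mu]. *)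
Lemma ge0_integral_past t E (g : Xi -> \bar R) : past t E ->
  measurable_fun setT g -> (forall x, 0 <= g x) ->
  \int[P]_(om in E) g (xi t om) = P E * \int[mu]_x g x.
Proof.
move=> tE mg g0; have mE := past_measurable tE.
have PE0 : 0 <= P E by [].
have PEfin : P E \is a fin_num by exact: fin_num_measure.
pose k := NngNum (fine_ge0 PE0).
have mgx : measurable_fun setT (g \o xi t) by exact: measurableT_comp.
transitivity (\int[mrestr P mE]_(om in E) g (xi t om)).
  apply: eq_measure_integral => A mA AE; rewrite /= /mrestr.
  by congr (P _); apply/esym/setIidl.
transitivity (\int[mrestr P mE]_om g (xi t om)).
  apply/esym; rewrite (@ge0_negligible_integral _ _ _ _ setT (~` E))//.
  - by rewrite setDE setCK setTI.
  - exact: measurableC.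
  - by rewrite /= /mrestr setICl measure0.
transitivity (\int[pushforward (mrestr P mE) (xi t)]_x g x).
  by rewrite ge0_integral_pushforward// preimage_setT.
transitivity (\int[mscale k mu]_x g x).
  apply: eq_measure_integral => A mA _.
  rewrite /= /pushforward /mrestr /mscale/= fineK// setIC.
  exact: past_independent.
by rewrite ge0_integral_mscale//= fineK.
Qed.

(** Applied to events [E] fixing the cell of u_t: on each of them the fluctuation at a fixed point
    has mean zero. *)
Lemma centered_past t E (g : Xi -> R) : past t E -> mu.-integrable setT (EFin \o g) ->
  let h := (fun om => (g (xi t om) - fine (\int[mu]_x (g x)%:E))%:E) \_ E in
  P.-integrable setT h /\ \int[P]_om h om = 0.
Proof.
move=> tE ig h; have mE := past_measurable tE.
pose c := fine (\int[mu]_x (g x)%:E).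
pose g' x := (g x - c)%R.
have fing : \int[mu]_x (g x)%:E \is a fin_num by exact: integrable_fin_num.
have mu1 : mu setT = 1 by exact: probability_setT.
have ic : mu.-integrable setT (EFin \o (cst c : Xi -> R)).
  by apply: finite_measure_integrable_cst.
have ig' : mu.-integrable setT (EFin \o g').
  have := integrableB measurableT ig ic.
  by apply: eq_integrable.
have int0 : \int[mu]_x (EFin \o g') x = 0.
  rewrite (_ : EFin \o g' = (fun x => (EFin \o g) x - (EFin \o cst c) x))//.
  rewrite integralB_EFin//= integral_cst// [X in c%:E * X]probability_setT mule1 /c fineK// subee//.
have mg' : measurable_fun setT (EFin \o g') by case/integrableP: ig'.
have ih : P.-integrable E (fun om => (g' (xi t om))%:E).
  apply/integrableP; split.
    apply: (@measurable_funS _ _ _ _ setT) => //.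
    by apply: (measurableT_comp mg').
  rewrite (ge0_integral_past (g := fun x => `|(g' x)%:E|) tE) //.
    apply: lte_mul_pinfty => //; first exact: fin_num_measure.
    by case/integrableP: ig'.
  exact: measurableT_comp.
split; first by apply/(integrable_mkcond _ mE).1.
rewrite -integral_mkcond integralE.
have posE : (fun om => (g' (xi t om))%:E)^\+ = (fun om => (EFin \o g')^\+ (xi t om)).
  by apply/funext => om; rewrite !funeposE.
have negE : (fun om => (g' (xi t om))%:E)^\- = (fun om => (EFin \o g')^\- (xi t om)).
  by apply/funext => om; rewrite !funenegE.
rewrite posE negE.
rewrite (ge0_integral_past (g := (EFin \o g')^\+) tE)//; last exact: measurable_funepos.
rewrite (ge0_integral_past (g := (EFin \o g')^\-) tE)//; last exact: measurable_funeneg.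
have fp : \int[mu]_x (EFin \o g')^\+ x \is a fin_num.
  by apply: integrable_fin_num => //; exact: integrable_funepos.
have fn : \int[mu]_x (EFin \o g')^\- x \is a fin_num.
  by apply: integrable_fin_num => //; exact: integrable_funeneg.
have PEf : P E \is a fin_num by exact: fin_num_measure.
rewrite -muleBr ?fin_num_adde_defl//; last by rewrite fin_numN.
by rewrite -integralE int0 mule0.
Qed.

(** The integrals of positive and negative parts are suprema over simple functions below them, so
    the comparison covers the excess risk at a random point, which may fail to be measurable. *)
Lemma integral_mono (X : Omega -> R) (Z : Omega -> R) :
  (forall om, (X om <= Z om)%R) ->
  \int[P]_om (X om)%:E <= \int[P]_om (Z om)%:E.
Proof.
move=> XZ; rewrite integralE [leRHS]integralE.
have h : {in [set: Omega], forall om, (X om)%:E <= (Z om)%:E} by move=> x _; rewrite lee_fin.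
apply: leeB.
  rewrite !ge0_integralTE; [|by move=> ?..].
  apply: ereal_sup_le => _ [g gX <-]; exists g => // om.
  apply: (le_trans (gX om)); exact: (funepos_le h (in_setT om)).
rewrite !ge0_integralTE; [|by move=> ?..].
apply: ereal_sup_le => _ [g gX <-]; exists g => // om.
apply: (le_trans (gX om)); exact: (funeneg_le h (in_setT om)).
Qed.

End Independence.

Section Averages.
Context {R : realType} {n : nat}.
Local Notation V := 'cV[R]_n.+1.

Lemma average_convex (K : set V) (f : V -> R) (k : nat) (u : nat -> V) :
  convex_set K -> convex_fun_on K f -> (forall t, (t < k.+1)%N -> K (u t)) ->
  K (average k.+1 u) /\ f (average k.+1 u) <= k.+1%:R^-1 * \sum_(t < k.+1) f (u t).
Proof.
move=> cK cf; elim: k => [|k IH] hu.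
  rewrite /average !big_ord1 invr1 scale1r mul1r; split=> //; exact: hu.
have [Ka fa] := IH (fun t tk => hu t (leqW tk)).
have k0 : (k.+1%:R : R) != 0 by rewrite pnatr_eq0.
have k1 : (k.+2%:R : R) != 0 by rewrite pnatr_eq0.
have E : (k.+2%:R : R) = k.+1%:R + 1 by rewrite mulrSr.
have aE : average k.+2 u = average k.+1 u + k.+2%:R^-1 *: (u k.+1 - average k.+1 u).
  rewrite {1}/average big_ord_recr/=.
  have -> : \sum_(i < k.+1) u i = k.+1%:R *: average k.+1 u.
    by rewrite /average scalerA divff// scale1r.
  move: (average k.+1 u) (u k.+1) => a b; apply/colP => j; rewrite !mxE.
  rewrite E; have : (0 : R) < k.+1%:R by rewrite ltr0n.
  by move: (k.+1%:R : R) => q q0; field; rewrite gt_eqF// addr_gt0.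
have s0 : 0 <= (k.+2%:R : R)^-1 by rewrite invr_ge0.
have s1 : (k.+2%:R : R)^-1 <= 1 by rewrite invf_le1// ler1n.
have Ku : K (u k.+1) by exact: hu.
split; first by rewrite aE; exact: convex_set_seg.
rewrite aE; apply: (le_trans (cf _ _ _ Ka Ku s0 s1)).
have -> : \sum_(t < k.+2) f (u t) = \sum_(t < k.+1) f (u t) + f (u k.+1).
  by rewrite big_ord_recr.
move: fa; set S := \sum_(t < k.+1) f (u t) => fa.
have : (1 - k.+2%:R^-1) * f (average k.+1 u) <= (1 - k.+2%:R^-1) * (k.+1%:R^-1 * S).
  by rewrite ler_wpM2l// subr_ge0.
have -> : (1 - k.+2%:R^-1) * (k.+1%:R^-1 * S) = k.+2%:R^-1 * S :> R.
  rewrite E; have : (0 : R) < k.+1%:R by rewrite ltr0n.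
  by move: (k.+1%:R : R) => q q0; field; rewrite !gt_eqF// addr_gt0.
rewrite mulrDr; move: (f (average _ _)) (f (u _)) (k.+2%:R^-1) => x y c; lra.
Qed.

End Averages.

Section Risk.
Context {R : realType} {n : nat} (dX : measure_display) (Xi : measurableType dX).
Local Notation V := 'cV[R]_n.+1.
Variables (mu : probability Xi R).

Lemma integrable_lin (N : nat) (a : 'I_N -> R) (h : 'I_N -> Xi -> R) :
  (forall i, mu.-integrable setT (EFin \o h i)) ->
  mu.-integrable setT (EFin \o (fun x => \sum_(i < N) a i * h i x)) /\
  \int[mu]_x (\sum_(i < N) a i * h i x) = \sum_(i < N) a i * \int[mu]_x h i x.
Proof.
elim: N a h => [|N IH] a h ih.
  split.
    by apply: eq_integrable (integrable0 _ _) => // x _; rewrite /= big_ord0.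
  by under eq_Rintegral do rewrite big_ord0; rewrite big_ord0 /Rintegral integral0.
have [i1 i2] := IH (a \o widen_ord (leqnSn N)) (h \o widen_ord (leqnSn N)) (fun i => ih _).
have i3 : mu.-integrable setT (EFin \o (fun x => a ord_max * h ord_max x)).
  have := integrableZl measurableT (a ord_max) (ih ord_max).
  by apply: eq_integrable.
split.
  apply: eq_integrable (integrableD measurableT i1 i3) => // x _.
  by rewrite /= big_ord_recr EFinD.
under eq_Rintegral do rewrite big_ord_recr/=.
rewrite RintegralD//= i2 big_ord_recr/=; congr (_ + _).
by rewrite RintegralZl.
Qed.

Lemma risk_mono (N : nat) (a : 'I_N -> R) (h : 'I_N -> Xi -> R) (g : Xi -> R) (r : R) :
  mu.-integrable setT (EFin \o g) ->
  (forall i, mu.-integrable setT (EFin \o h i)) ->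
  (forall x, g x <= \sum_(i < N) a i * h i x + r) ->
  \int[mu]_x g x <= \sum_(i < N) a i * \int[mu]_x h i x + r.
Proof.
move=> ig ih gh; have [i1 i2] := integrable_lin a ih.
have ir : mu.-integrable setT (EFin \o (cst r : Xi -> R)).
  exact: finite_measure_integrable_cst.
have -> : \sum_(i < N) a i * \int[mu]_x h i x + r
    = \int[mu]_x (\sum_(i < N) a i * h i x + r).
  rewrite RintegralD//= i2; congr (_ + _).
  rewrite Rintegral_cst//.
  by rewrite [X in fine X]probability_setT mulr1.
apply: le_Rintegral => //.
by apply: eq_integrable (integrableD measurableT i1 ir).
Qed.

End Risk.

Section OnlineToBatch.
Context {R : realType} {n : nat} (dX dO : measure_display)
  (Xi : measurableType dX) (Omega : measurableType dO).
Local Notation V := 'cV[R]_n.+1.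
Local Notation d := (n.+1%:R : R).
Variables (P : probability Omega R) (mu : probability Xi R).
Variable xi : nat -> Omega -> Xi.
Hypothesis xi_iid : iid P mu xi.

Lemma enorm_coord (x : V) i : `|x i ord0| <= enorm x.
Proof.
rewrite -ler_sqr ?nnegrE ?normr_ge0 ?enorm_ge0// sqr_enorm real_normK ?num_real//.
rewrite /dot (bigD1 i)//= -expr2 lerDl; apply: sumr_ge0 => j _.
by rewrite -expr2 sqr_ge0.
Qed.

Lemma enorm_le_coord (x : V) (h : R) : (forall i, `|x i ord0| <= h) -> enorm x <= d * h.
Proof.
move=> hx; have h0 : 0 <= h by apply: le_trans (hx ord0).
rewrite enorm_le ?mulr_ge0// exprMn.
apply: (@le_trans _ _ (\sum_(i < n.+1) h ^+ 2)).
  apply: ler_sum => i _; rewrite -expr2 -[_ ^+ 2]real_normK ?num_real//.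
  by rewrite ler_sqr ?nnegrE.
rewrite sumr_const card_ord -[h ^+ 2 *+ _]mulr_natl ler_wpM2r ?sqr_ge0//.
by rewrite expr2 ler_peMr// ler1n.
Qed.

Section Cells.
Variables (h : R) (h0 : 0 < h) (m : nat) (hm : 2 / h < m.+1%:R).
Implicit Types (j : {ffun 'I_n.+1 -> 'I_m.+1}) (x y : V).

(** Half-open cubes, so that distinct cells are disjoint; the shift by 1 makes the indices natural
    numbers on the unit ball. *)
Definition cell j : set V :=
  [set x | forall i, (j i)%:R * h <= x i ord0 + 1 < (j i).+1%:R * h].

Lemma cell_exists x : enorm x <= 1 -> exists j, cell j x.
Proof.
move=> x1.
have hx i : 0 <= (x i ord0 + 1) / h < m.+1%:R.
  have := le_trans (enorm_coord x i) x1; rewrite ler_norml => /andP[h1 h2].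
  apply/andP; split; first by rewrite divr_ge0 ?(ltW h0)//; lra.
  by apply: le_lt_trans hm; rewrite ler_pM2r ?invr_gt0//; lra.
exists [ffun i => inord (Num.truncn ((x i ord0 + 1) / h))] => i.
have /andP[y0 ym] := hx i.
rewrite ffunE inordK; last by rewrite truncn_lt_nat.
by have := truncn_itv y0; rewrite ler_pdivlMr// ltr_pdivrMr.
Qed.

Lemma cell_inj j j' x : cell j x -> cell j' x -> j = j'.
Proof.
move=> jx jx'; apply/ffunP => i; apply/val_inj.
have /andP[a1 a2] := jx i; have /andP[b1 b2] := jx' i.
have := le_lt_trans a1 b2; have := le_lt_trans b1 a2.
rewrite !ltr_pM2r// !ltr_nat !ltnS => c1 c2; apply/eqP.
by rewrite eqn_leq c1 c2.
Qed.

Lemma cell_diam j x y : cell j x -> cell j y -> enorm (x - y) <= d * h.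
Proof.
move=> jx jy; apply: enorm_le_coord => i.
have /andP[a1 a2] := jx i; have /andP[b1 b2] := jy i.
rewrite !mxE ler_norml; move: a2 b2; rewrite -!natr1 !mulrDl mul1r => a2 b2.
by apply/andP; split; lra.
Qed.

Lemma cell_past t (u : Omega -> V) j : depends_on_first xi t u ->
  past xi t (u @^-1` cell j).
Proof.
move=> hu.
have -> : u @^-1` cell j = \bigcap_(i in [set: 'I_n.+1])
    (fun om => u om i ord0) @^-1` `[(j i)%:R * h - 1, (j i).+1%:R * h - 1[%classic.
  apply/seteqP; split => om /= H i; first by move=> _; rewrite /= in_itv/= lerBlDr ltrBrDr; exact: H.
  by have := H i I; rewrite /= in_itv/= lerBlDr ltrBrDr.
apply: (@fin_bigcap_measurable _ (g_sigma_algebraType _)); first exact: finite_finset.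
move=> i _; apply: hu; exact: measurable_itv.
Qed.

End Cells.

Variables (alpha : R) (f : V -> Xi -> R) (C dom : set V) (T : nat).
Hypotheses (alpha_gt0 : 0 < alpha) (cdom : convex_set dom)
  (floss : loss_family mu alpha dom f) (Cdom : C `<=` dom) (C0 : C !=set0)
  (CB : C `<=` eball 1) (T_gt0 : (0 < T)%N).
Variables (u0 : V) (iu0 : interior_point dom u0).

Let f_convex x : convex_fun_on dom (f^~ x).
Proof. by case: floss => [fc _ _]; exact: exp_concave_convex (fc x). Qed.

Let f_lip x u v : interior_point dom u -> dom v ->
  f u x <= f v x + enorm (v - u).
Proof.
move=> iu dv; case: floss => [_ fb _].
have := lipschitz_interior cdom (@f_convex x) iu dv (fun w z => fb x w z); lra.
Qed.

Let f_int u : dom u -> mu.-integrable setT (EFin \o f u).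
Proof. by case: floss => [_ _ fi]; exact: fi. Qed.

Lemma interior_mem (K : set V) u : interior_point K u -> K u.
Proof. by case=> r r0; apply; rewrite subrr enorm0 ltW. Qed.

Lemma risk_lip u v : interior_point dom u -> dom v ->
  risk mu f u <= risk mu f v + enorm (v - u).
Proof.
move=> iu dv; have du := interior_mem iu.
have := @risk_mono _ _ _ mu 1 (fun=> 1) (fun=> f v) (f u) (enorm (v - u)) (f_int du)
  (fun=> f_int dv).
rewrite !big_ord1 mul1r; apply => x; rewrite big_ord1 mul1r; exact: f_lip.
Qed.

Lemma excess_risk_le u v0 : C v0 -> interior_point dom u ->
  excess_risk mu f C u <= enorm u + 1.
Proof.
move=> Cv0 iu; rewrite /excess_risk lerBlDr.
suff : risk mu f u - (enorm u + 1) <= inf [set risk mu f v | v in C] by lra.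
apply: lb_le_inf; first by exists (risk mu f v0), v0.
move=> _ [v Cv <-]; have := risk_lip iu (Cdom Cv).
have := enormB v u; have := CB Cv; rewrite /eball/=; lra.
Qed.

Variables (u : nat -> Omega -> V) (Reg : R).
Hypotheses (u_past : forall t, (t < T)%N -> depends_on_first xi t (u t))
  (u_int : forall t om, (t < T)%N -> interior_point dom (u t om))
  (u_ball : forall t om, (t < T)%N -> enorm (u t om) <= 1)
  (u_reg : forall om v, C v ->
     \sum_(t < T) (f (u t om) (xi t om) - f v (xi t om)) <= Reg).

Section Discretisation.
Variables (delta : R) (delta_gt0 : 0 < delta) (v : V) (Cv : C v).
Let h := delta / d.
Let h0 : 0 < h. Proof. by rewrite divr_gt0// ltr0n. Qed.
Let m := Num.truncn (2 / h).
Let hm : 2 / h < m.+1%:R. Proof. exact: truncnS_gt. Qed.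
Local Notation J := {ffun 'I_n.+1 -> 'I_m.+1}.

Let E t (j : J) := u t @^-1` cell h j.

(* A value of [u t] in the cell [j], when there is one. *)
Let rep t (j : J) : V :=
  if pselect (exists om, E t j om) is left e then u t (projT1 (cid e)) else v.

Let rep_dom t j : (t < T)%N -> dom (rep t j).
Proof.
move=> tT; rewrite /rep; case: pselect => [e|_]; last exact: Cdom.
by apply: interior_mem; exact: u_int.
Qed.

Let rep_close t j om : (t < T)%N -> E t j om ->
  interior_point dom (rep t j) /\ enorm (rep t j - u t om) <= delta.
Proof.
move=> tT Ej; rewrite /rep; case: pselect => [e|[]]; last by exists om.
split; first exact: u_int.
have := projT2 (cid e); move: (projT1 _) => om' Ej'.
by have := cell_diam Ej' Ej; rewrite /h mulrCA divff ?mulr1.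
Qed.

(* Centred fluctuations: [inl _] for the comparator, [inr j] for the cell [j]. *)
Let fluct (k : 'I_T * ('I_1 + J)) (om : Omega) : R :=
  if k.2 is inr j then
    (if om \in E k.1 j then f (rep k.1 j) (xi k.1 om) - risk mu f (rep k.1 j) else 0)
  else f v (xi k.1 om) - risk mu f v.

Let coef (k : 'I_T * ('I_1 + J)) : R := if k.2 is inr _ then - T%:R^-1 else T%:R^-1.

Let fluctP k : P.-integrable setT (EFin \o fluct k) /\ (\int[P]_om (fluct k om)%:E)%E = 0%E.
Proof.
case: k => t [i|j]; rewrite /fluct/=.
  have [i1 i2] := centered_past xi_iid (@past_setT _ _ _ _ xi t) (f_int (Cdom Cv)).
  by rewrite patch_setT in i1 i2.
have [i1 i2] := centered_past xi_iid (@cell_past h m t (u t) j (u_past (ltn_ord t)))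
  (f_int (rep_dom j (ltn_ord t))).
have EQ : (fun om => (if om \in E t j then f (rep t j) (xi t om) - risk mu f (rep t j) else 0)%:E)
   = (fun om => (f (rep t j) (xi t om) - fine (\int[mu]_x (f (rep t j) x)%:E))%:E) \_ (E t j).
  by apply/funext => om; rewrite /patch; case: ifP.
by rewrite -EQ in i1 i2; split; [exact: i1|exact: i2].
Qed.

Let c0 := inf [set risk mu f v | v in C].

(** An integrable majorant of the excess risk whose expectation is explicit. One [delta] moves u_t
    to the cell representative in the risk, the other moves back in the loss. *)
Let bound om : R := risk mu f v - c0 + Reg / T%:R + 2 * delta + \sum_k coef k * fluct k om.

Let int_bound : (\int[P]_om (bound om)%:E)%E = (risk mu f v - c0 + Reg / T%:R + 2 * delta)%:E.
Proof.
rewrite /bound; set c := _ - c0 + _ + _.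
under eq_integral do rewrite EFinD -sumEFin.
have ik k : P.-integrable setT (fun om => (coef k * fluct k om)%:E).
  by apply: eq_integrable (integrableZl measurableT (coef k) (fluctP k).1).
rewrite integralD//=; last 2 first.
- exact: finite_measure_integrable_cst.
- exact: integrable_sum.
rewrite integral_cst// [X in (c%:E * X)%E]probability_setT mule1.
rewrite integral_sum// big1 ?adde0// => k _.
under eq_integral do rewrite EFinM.
by rewrite integralZl ?(fluctP k).2 ?mule0//; exact: (fluctP k).1.
Qed.

Let pathwise om : excess_risk mu f C (average T (u^~ om)) <= bound om.
Proof.
rewrite /excess_risk /bound -/c0 lerBlDr.
have TE : T = T.-1.+1 by rewrite prednK.
have dt t : (t < T)%N -> dom (u t om) by move=> tT; apply: interior_mem; exact: u_int.
have avg_dom : dom (average T (u^~ om)).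
  rewrite TE; apply: (average_convex cdom (f_convex (xi 0 om)) _).1.
  by rewrite -TE.
have h1 : risk mu f (average T (u^~ om)) <= \sum_(t < T) T%:R^-1 * risk mu f (u t om).
  rewrite -[leRHS]addr0; apply: risk_mono => [|t|x]; rewrite ?addr0; [exact: f_int|exact/f_int/dt|].
  rewrite -mulr_sumr TE; apply: (average_convex cdom (f_convex x) _).2.
  by rewrite -TE.
(* Exactly one cell contains u_t, so a single fluctuation survives in the sum over [j]. *)
have h2 (t : 'I_T) : risk mu f (u t om)
    <= 2 * delta + f (u t om) (xi t om) - \sum_j fluct (t, inr j) om.
  have [j ju] := cell_exists h0 hm (u_ball om (ltn_ord t)).
  have [ir close] := rep_close (ltn_ord t) ju.
  rewrite (bigD1 j)//= big1 ?addr0 => [|j' j'j]; last first.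
    rewrite /fluct/=; case: ifPn => // /set_mem ju'.
    by case/eqP: j'j; exact: cell_inj ju' ju.
  rewrite /fluct/= mem_set//.
  have l1 := risk_lip (u_int om (ltn_ord t)) (interior_mem ir).
  have l2 := f_lip (xi t om) ir (dt t (ltn_ord t)).
  have l3 : enorm (u t om - rep t j) <= delta by rewrite -opprB enormN.
  lra.
have h3 : \sum_(t < T) T%:R^-1 * risk mu f (u t om)
    <= \sum_(t < T) T%:R^-1 * (2 * delta + f (u t om) (xi t om) - \sum_j fluct (t, inr j) om).
  by apply: ler_sum => t _; rewrite ler_wpM2l ?invr_ge0.
apply: (le_trans h1); apply: (le_trans h3).
have T0 : (0 : R) < T%:R by rewrite ltr0n.
have -> : \sum_k coef k * fluct k om
   = T%:R^-1 * (\sum_(t < T) (f v (xi t om) - risk mu f v))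
     - T%:R^-1 * \sum_(t < T) \sum_j fluct (t, inr j) om.
  rewrite (eq_bigr (fun k => coef (k.1, k.2) * fluct (k.1, k.2) om)); last by case.
  rewrite -(pair_bigA _ (fun t o => coef (t, o) * fluct (t, o) om))/=.
  rewrite !mulr_sumr -sumrB; apply: eq_bigr => t _.
  rewrite big_sumType big_ord1/= /coef/= /fluct/= mulr_sumr -sumrN.
  by congr (_ + _); apply: eq_bigr => j _; rewrite mulNr.
set F := T%:R^-1 * _ - _ * _; have -> : risk mu f v - c0 + Reg / T%:R + 2 * delta + F + c0
  = risk mu f v + Reg / T%:R + 2 * delta + F by ring.
rewrite /F -mulr_sumr -ler_pdivlMl ?invr_gt0// invrK.
rewrite !mulrDr [T%:R * (_ / _)]mulrCA divff ?gt_eqF// mulr1 mulrN !mulrA divff ?gt_eqF// !mul1r.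
have := u_reg om Cv; rewrite !sumrB !sumr_const !card_ord big_split/=.
rewrite sumr_const card_ord -[risk mu f v *+ T]mulr_natl -[(2 * delta) *+ T]mulr_natl.
lra.
Qed.

Lemma discretised_bound : ('E_P[fun om => excess_risk mu f C (average T (u^~ om))]
  <= (risk mu f v - c0 + Reg / T%:R + 2 * delta)%:E)%E.
Proof. by rewrite unlock -int_bound; apply: integral_mono; exact: pathwise. Qed.

End Discretisation.

(** A comparator within [ep / 3] of the infimum, and [delta = ep / 3] counted twice. *)
Lemma online_to_batch (ep : R) : 0 < ep ->
  ('E_P[fun om => excess_risk mu f C (average T (u^~ om))] <= (Reg / T%:R + ep)%:E)%E.
Proof.
move=> ep0; have d0 : 0 < ep / 3 by rewrite divr_gt0.
have hinf : has_inf [set risk mu f v | v in C].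
  have [v0 Cv0] := C0; split; first by exists (risk mu f v0), v0.
  exists (risk mu f u0 - (enorm u0 + 1)) => _ [v Cv <-].
  have := risk_lip iu0 (Cdom Cv); have := enormB v u0; have := CB Cv.
  rewrite /eball/=; lra.
have [_ [v Cv <-] hv] := inf_adherent d0 hinf.
apply: (le_trans (discretised_bound d0 Cv)); rewrite lee_fin.
move: hv; move: (inf _) => c; lra.
Qed.


End OnlineToBatch.

(** * Measurability of the iterates *)

Section MeasurableMatrices.
Context {R : realType} (dW : measure_display) (W : measurableType dW).

Definition mx_measurable m p (A : W -> 'M[R]_(m, p)) :=
  forall i j, measurable_fun setT (fun om => A om i j).

(** Reduced to the measurable real power by $h^{-1}=h\,(h^2)^{-1}$, which also covers [h = 0], where
    the inverse is 0. *)
Lemma measurable_inv (h : W -> R) : measurable_fun setT h ->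
  measurable_fun setT (fun om => (h om)^-1).
Proof.
move=> mh.
have -> : (fun om => (h om)^-1) = (fun om => h om * (h om ^+ 2) `^ (- 1)).
  apply/funext => om; have [->|h0] := eqVneq (h om) 0; first by rewrite invr0 mul0r.
  by rewrite powR_inv1 ?sqr_ge0//; field.
apply: measurable_funM => //.
apply: (measurableT_comp (f := @powR R ^~ (- 1))); first exact: measurable_powR.
exact: measurable_funX.
Qed.

Lemma measurable_bigsum (I : Type) (r : seq I) (P : pred I) (h : I -> W -> R) :
  (forall i, measurable_fun setT (h i)) ->
  measurable_fun setT (fun om => \sum_(i <- r | P i) h i om).
Proof.
move=> mh; elim: r => [|i r IH].
  by under eq_fun do rewrite big_nil; exact: measurable_cst.
under eq_fun do rewrite big_cons.
by case: (P i) => //; exact: measurable_funD.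
Qed.

Lemma measurable_bigprod (I : Type) (r : seq I) (h : I -> W -> R) :
  (forall i, measurable_fun setT (h i)) ->
  measurable_fun setT (fun om => \prod_(i <- r) h i om).
Proof.
move=> mh; elim: r => [|i r IH].
  by under eq_fun do rewrite big_nil; exact: measurable_cst.
by under eq_fun do rewrite big_cons; exact: measurable_funM.
Qed.

Section Operations.
Variables (m p q : nat).
Implicit Types (A B : W -> 'M[R]_(m, p)) (a : W -> R).

Lemma mx_measurable_cst (A : 'M[R]_(m, p)) : mx_measurable (fun=> A).
Proof. by move=> i j; exact: measurable_cst. Qed.

Lemma mx_measurableD A B : mx_measurable A -> mx_measurable B ->
  mx_measurable (fun om => A om + B om).
Proof. by move=> mA mB i j; under eq_fun do rewrite mxE; exact: measurable_funD. Qed.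

Lemma mx_measurableZ a A : measurable_fun setT a -> mx_measurable A ->
  mx_measurable (fun om => a om *: A om).
Proof. by move=> ma mA i j; under eq_fun do rewrite mxE; exact: measurable_funM. Qed.

Lemma mx_measurableB A B : mx_measurable A -> mx_measurable B ->
  mx_measurable (fun om => A om - B om).
Proof. by move=> mA mB i j; under eq_fun do rewrite !mxE; exact: measurable_funB. Qed.

Lemma mx_measurable_sum (I : Type) (r : seq I) (P : pred I) (A : I -> W -> 'M[R]_(m, p)) :
  (forall i, mx_measurable (A i)) ->
  mx_measurable (fun om => \sum_(i <- r | P i) A i om).
Proof.
move=> mA i j; under eq_fun do rewrite summxE.
by apply: measurable_bigsum => k; exact: mA.
Qed.

Lemma mx_measurable_tr A : mx_measurable A -> mx_measurable (fun om => (A om)^T).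
Proof. by move=> mA i j; under eq_fun do rewrite mxE; exact: mA. Qed.

Lemma mx_measurableM A (B : W -> 'M[R]_(p, q)) : mx_measurable A -> mx_measurable B ->
  mx_measurable (fun om => A om *m B om).
Proof.
move=> mA mB i j; under eq_fun do rewrite mxE.
by apply: measurable_bigsum => k; apply: measurable_funM; [exact: mA|exact: mB].
Qed.

Lemma mx_measurable_if (b : W -> bool) A B : measurable_fun setT b ->
  mx_measurable A -> mx_measurable B ->
  mx_measurable (fun om => if b om then A om else B om).
Proof.
move=> mb mA mB i j.
have -> : (fun om => (if b om then A om else B om) i j)
  = (fun om => if b om then A om i j else B om i j) by apply/funext => om; case: (b om).
exact: measurable_fun_ifT.
Qed.

End Operations.

Lemma measurable_det m (A : W -> 'M[R]_m) : mx_measurable A ->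
  measurable_fun setT (fun om => \det (A om)).
Proof.
move=> mA; rewrite /determinant; apply: measurable_bigsum => s.
apply: measurable_funM; first exact: measurable_cst.
by apply: measurable_bigprod => i; exact: mA.
Qed.

Lemma mx_measurable_scalar m (a : W -> R) : measurable_fun setT a ->
  mx_measurable (fun om => (a om)%:M : 'M[R]_m).
Proof.
move=> ma i j; under eq_fun do rewrite mxE.
by case: (i == j) => //=; exact: measurable_cst.
Qed.

(** [invmx] returns a singular matrix unchanged, so it is a case distinction between [A] and
    Cramer's formula. *)
Lemma mx_measurable_invmx m (A : W -> 'M[R]_m) : mx_measurable A ->
  mx_measurable (fun om => invmx (A om)).
Proof.
move=> mA.
have -> : (fun om => invmx (A om))
  = (fun om => if \det (A om) == 0 then A om else (\det (A om))^-1 *: \adj (A om)).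
  apply/funext => om; rewrite /invmx unitmxE unitfE.
  by case: eqP.
apply: mx_measurable_if => //.
  by apply: measurable_fun_eqr; [exact: measurable_det|exact: measurable_cst].
apply: mx_measurableZ; first by apply: measurable_inv; exact: measurable_det.
move=> i j; under eq_fun do rewrite mxE /cofactor.
apply: measurable_funM; first exact: measurable_cst.
apply: measurable_det => k l; under eq_fun do rewrite !mxE; exact: mA.
Qed.

Lemma mx_measurableX m (A : W -> 'M[R]_m.+1) k : mx_measurable A ->
  mx_measurable (fun om => A om ^+ k).
Proof.
move=> mA; elim: k => [|k IH]; first exact: mx_measurable_cst.
by under eq_fun do rewrite exprS; exact: mx_measurableM.
Qed.

Section Vectors.
Variable n : nat.
Local Notation V := 'cV[R]_n.+1.
Local Notation d := (n.+1%:R : R).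
Implicit Types (x y : W -> V).

Lemma measurable_dot x y : mx_measurable x -> mx_measurable y ->
  measurable_fun setT (fun om => dot (x om) (y om)).
Proof.
move=> mx my; apply: measurable_bigsum => i.
by apply: measurable_funM; [exact: mx|exact: my].
Qed.

Lemma mx_measurable_played x y : mx_measurable x -> mx_measurable y ->
  mx_measurable (fun om => played (x om) (y om)).
Proof.
move=> mx my; have md := measurable_dot my mx.
apply: mx_measurable_if => //; first exact: measurable_fun_ler.
by apply: mx_measurableZ => //; exact: measurable_inv.
Qed.

Lemma mx_measurable_surrogate x y (z : W -> V) :
  mx_measurable x -> mx_measurable y -> mx_measurable z ->
  mx_measurable (fun om => surrogate (x om) (y om) (z om)).
Proof.
move=> mx my mz; apply: mx_measurableB => //; apply: mx_measurableZ => //.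
apply: measurable_fun_ifT; last exact: measurable_cst.
  by apply: measurable_fun_ltr; [exact: measurable_dot|exact: measurable_cst].
by apply: measurable_dot => //; exact: mx_measurable_played.
Qed.

Section Run.
Variables (B eta beta c : R) (T : nat) (w nu zeta : nat -> W -> V) (k : nat).
Let g t om := surrogate (w t om) (nu t om) (zeta t om).
Hypotheses (kT : (k <= T)%N)
  (w0 : forall om, w 0%N om = 0)
  (wS : forall t om, (t < T)%N -> w t.+1 om = w t om -
     \sum_(1 <= j < (oqns_terms (n := n) B eta beta c T).+2)
       oqns_theta eta c (w^~ om) t ^+ j.-1
        *: (oqns_H B eta beta c (w^~ om) (g^~ om) t ^+ j
            *m pgrad B eta beta (w^~ om) (g^~ om) t.+1 (w t om)))
  (mnu : forall t, (t < k)%N -> mx_measurable (nu t))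
  (mzeta : forall t, (t < k)%N -> mx_measurable (zeta t)).

(** [W] is arbitrary because it will be Omega with the sigma-algebra of the first observations. With
    [pgrad] in place of the derivative, only arithmetic, tests and matrix inverses occur. *)
Lemma mx_measurable_run t : (t <= k)%N ->
  mx_measurable (w t) /\ mx_measurable (fun om => landmark c (w^~ om) t).
Proof.
elim/ltn_ind: t => -[|t] IH tk.
  split; last exact: mx_measurable_cst.
  have -> : w 0%N = fun=> 0 by apply/funext.
  exact: mx_measurable_cst.
have mw s : (s <= t)%N -> mx_measurable (w s).
  by move=> st; apply: (IH s _ _).1; [rewrite ltnS|exact: leq_trans st (ltnW tk)].
have mg s : (s < t.+1)%N -> mx_measurable (g s).
  rewrite ltnS => st; have sk : (s < k)%N by exact: leq_ltn_trans st tk.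
  by apply: mx_measurable_surrogate; [exact: mw|exact: mnu|exact: mzeta].
have ml : mx_measurable (fun om => landmark c (w^~ om) t).
  exact: (IH t (ltnSn t) (ltnW tk)).2.
have cm (a : R) : measurable_fun setT (fun _ : W => a) by exact: measurable_cst.
have mdist (x : W -> V) : mx_measurable x ->
    measurable_fun setT (fun om => (1 - enorm (x om) ^+ 2)^-1).
  move=> mx; apply: measurable_inv; under eq_fun do rewrite sqr_enorm.
  by apply: measurable_funB => //; exact: measurable_dot.
have mth : measurable_fun setT (fun om => oqns_theta eta c (w^~ om) t).
  by apply: measurable_funB; apply: measurable_funM => //; apply: mdist; [|exact: mw].
have msum (F : 'I_t.+1 -> W -> R) : (forall s, measurable_fun setT (F s)) ->
    mx_measurable (fun om => \sum_(s < t.+1) F s om *: g s om).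
  by move=> mF; apply: mx_measurable_sum => s; apply: mx_measurableZ => //; exact: mg.
have mH : mx_measurable (fun om => oqns_H B eta beta c (w^~ om) (g^~ om) t).
  apply: mx_measurable_invmx; apply: mx_measurableD.
    do 2 apply: mx_measurable_invmx; apply: mx_measurableD.
      apply: mx_measurableD; apply: mx_measurable_scalar => //.
      by apply: measurable_funM => //; exact: mdist.
    apply: mx_measurableZ => //; apply: mx_measurable_sum => s.
    by apply: mx_measurableM; [|apply: mx_measurable_tr]; exact: mg.
  apply: mx_measurableZ.
    apply: measurable_funM => //.
    have -> : (fun om => ((1 - enorm (w t om) ^+ 2) ^+ 2)^-1)
      = (fun om => (1 - enorm (w t om) ^+ 2)^-1 ^+ 2) by apply/funext => om; rewrite exprVn.
    by apply: measurable_funX; apply: mdist; exact: mw.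
  by apply: mx_measurableM; [|apply: mx_measurable_tr]; exact: mw.
have mG : mx_measurable (fun om => pgrad B eta beta (w^~ om) (g^~ om) t.+1 (w t om)).
  apply: mx_measurableD.
    apply: mx_measurableD.
      apply: mx_measurableD; apply: mx_measurableZ => //; try exact: mw.
      apply: measurable_funM => //; apply: measurable_inv.
      by apply: measurable_funB => //; apply: measurable_dot; exact: mw.
    apply: mx_measurableZ => //; apply: msum => s; apply: measurable_dot; first exact: mg.
    by apply: mx_measurableB; [exact: mw|apply: mw; rewrite -ltnS].
  by apply: mx_measurable_sum => s; exact: mg.
have mw1 : mx_measurable (w t.+1).
  have -> : w t.+1 = fun om => w t om -
     \sum_(1 <= j < (oqns_terms (n := n) B eta beta c T).+2)
       oqns_theta eta c (w^~ om) t ^+ j.-1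
        *: (oqns_H B eta beta c (w^~ om) (g^~ om) t ^+ j
            *m pgrad B eta beta (w^~ om) (g^~ om) t.+1 (w t om)).
    by apply/funext => om; rewrite wS//; exact: leq_trans kT.
  apply: mx_measurableB; first exact: mw.
  apply: mx_measurable_sum => j; apply: mx_measurableZ; first exact: measurable_funX.
  by apply: mx_measurableM => //; exact: mx_measurableX.
split=> //=; apply: mx_measurable_if => //.
rewrite /keep_landmark; under eq_fun do rewrite !sqr_enorm.
apply: measurable_fun_ler.
  apply: (@measurableT_comp _ _ _ _ _ _ (@Num.norm R R)); first exact: normr_measurable.
  by apply: measurable_funB; exact: measurable_dot.
by apply: measurable_funM => //; apply: measurable_funB => //; exact: measurable_dot.
Qed.

End Run.
End Vectors.
End MeasurableMatrices.

Section Depends.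
Context {R : realType} {n : nat} (dX dO : measure_display)
  (Xi : measurableType dX) (Omega : measurableType dO).
Local Notation V := 'cV[R]_n.+1.
Variable xi : nat -> Omega -> Xi.

Lemma depends_on_firstP k (X : Omega -> V) : depends_on_first xi k X <->
  mx_measurable (X : g_sigma_algebraType [set E | exists s (D : set Xi),
         [/\ (s < k)%N, measurable D & E = xi s @^-1` D]] -> V).
Proof.
split=> h i.
  move=> j; rewrite (ord1 j) => _ A mA; rewrite setTI; exact: h.
move=> A mA; have := h i ord0 measurableT A mA; by rewrite setTI.
Qed.

Lemma depends_on_first_le k l (X : Omega -> V) : (k <= l)%N ->
  depends_on_first xi k X -> depends_on_first xi l X.
Proof.
move=> kl h i A mA; apply: smallest_sub (h i A mA); first exact: smallest_sigma_algebra.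
move=> _ [s [D [sk mD ->]]]; apply: sub_sigma_algebra.
by exists s, D; split=> //; exact: leq_trans kl.
Qed.

End Depends.

(** * Regret of the reduction *)

Section ReductionRegret.
Context {R : realType} {n : nat}.
Local Notation V := 'cV[R]_n.+1.
Local Notation d := (n.+1%:R : R).
Variables (B eta beta ep b0 : R) (T : nat) (C dom : set V) (loss : nat -> V -> R).
Let e := eta * d.
Let reg := d + eta * B ^+ 2.

(* A run of the reduction in which every [nu t] is an exact or approximate
   subgradient, [b0] bounding its norm. *)
Definition good_run (N : nat) (w nu zeta : nat -> V) :=
  oqns_upto B eta beta (1 / 4) T N w (fun t => surrogate (w t) (nu t) (zeta t)) /\
  forall t, (t < N)%N ->
    [/\ subdiff (ext dom (loss t)) (played (w t) (nu t)) (zeta t),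
        enorm (zeta t) <= 1 &
        dot (w t) (w t) < 1 -> admissible C ep (w t) (nu t) /\ enorm (nu t) <= b0].

Hypotheses (eta_ge : 11 <= eta) (beta_gt0 : 0 < beta) (beta_le : beta <= 1 / 8)
  (B_ge0 : 0 <= B) (T_gt0 : (0 < T)%N) (ep01 : 0 <= ep <= 1).
Hypothesis b0P : forall s, 0 <= s -> s < 1 ->
  (1 + s * b0) ^+ 2 <= reg /\ 16 * (1 + s * b0) ^+ 2 <= 2 * e / (1 - s ^+ 2) + reg.

Section Run.
Variables (N : nat) (w nu zeta : nat -> V).
Hypothesis run : good_run N w nu zeta.
Let g t := surrogate (w t) (nu t) (zeta t).

Let g_le t : (t < N)%N -> (forall s, (s <= t)%N -> dot (w s) (w s) < 1) ->
  dot (g t) (g t) <= reg /\ 16 * dot (g t) (g t) <= 2 * e / (1 - dot (w t) (w t)) + reg.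
Proof.
move=> tT /(_ t (leqnn _)) w1; have [_ /(_ t tT) [_ z1 /(_ w1) [_ nb]]] := run.
have wn : enorm (w t) < 1 by rewrite enorm_lt// expr1n.
have h := surrogate_norm z1 (ltW wn) nb; have [h1 h2] := b0P (enorm_ge0 (w t)) wn.
have gg : dot (g t) (g t) <= (1 + enorm (w t) * b0) ^+ 2.
  rewrite -sqr_enorm ler_sqr ?nnegrE ?enorm_ge0//; exact: le_trans (enorm_ge0 _) h.
rewrite -[dot (w t) (w t)]sqr_enorm; split; first exact: le_trans h1.
by apply: le_trans h2; rewrite ler_pM2l.
Qed.

Lemma run_in_ball t : (t <= N)%N -> dot (w t) (w t) < 1.
Proof. exact: (guarantee_in_ball eta_ge beta_gt0 B_ge0 T_gt0 run.1 g_le). Qed.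

Lemma run_changes :
  (\sum_(t < N) ~~ keep_landmark (1 / 4) (w t.+1) (landmark (1 / 4) w t))%N%:R / 5
    <= 3 * (d / beta * ln (d * (1 + beta * N%:R))) + N%:R / e.
Proof. exact: (guarantee_changes eta_ge beta_gt0 B_ge0 T_gt0 run.1 g_le). Qed.

Lemma run_regret alpha tau v : 0 < tau -> tau <= 1 -> beta <= alpha / 2 ->
  C `<=` eball 1 -> C `<=` dom -> convex_set dom ->
  (forall t, (t < N)%N -> exp_concave alpha dom (loss t)) -> C v ->
  \sum_(t < N) (loss t (played (w t) (nu t)) - loss t v)
    <= - e * ln tau + reg / 2 + 1 + 6 * (d / beta * ln (d * (1 + beta * N%:R)))
       + N%:R * (2 * (ep + 3 * tau)).
Proof.
move=> tau0 tau1 ba CB Cdom cdom fc Cv.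
have u1 : dot ((1 - tau) *: v) ((1 - tau) *: v) <= 1 - tau.
  have v1 : enorm v <= 1 := CB v Cv.
  rewrite dotZl dotZr mulrA -sqr_enorm -[leRHS]mulr1.
  apply: ler_pM; rewrite ?sqr_ge0//.
    by rewrite ler_piMr ?subr_ge0//; lra.
  by rewrite -(@expr1n _ 2) ler_sqr ?nnegrE ?enorm_ge0.
have u2 : dot ((1 - tau) *: v) ((1 - tau) *: v) < 1 by lra.
have := guarantee_regret eta_ge beta_gt0 B_ge0 T_gt0 run.1 g_le u2.
rewrite -/e -/reg -/g => h.
have e0 : 0 < e by rewrite mulr_gt0 ?ltr0n//; have := eta_ge; lra.
have lnu : - e * ln (1 - dot ((1 - tau) *: v) ((1 - tau) *: v)) <= - e * ln tau.
  by rewrite !mulNr lerN2 ler_pM2l// ler_ln ?posrE//; lra.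
have : \sum_(t < N) (loss t (played (w t) (nu t)) - loss t v)
    <= \sum_(t < N) ((dot (g t) (w t - (1 - tau) *: v)
       - beta / 2 * dot (g t) (w t - (1 - tau) *: v) ^+ 2) + 2 * (ep + 3 * tau)).
  apply: ler_sum => t _; have tT := ltn_ord t.
  have w1 := run_in_ball (ltnW tT).
  have [_ /(_ t tT) [hz z1 /(_ w1) [adm _]]] := run.
  have wn : enorm (w t) <= 1 by rewrite enorm_le// expr1n ltW.
  have b01 : 0 <= beta <= 1 / 8 by rewrite (ltW beta_gt0).
  have t01 : 0 <= tau <= 1 by rewrite (ltW tau0).
  have [a2 ab] := surrogate_regret CB wn adm z1 ep01 t01 b01 Cv.
  have := exp_concave_regret cdom (fc t tT) beta_gt0 beta_le ba hz (Cdom v Cv) a2.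
  rewrite /g; lra.
rewrite [leRHS]big_split/= sumr_const card_ord -[_ *+ N]mulr_natl; lra.
Qed.

End Run.
End ReductionRegret.

Section Interior.
Context {R : realType} {n : nat}.
Local Notation V := 'cV[R]_n.+1.

Lemma interior_convex (K : set V) : convex_set K -> convex_set (interior_point K).
Proof.
move=> cK x y t /set_mem[r r0 hr] /set_mem[r' r0' hr']; apply/mem_set.
have t0 : 0 <= t%:num by [].
have t1 : t%:num <= 1 by [].
rewrite (@conv_seg _ _ t (1 - t%:num)) ?subKr//.
exists (Num.min r r') => [|v hv]; first by rewrite lt_min r0.
set p := x + _ in hv.
have -> : v = (x + (v - p)) + (1 - t%:num) *: ((y + (v - p)) - (x + (v - p))).
  by rewrite /p; apply/colP => i; rewrite !mxE; ring.
apply: convex_set_seg => //; [apply: hr|apply: hr'].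
  by rewrite addrC addKr; apply: le_trans hv _; rewrite ge_min lexx.
by rewrite addrC addKr; apply: le_trans hv _; rewrite ge_min lexx orbT.
Qed.

Lemma eball_convex (r : R) : 0 <= r -> convex_set (eball r : set V).
Proof.
move=> r0 x y t /set_mem hx /set_mem hy; apply/mem_set.
have t0 : 0 <= t%:num by [].
have t1 : t%:num <= 1 by [].
rewrite (@conv_seg _ _ t (1 - t%:num)) ?subKr//.
have -> : x + (1 - t%:num) *: (y - x) = t%:num *: x + (1 - t%:num) *: y.
  by apply/colP => i; rewrite !mxE; ring.
move: hx hy; rewrite /eball/= => hx hy; apply: (le_trans (enormD _ _)).
rewrite !enormZ !ger0_norm ?subr_ge0//.
have : t%:num * enorm x <= t%:num * r by rewrite ler_wpM2l.
have : (1 - t%:num) * enorm y <= (1 - t%:num) * r by rewrite ler_wpM2l// subr_ge0.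
lra.
Qed.

Lemma average_interior (K : set V) (T : nat) (u : nat -> V) (r0 : R) : convex_set K ->
  0 < r0 -> eball r0 `<=` K ->
  (forall t, (t < T)%N -> interior_point K (u t) /\ enorm (u t) <= 1) ->
  interior_point K (average T u) /\ enorm (average T u) <= 1.
Proof.
move=> cK r00 rK; case: T => [|T] hu.
  rewrite /average big_ord0 scaler0 enorm0; split=> //.
  by exists r0 => // v; rewrite subr0 => hv; exact: rK.
have cf0 (K' : set V) : convex_fun_on K' (fun=> 0).
  by move=> *; rewrite !mulr0 addr0.
have hi t : (t < T.+1)%N -> interior_point K (u t) by move/hu => [].
have hb t : (t < T.+1)%N -> eball 1 (u t) by move/hu => [].
split; first exact: (average_convex (interior_convex cK) (@cf0 _) hi).1.
exact: (average_convex (eball_convex ler01) (@cf0 _) hb).1.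
Qed.

End Interior.

(** * The choice of the horizon *)

Section Numeric.
Context {R : realType}.

Lemma nceil_le (x : R) : 0 <= x -> (nceil x)%:R <= x + 1.
Proof.
move=> x0; rewrite /nceil pmulrn abszE ger0_norm ?ceil_ge0//; last lra.
by have := ceilB1_lt x; rewrite intrB; lra.
Qed.

Lemma ln2_ge : 1 / 2 <= ln (2 : R).
Proof.
rewrite -[X in X <= _]expRK ler_ln ?posrE ?expR_gt0//.
apply: (le_trans (expR_le_inv _)); first lra.
have -> : 1 - 1 / 2 = 2^-1 :> R by field.
by rewrite invrK.
Qed.

Variables (n : nat) (eps alpha eta am em : R).
Local Notation d := (n.+1%:R : R).
Hypotheses (eps_gt0 : 0 < eps) (eps_le : eps <= 1 / d) (alpha_gt0 : 0 < alpha)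
  (alpha_le : alpha <= am) (eta_ge : 11 <= eta) (eta_le : eta <= em).
Let beta := Num.min (1 / 8) (alpha / 2).
Let L := ln (d / eps).
Let T := nceil (d * L / (alpha * eps)).

Let d1 : 1 <= d. Proof. by rewrite ler1n. Qed.

Let eps1 : eps <= 1.
Proof. by apply: le_trans eps_le _; rewrite ler_pdivrMr ?ltr0n// mul1r. Qed.

Lemma beta_gt0 : 0 < beta.
Proof. by rewrite lt_min !divr_gt0. Qed.

Lemma beta_le8 : beta <= 1 / 8.
Proof. by rewrite ge_min lexx. Qed.

Lemma beta_le_half : beta <= alpha / 2.
Proof. by rewrite ge_min lexx orbT. Qed.

(** The ratio is the maximum of [8 * alpha] and 2. *)
Lemma beta_inv_le : alpha / beta <= 8 * am + 2.
Proof.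
have b0 := beta_gt0; rewrite ler_pdivrMr//.
rewrite /beta minEle; case: ifPn => _; have := alpha_gt0; have := alpha_le; nra.
Qed.

Lemma ratio_ge1 : 1 <= d / eps.
Proof. by rewrite ler_pdivlMr// mul1r; have := d1; have := eps1; lra. Qed.

Lemma log_ratio_ge0 : 0 <= L.
Proof. by rewrite ln_ge0// ratio_ge1. Qed.

Lemma log_ratio_le : L <= d / eps.
Proof.
have r0 : 0 < d / eps by apply: lt_le_trans ratio_ge1.
have := @le_ln1Dx R (d / eps - 1); rewrite [1 + _]addrC subrK -/L.
have -> : (-1 < d / eps - 1) = true by lra.
by move=> /(_ isT); lra.
Qed.

Lemma horizon_ge : d * L / (alpha * eps) <= T%:R.
Proof. exact: nceil_ge. Qed.

Lemma horizon_le : T%:R <= d * L / (alpha * eps) + 1.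
Proof.
apply: nceil_le; apply: divr_ge0; last by rewrite mulr_ge0// ltW.
by rewrite mulr_ge0 ?log_ratio_ge0.
Qed.

Section Large.
Hypothesis large : 2 < d / eps.

Lemma log_ratio_large : 1 / 2 <= L.
Proof.
apply: (le_trans ln2_ge); rewrite ler_ln ?posrE//; first exact: ltW.
by apply: lt_trans large.
Qed.

Lemma horizon_gt0 : (0 < T)%N.
Proof.
rewrite -(ltr_nat R); apply: lt_le_trans horizon_ge.
apply: divr_gt0; rewrite mulr_gt0//.
by have := log_ratio_large; lra.
Qed.

(** With r = d / eps > 2: [d <= r] and [beta * T <= r ^+ 2 / 2 + 1 / 8], so the argument is at most
    [r ^+ 3]. *)
Lemma log_det_le : ln (d * (1 + beta * T%:R)) <= 3 * L.
Proof.
have r2 := large; set r := d / eps in r2; have d0 : 0 < d by rewrite ltr0n.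
have r0 : 0 < r by apply: lt_trans r2.
have bT : beta * T%:R <= r * r / 2 + 1 / 8.
  have h1 : beta * T%:R <= beta * (d * L / (alpha * eps) + 1).
    by rewrite ler_pM2l ?beta_gt0// horizon_le.
  have h2 : beta * (d * L / (alpha * eps)) <= alpha / 2 * (d * L / (alpha * eps)).
    rewrite ler_wpM2r ?beta_le_half//; apply: divr_ge0; last by rewrite mulr_ge0// ltW.
    by rewrite mulr_ge0 ?log_ratio_ge0.
  have E : alpha / 2 * (d * L / (alpha * eps)) = r * L / 2.
    by rewrite /r; field; rewrite !gt_eqF.
  have h3 : r * L <= r * r by rewrite ler_pM2l// log_ratio_le.
  have := beta_le8; lra.
have dr : d <= r by rewrite /r ler_pdivlMr// ler_piMr// ltW.
have b0 : 0 <= beta * T%:R by rewrite mulr_ge0// ltW// beta_gt0.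
have : d * (1 + beta * T%:R) <= r ^+ 3.
  have : d * (1 + beta * T%:R) <= r * (1 + (r * r / 2 + 1 / 8)) by apply: ler_pM; lra.
  move/le_trans; apply.
  have -> : r ^+ 3 = r * (r * r) by ring.
  by rewrite ler_pM2l//; nra.
have -> : 3 * L = ln (r ^+ 3) by rewrite lnXn// mulr_natl.
move=> h; rewrite ler_ln ?posrE ?exprn_gt0//.
by rewrite mulr_gt0//; lra.
Qed.

(** Every term is compared with [eps * T] through [d * L <= alpha * eps * T]. The 7 collects barrier
    (1) and regularisation (6), 18 is 6 times the 3 of [log_det_le], and 8 pays for [ep] and tau =
    eps / d. *)
Lemma regret_rate (reg ep : R) : reg <= 5 * (eta * d) -> ep <= eps ->
  (- (eta * d) * ln (eps / d) + reg / 2 + 1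
     + 6 * (d / beta * ln (d * (1 + beta * T%:R)))
     + T%:R * (2 * (ep + 3 * (eps / d)))) / T%:R
  <= (7 * (em * am) + 18 * (8 * am + 2) + 8) * eps.
Proof.
move=> hreg hep; have d0 : 0 < d by rewrite ltr0n.
have T0 : (0 : R) < T%:R by rewrite ltr0n horizon_gt0.
rewrite ler_pdivrMr//.
have lnE : ln (eps / d) = - L by rewrite /L -lnV ?posrE ?divr_gt0// invf_div.
have L2 := log_ratio_large.
have TL : d * L <= alpha * eps * T%:R.
  by have := horizon_ge; rewrite ler_pdivrMr ?mulr_gt0//; lra.
have e0 : 0 < eta by have := eta_ge; lra.
have am0 : 0 < am by apply: lt_le_trans alpha_le.
have a1 : eta * alpha <= em * am.
  by apply: ler_pM => //; exact: ltW.
have eT : 0 < eps * T%:R by rewrite mulr_gt0.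
have t1 : eta * (d * L) <= em * am * (eps * T%:R).
  have : eta * (d * L) <= eta * (alpha * eps * T%:R) by rewrite ler_pM2l.
  have : eta * alpha * (eps * T%:R) <= em * am * (eps * T%:R) by rewrite ler_pM2r.
  lra.
have t2 : reg / 2 + 1 <= 6 * (em * am * (eps * T%:R)).
  have : eta * d * (1 / 2) <= eta * d * L by rewrite ler_wpM2l// mulr_ge0// ltW.
  have : 11 * 1 <= eta * d by apply: ler_pM => //; have := d1; lra.
  lra.
have t3 : 6 * (d / beta * ln (d * (1 + beta * T%:R))) <= 18 * (8 * am + 2) * (eps * T%:R).
  have b0 := beta_gt0.
  have h1 : d / beta * ln (d * (1 + beta * T%:R)) <= d / beta * (3 * L).
    by rewrite ler_wpM2l ?log_det_le// divr_ge0// ltW.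
  have h2 : d / beta * (3 * L) = 3 * (d * L) / beta by ring.
  have h3 : d * L / beta <= alpha * eps * T%:R / beta by rewrite ler_pM2r ?invr_gt0.
  have h4 : alpha / beta * (eps * T%:R) <= (8 * am + 2) * (eps * T%:R).
    by rewrite ler_pM2r ?beta_inv_le.
  have -> : 18 * (8 * am + 2) * (eps * T%:R) = 18 * ((8 * am + 2) * (eps * T%:R)) by ring.
  have h5 : alpha * eps * T%:R / beta = alpha / beta * (eps * T%:R) by ring.
  rewrite h5 in h3; have : 3 * (d * L) / beta = 3 * (d * L / beta) by ring.
  lra.
have t4 : T%:R * (2 * (ep + 3 * (eps / d))) <= 8 * (eps * T%:R).
  have : eps / d <= eps by rewrite ler_pdivrMr// ler_peMr// ltW.
  move: (eps / d) => q h; have he := hep.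
  have : T%:R * (2 * (ep + 3 * q)) <= T%:R * (8 * eps) by rewrite ler_pM2l//; lra.
  lra.
have e3 : eta * d * L = eta * (d * L) by rewrite mulrA.
rewrite lnE mulrNN e3; move: t1 t2 t3 t4.
move: (6 * (d / beta * _)) (T%:R * (2 * _)) (eta * (d * L)) => A1 A2 A3 t1 t2 t3 t4.
lra.
Qed.

End Large.
End Numeric.

(** * Expected excess risk of the reduction *)

Section ReductionExpectation.
Context {R : realType} {n : nat} (dX dO : measure_display)
  (Xi : measurableType dX) (Omega : measurableType dO).
Local Notation V := 'cV[R]_n.+1.
Local Notation d := (n.+1%:R : R).
Variables (P : probability Omega R) (mu : probability Xi R) (xi : nat -> Omega -> Xi)
  (f : V -> Xi -> R) (C dom : set V).
Variables (eps alpha eta am em B b0 ep r0 : R).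
Let beta := Num.min (1 / 8) (alpha / 2).
Let T := nceil (d * ln (d / eps) / (alpha * eps)).
Let e := eta * d.
Let reg := d + eta * B ^+ 2.
Hypotheses (eps_gt0 : 0 < eps) (eps_le : eps <= 1 / d) (alpha_gt0 : 0 < alpha)
  (alpha_le : alpha <= am) (eta_ge : 11 <= eta) (eta_le : eta <= em).
Hypotheses (xi_iid : iid P mu xi) (floss : loss_family mu alpha dom f)
  (cdom : convex_set dom) (C0 : C !=set0) (CB : C `<=` eball 1) (Cdom : C `<=` dom).
Hypotheses (B_ge0 : 0 <= B) (reg_le : reg <= 5 * e) (ep0 : 0 <= ep) (ep_le : ep <= eps)
  (r00 : 0 < r0) (rdom : eball r0 `<=` dom).
Hypothesis b0P : forall s, 0 <= s -> s < 1 ->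
  (1 + s * b0) ^+ 2 <= reg /\ 16 * (1 + s * b0) ^+ 2 <= 2 * e / (1 - s ^+ 2) + reg.

Lemma reduction_expectation (w nu zeta : nat -> Omega -> V) :
  nonanticipating xi T nu zeta ->
  (forall om, good_run B eta beta ep b0 T C dom (fun t => f^~ (xi t om)) T
     (w^~ om) (nu^~ om) (zeta^~ om)) ->
  ('E_P[fun om => excess_risk mu f C (average T (fun t => played (w t om) (nu t om)))]
     <= ((7 * (em * am) + 18 * (8 * am + 2) + 9) * eps)%:E)%E.
Proof.
move=> nonant run.
have d0 : 0 < d by rewrite ltr0n.
have eps1 : eps <= 1.
  by apply: le_trans eps_le _; rewrite ler_pdivrMr ?ltr0n// mul1r ler1n.
have b_gt0 : 0 < beta by exact: beta_gt0.
have ep01 : 0 <= ep <= 1 by rewrite ep0 (le_trans ep_le).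
have [fc fb _] := floss.
have ball t om : (t < T)%N -> dot (w t om) (w t om) < 1.
  move=> tT; have T_gt0 : (0 < T)%N by exact: leq_ltn_trans tT.
  exact: (run_in_ball eta_ge b_gt0 B_ge0 T_gt0 b0P (run om) (ltnW tT)).
have uint om t : (t < T)%N ->
    interior_point dom (played (w t om) (nu t om)) /\ enorm (played (w t om) (nu t om)) <= 1.
  move=> tT; have [_ /(_ t tT) [hz _ _]] := run om; split.
    by apply: (subdiff_interior cdom r00 rdom hz) => z'; exact: fb.
  apply: (le_trans (played_le _ _)); rewrite enorm_le// expr1n ltW//.
  exact: ball.
have avg om := average_interior cdom r00 rdom (uint om).
have am0 : 0 < am by apply: lt_le_trans alpha_le.
have [v0 Cv0] := C0.
have [small|large] := leP (d / eps) 2.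
  apply: (@le_trans _ _ (2 : R)%:E).
    rewrite unlock; apply: (@le_trans _ _ (\int[P]_om (2 : R)%:E)%E).
      apply: integral_mono => om; have [ai a1] := avg om.
      by have := excess_risk_le alpha_gt0 cdom floss Cdom CB Cv0 ai; lra.
    by rewrite integral_cst// [X in (_ * X)%E]probability_setT mule1.
  rewrite lee_fin; have e2 : 1 / 2 <= eps.
    move: small; rewrite ler_pdivrMr//; have : 1 <= d by rewrite ler1n.
    lra.
  have p1 : 0 <= em * am by apply: mulr_ge0; [have := eta_ge; have := eta_le; lra|exact: ltW].
  have : 4 * eps <= (7 * (em * am) + 18 * (8 * am + 2) + 9) * eps.
    by rewrite ler_pM2r//; lra.
  lra.
have T_gt0 : (0 < T)%N by exact: horizon_gt0.
pose Reg : R := - e * ln (eps / d) + reg / 2 + 1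
     + 6 * (d / beta * ln (d * (1 + beta * T%:R)))
     + T%:R * (2 * (ep + 3 * (eps / d))).
pose u t om := played (w t om) (nu t om).
have mw t : (t < T)%N -> depends_on_first xi t (w t).
  move=> tT.
  (* Omega with the sigma-algebra of the rounds before [t], so that measurability on [W] is
     dependence on the past. *)
  pose W := g_sigma_algebraType [set E | exists s (D : set Xi),
    [/\ (s < t)%N, measurable D & E = xi s @^-1` D]].
  have mnu s : (s < t)%N -> mx_measurable (nu s : W -> V).
    move=> st; apply/depends_on_firstP; apply: (depends_on_first_le (ltnW st)).
    by have [] := nonant s (ltn_trans st tT).
  have mzeta s : (s < t)%N -> mx_measurable (zeta s : W -> V).
    move=> st; apply/depends_on_firstP; apply: (depends_on_first_le st).
    by have [] := nonant s (ltn_trans st tT).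
  apply/depends_on_firstP.
  refine (@mx_measurable_run R _ W n B eta beta (1 / 4) T w nu zeta t (ltnW tT) _ _
    mnu mzeta t (leqnn t)).1 => [om|s om sT]; first by case: (run om) => -[].
  have [[_ /(_ s sT) ->] _] := run om.
  by rewrite gradient_Phi//; exact: ball.
have u_past t : (t < T)%N -> depends_on_first xi t (u t).
  move=> tT; apply/depends_on_firstP.
  apply: mx_measurable_played; apply/depends_on_firstP; first exact: mw.
  by have [] := nonant t tT.
have i0 : interior_point dom 0.
  by exists r0 => // v; rewrite subr0 => hv; exact: rdom.
have u_reg om v : C v ->
    \sum_(t < T) (f (u t om) (xi t om) - f v (xi t om)) <= Reg.
  move=> Cv; apply: (run_regret eta_ge b_gt0 _ B_ge0 T_gt0 ep01 b0P (run om) _ _ _ CB Cdom cdom _ Cv) => //.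
  - exact: beta_le8.
  - by rewrite divr_gt0.
  - by rewrite ler_pdivrMr// mul1r (le_trans eps1)// ler1n.
  - exact: beta_le_half.
have u_int t om : (t < T)%N -> interior_point dom (u t om) by move=> /(uint om) [].
have u_ball t om : (t < T)%N -> enorm (u t om) <= 1 by move=> /(uint om) [].
have := online_to_batch xi_iid alpha_gt0 cdom floss Cdom C0 CB T_gt0 i0 u_past u_int u_ball u_reg eps_gt0.
move/le_trans; apply; rewrite lee_fin.
have := regret_rate eps_gt0 eps_le alpha_gt0 alpha_le eta_ge eta_le large reg_le ep_le.
rewrite -/T -/beta -/e -/Reg; lra.
Qed.

End ReductionExpectation.

(** * Correctness of the program *)

Section ShermanMorrison.
Context {R : realType} {n : nat}.
Local Notation V := 'cV[R]_n.+1.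

(** Coercivity makes the denominator [1 + k * a] positive and both matrices invertible. *)
Lemma rank_oneP (S : 'M[R]_n.+1) (k0 k : R) (x : V) : 0 < k0 -> coercive k0 S -> 0 <= k ->
  value (rank_one (invmx S) k x) = invmx (S + k *: (x *m x^T)).
Proof.
move=> k00 cS k_ge0; rewrite /rank_one/=.
have uS := coercive_unit k00 cS.
have [y yE] : exists y, y = invmx S *m x by exists (invmx S *m x).
rewrite -yE; set a := dot x y; set b := k / (1 + k * a).
have Sy : S *m y = x by rewrite yE mulmxA mulmxV// mul1mx.
have a0 : 0 <= a.
  rewrite /a -{1}Sy; apply: (coercive_form_ge0 (k := k0)) => //; exact: ltW.
have a1 : 0 < 1 + k * a by rewrite ltr_pwDl// mulr_ge0.
have cS' : coercive (k0 + 0) (S + k *: (x *m x^T)).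
  by apply: coerciveD => //; exact: coercive_outer.
rewrite addr0 in cS'; have uS' := coercive_unit k00 cS'.
have yT : x^T *m invmx S = y^T by rewrite yE trmx_mul sym_invmx// cS.1.
have xy : (x *m x^T) *m y = a *: x by rewrite outer_mulmx.
have E : (S + k *: (x *m x^T)) *m (invmx S + (- b) *: (y *m y^T)) = 1%:M.
  have SY : S *m (y *m y^T) = x *m y^T by rewrite mulmxA Sy.
  have XA : (x *m x^T) *m invmx S = x *m y^T by rewrite -mulmxA yT.
  have XY : (x *m x^T) *m (y *m y^T) = a *: (x *m y^T) by rewrite mulmxA xy -scalemxAl.
  rewrite mulmxDr mulmxDl mulmxV// -scalemxAl XA -scalemxAr mulmxDl SY -scalemxAl XY.
  move: (x *m y^T) => M; rewrite -[RHS]addr0 -addrA; congr (_ + _).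
  rewrite scalerDr !scalerA -!scalerDl.
  have -> : k + (- b + - b * k * a) = 0 by rewrite /b; field; rewrite gt_eqF.
  by rewrite scale0r.
by rewrite -[LHS]mul1mx -(mulVmx uS') -mulmxA E mulmx1.
Qed.

Lemma neumannP j (theta : R) (H : 'M[R]_n.+1) (y acc : V) :
  value (neumann j theta H y acc)
  = acc + \sum_(1 <= i < j.+1) theta ^+ i *: (H ^+ i *m y).
Proof.
elim: j y acc => [|j IH] y acc; first by rewrite big_geq//= addr0.
rewrite /= IH [in RHS]big_nat_recl//= -addrA !expr1; congr (_ + (_ + _)).
apply: eq_big_nat => i _.
rewrite -scalemxAr scalerA -exprSr mulmxA.
by rewrite [H ^+ i.+1]exprSr mulmxE.
Qed.

End ShermanMorrison.

Section ProgramCorrectness.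
Context {R : realType} {n : nat}.
Local Notation V := 'cV[R]_n.+1.
Local Notation d := (n.+1%:R : R).
Variables (B eta beta c : R) (T : nat) (nu_prog : V -> Defs.comp V) (zeta : nat -> V).
Let e := eta * d.
Let reg := d + eta * B ^+ 2.
Let w := program_w B eta beta c T nu_prog zeta.
Let nu := program_nu B eta beta c T nu_prog zeta.
Let g t := surrogate (w t) (nu t) (zeta t).
Let st t := value (program_state B eta beta c T nu_prog zeta t).
Hypotheses (e_ge : 11 <= e) (reg_ge0 : 0 <= reg) (beta_ge0 : 0 <= beta) (cE : c = 1 / 4).

Definition landmark_hess (v : V) (t : nat) : 'M[R]_n.+1 :=
  (2 * eta * d / (1 - enorm v ^+ 2))%:M + reg%:M + beta *: \sum_(s < t) g s *m (g s)^T.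

Lemma landmark_hess_coercive v t : dot v v < 1 -> coercive 1 (landmark_hess v t).
Proof.
move=> v1; have v0 := dot_ge0 v; have Dv : 0 < 1 - dot v v by rewrite subr_gt0.
have h : 1 <= 2 * eta * d / (1 - enorm v ^+ 2) + reg + 0.
  rewrite sqr_enorm addr0; have : 1 <= 2 * eta * d / (1 - dot v v).
    by rewrite ler_pdivlMr// mul1r -mulrA; have := e_ge; rewrite /e; lra.
  by have := reg_ge0; lra.
apply: (coercive_le h); apply: coerciveD.
  by apply: coerciveD; exact: coercive_scalar.
by rewrite scaler_sumr; apply: coercive_sum => s; exact: coercive_outer.
Qed.

Lemma play_value (x y : V) : value (play x y) = played x y.
Proof. by rewrite /play /played/=; case: ifP. Qed.

Lemma feedback_value (x y z : V) : value (feedback x y (played x y) z) = surrogate x y z.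
Proof. by rewrite /feedback /surrogate/=; case: ifP => //; rewrite scale0r subr0. Qed.

Lemma program_stateS t : st t.+1 =
  value (oqns_update B eta beta c T (st t) (played (w t) (nu t)) (g t)).
Proof. by rewrite /st /= play_value feedback_value. Qed.

(** The stored inverse lags one round behind, hence the landmark at [t.-1]; at [t = 0] this is the
    landmark 0 of the initial matrix. When [st_same] holds, a rank-one correction is enough. *)
Definition state_inv t :=
  [/\ st_v (st t) = landmark c w t,
      st_same (st t) -> landmark c w t = landmark c w t.-1,
      st_A (st t) = invmx (landmark_hess (landmark c w t.-1) t) &
      [/\ st_G (st t) = \sum_(s < t) g s *m (g s)^T,
          st_q (st t) = \sum_(s < t) dot (g s) (w s) *: g s,
          st_g (st t) = \sum_(s < t) g s &
          st_u (st t) = \sum_(s < t) played (w s) (nu s)]].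

Definition updated_inverse t : 'M[R]_n.+1 :=
  value (if st_same (st t) then rank_one (st_A (st t)) beta (g t) else
    let* r := tick 1 (2 * eta * d / (1 - dot (st_v (st t)) (st_v (st t))) + (d + eta * B ^+ 2)) in
    let* D := Defs.scalar r in
    let* bG := Defs.mscale beta (st_G (st t) + g t *m (g t)^T) in
    let* S := madd D bG in minv S).

Lemma updated_inverseP t : state_inv t -> (forall s, (s <= t)%N -> dot (w s) (w s) < 1) ->
  updated_inverse t = invmx (landmark_hess (landmark c w t) t.+1).
Proof.
move=> [vE sE AE [GE _ _ _]] hw; rewrite /updated_inverse.
have w0 : w 0%N = 0 by [].
have [v1 _] := landmark_close cE w0 hw.
have SE v : landmark_hess v t.+1 = landmark_hess v t + beta *: (g t *m (g t)^T).
  by rewrite /landmark_hess big_ord_recr/= scalerDr addrA.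
case: ifPn => same.
  rewrite AE -(sE same) SE; apply: (@rank_oneP _ _ _ 1) => //.
  exact: landmark_hess_coercive.
rewrite /= GE vE /landmark_hess -sqr_enorm big_ord_recr/=.
by rewrite raddfD.
Qed.

(** The running sums suffice for the gradient because $\sum_s\langle g_s,w-w_s\rangle g_s=Gw-q$, and
    [neumann] started at [y = H grad] produces all the powers of the series. *)
Lemma update_w t : state_inv t -> (forall s, (s <= t)%N -> dot (w s) (w s) < 1) ->
  w t.+1 = w t - \sum_(1 <= k < (oqns_terms (n := n) B eta beta c T).+2)
      oqns_theta eta c w t ^+ k.-1
        *: (oqns_H B eta beta c w g t ^+ k *m gradient (Phi B eta beta w g t.+1) (w t)).
Proof.
move=> inv hw; have [vE sE AE [GE qE gE uE]] := inv.
have w1 := hw t (leqnn _).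
have w0 : w 0%N = 0 by [].
have [v1 _] := landmark_close cE w0 hw.
have D0 : 0 < 1 - dot (w t) (w t) by rewrite subr_gt0.
set terms := oqns_terms _ _ _ _ _.
set ww := dot (w t) (w t); rewrite -/ww in D0.
have -> : w t.+1 = w t -
    (let H := value (rank_one (updated_inverse t) (4 * eta * d / (1 - ww) ^+ 2) (w t)) in
     let y := H *m (beta *: ((st_G (st t) + g t *m (g t)^T) *m w t
                             - (st_q (st t) + dot (g t) (w t) *: g t))
                    + (2 * eta * d / (1 - ww) + (d + eta * B ^+ 2)) *: w t
                    + (st_g (st t) + g t)) in
     value (neumann terms (2 * eta * d / (1 - dot (st_v (st t)) (st_v (st t)))
                           - 2 * eta * d / (1 - ww)) H y y)).
  by rewrite {1}/w /program_w -/(st t.+1) program_stateS.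
cbv zeta; rewrite updated_inverseP// neumannP vE GE qE gE.
have -> : value (rank_one (invmx (landmark_hess (landmark c w t) t.+1))
    (4 * eta * d / (1 - ww) ^+ 2) (w t)) = oqns_H B eta beta c w g t.
  rewrite (@rank_oneP _ _ _ 1)//; first by rewrite /oqns_H /oqns_A invmxK (sqr_enorm (w t)).
    exact: landmark_hess_coercive.
  have e4 : 0 <= 4 * eta * d by rewrite -mulrA; have := e_ge; rewrite /e; lra.
  by rewrite mulr_ge0// invr_ge0 sqr_ge0.
set H := oqns_H _ _ _ _ _ _ _; set grad := _ + _ + _.
have -> : grad = gradient (Phi B eta beta w g t.+1) (w t).
  rewrite gradient_Phi// /grad /pgrad /bgrad -/ww.
  have E : (\sum_(s < t) g s *m (g s)^T + g t *m (g t)^T) *m w t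
      - (\sum_(s < t) dot (g s) (w s) *: g s + dot (g t) (w t) *: g t)
      = \sum_(s < t.+1) dot (g s) (w t - w s) *: g s.
    rewrite mulmxDl mulmx_suml outer_mulmx [in RHS]big_ord_recr/= opprD addrACA -sumrB.
    rewrite -scalerBl -dotBr; congr (_ + _); apply: eq_bigr => s _.
    by rewrite outer_mulmx -scalerBl -dotBr.
  rewrite E [in X in _ = _ + X]big_ord_recr/= scalerDl; congr (_ + _).
  by rewrite addrC; congr (_ *: _ + _ + _); rewrite mulrA.
set gr := gradient _ _.
congr (_ - _); rewrite [in RHS]big_nat_recl//= expr0 scale1r expr1; congr (_ + _).
apply: eq_big_nat => i i0.
by rewrite /oqns_theta !sqr_enorm [H ^+ i.+1]exprSr -mulmxE -mulmxA.
Qed.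

Lemma state_inv0 : state_inv 0.
Proof.
split=> //; last by split; rewrite big_ord0 // /st /= raddf0.
rewrite /landmark_hess big_ord0 scaler0 addr0 /= sqr_enorm dot0l subr0 divr1.
rewrite /st /= -raddfD/= addrA invmx_scalar//.
Qed.

Lemma landmark_kept t : st_v (st t) = landmark c w t ->
  st_same (st t.+1) = keep_landmark c (w t.+1) (landmark c w t).
Proof.
move=> vE; rewrite /keep_landmark !sqr_enorm -vE [in RHS]/w /program_w -/(st t.+1).
by rewrite program_stateS.
Qed.

Lemma state_invS t : state_inv t -> (forall s, (s <= t)%N -> dot (w s) (w s) < 1) ->
  state_inv t.+1.
Proof.
move=> inv hw; have [vE sE AE [GE qE gE uE]] := inv.
have sameE := landmark_kept vE.
have vS : st_v (st t.+1) = if st_same (st t.+1) then st_v (st t) else w t.+1.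
  by rewrite [in RHS]/w /program_w -/(st t.+1) program_stateS.
have AS : st_A (st t.+1) = updated_inverse t by rewrite program_stateS.
split.
- by rewrite vS sameE vE.
- by rewrite sameE /= => ->.
- by rewrite AS updated_inverseP.
- by split; rewrite program_stateS big_ord_recr/= ?GE ?qE ?gE ?uE.
Qed.

(** A joint induction: the state invariant makes round [N] an OQNS step, and the prefix run keeps
    [w N] in the ball, which the next inverse needs. *)
Lemma program_good_run ep b0 (C dom : set V) (loss : nat -> V -> R) :
  11 <= eta -> 0 < beta -> 0 <= B -> c = 1 / 4 ->
  (forall s, 0 <= s -> s < 1 ->
    (1 + s * b0) ^+ 2 <= reg /\ 16 * (1 + s * b0) ^+ 2 <= 2 * e / (1 - s ^+ 2) + reg) ->
  (forall t, (t < T)%N ->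
    [/\ subdiff (ext dom (loss t)) (played (w t) (nu t)) (zeta t),
        enorm (zeta t) <= 1 &
        dot (w t) (w t) < 1 -> admissible C ep (w t) (nu t) /\ enorm (nu t) <= b0]) ->
  forall N, (N <= T)%N -> good_run B eta beta ep b0 T C dom loss N w nu zeta /\ state_inv N.
Proof.
move=> eta_ge beta_gt0 B_ge0 cE' b0P H.
have wr N : (N <= T)%N ->
    oqns_upto B eta beta (1 / 4) T N w g -> good_run B eta beta ep b0 T C dom loss N w nu zeta.
  by move=> NT h; split=> // t tN; apply: H; exact: leq_trans NT.
elim=> [|N IH] NT.
  by split; [apply: wr|exact: state_inv0].
have [hN inv] := IH (ltnW NT); have T_gt0 : (0 < T)%N by exact: leq_ltn_trans NT.
have hw s : (s <= N)%N -> dot (w s) (w s) < 1.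
  exact: (run_in_ball eta_ge beta_gt0 B_ge0 T_gt0 b0P hN).
split; last exact: state_invS.
apply: wr => //; split=> // t; rewrite ltnS leq_eqVlt => /orP[/eqP ->|tN].
  by rewrite -cE'; exact: update_w.
exact: hN.1.2.
Qed.

Lemma program_value : state_inv T ->
  value (program B eta beta c T nu_prog zeta) = average T (fun t => played (w t) (nu t)).
Proof. by move=> [_ _ _ [_ _ _ uE]]; rewrite /= -/(st T) uE. Qed.

End ProgramCorrectness.

(** * Oracle subgradients *)

Section Oracles.
Context {R : realType} {n : nat}.
Local Notation V := 'cV[R]_n.+1.
Local Notation d := (n.+1%:R : R).
Implicit Types (C : set V) (O : V -> option V) (x y v w nu : V).

Lemma projection_obtuse C w p x : convex_set C -> C p ->
  (forall v, C v -> enorm (p - w) <= enorm (v - w)) -> C x -> dot (w - p) (x - p) <= 0.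
Proof.
move=> cC Cp pw Cx; rewrite leNgt; apply/negP.
set a := dot _ _ => a0; set q := dot (x - p) (x - p).
have q0 : 0 <= q := dot_ge0 _.
(* For this [tau] one has [tau * q = (1 - tau) * a], so the squared distance changes by
   [- tau * (1 + tau) * a], contradicting the minimality of [p]. *)
set tau := a / (a + q).
have aq : 0 < a + q by rewrite ltr_wpDr.
have t0 : 0 < tau by rewrite divr_gt0.
have t1 : tau <= 1 by rewrite ler_pdivrMr// mul1r lerDl.
have := pw _ (convex_set_seg cC Cp Cx (ltW t0) t1).
rewrite -ler_sqr ?nnegrE ?enorm_ge0// !sqr_enorm addrAC -[p - w]opprB.
rewrite [leRHS]dotDl !dotDr (dotC (tau *: _)) !dotZr !dotZl !dotNl !dotNr -/a -/q.
have tE : tau * q = a - tau * a by rewrite /tau; field; rewrite gt_eqF.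
nra.
Qed.

(** For unit [nu] along [w - p] and [x] in [C],
    $\|v-x\|\ge\langle\nu,v-x\rangle\ge\langle\nu,v-p\rangle$, the last step by the obtuse angle at
    [p]; and $\langle\nu,w-p\rangle$ is the distance itself. *)
Lemma nu_projection_subdiff C O w : convex_set C -> projection_oracle C O ->
  subdiff (inf_conv C (fun x => (enorm x)%:E)) w (value (nu_projection O w)).
Proof.
move=> cC /(_ w); set S := inf_conv _ _.
have Sge0 y : (0 <= S y)%E by apply: inf_conv_ge0 => x; rewrite lee_fin enorm_ge0.
have zero : (S w <= 0)%E -> subdiff S w 0.
  move=> S0; rewrite /subdiff/=; have -> : S w = 0%E by apply/eqP; rewrite eq_le S0 Sge0.
  by split=> // v; rewrite dot0l adde0.
rewrite /nu_projection /=; case: (O w) => [p [Cp pw]|Cw] /=; last first.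
  by apply: zero; apply: (inf_conv_le Cw); rewrite subrr enorm0.
rewrite -/(enorm (w - p)); set s := enorm (w - p).
have Sw : (S w <= s%:E)%E by exact: (inf_conv_le Cp).
case: eqP => [s0|/eqP s0] /=; first by apply: zero; move: Sw; rewrite s0.
have s_gt0 : 0 < s by rewrite lt_def s0 enorm_ge0.
rewrite /subdiff/=; have -> : S w = s%:E.
  apply/eqP; rewrite eq_le Sw; apply: le_ereal_inf_tmp => _ [x Cx <-].
  by rewrite lee_fin /s -enormN opprB -(enormN (w - x)) opprB pw.
split=> // v; apply: le_ereal_inf_tmp => _ [x Cx <-].
rewrite -EFinD lee_fin.
have nun : enorm (s^-1 *: (w - p)) = 1.
  by rewrite enormZ ger0_norm ?invr_ge0 ?enorm_ge0// mulVf.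
have h1 : dot (s^-1 *: (w - p)) (v - x) <= enorm (v - x).
  by apply: le_trans (ler_norm _) _; rewrite (le_trans (dot_le_enorm _ _))// nun mul1r.
have h2 : dot (s^-1 *: (w - p)) (x - p) <= 0.
  by rewrite dotZl pmulr_rle0 ?invr_gt0//; exact: projection_obtuse pw Cx.
have h3 : dot (s^-1 *: (w - p)) (w - p) = s.
  by rewrite dotZl -sqr_enorm -/s expr2 mulKf.
move: h1 h2 h3; set u := s^-1 *: _; rewrite !dotBr; lra.
Qed.

(** The program returns only the upper end and the separator; the lower end certified by that
    separator is recovered as [lo']. *)
Lemma bisectP C O (N : nat) w (lo hi : R) y : separation_oracle C O ->
  0 < lo -> lo <= hi -> C (hi^-1 *: w) ->
  (forall v, C v -> dot y v < dot y (lo^-1 *: w)) ->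
  let r := value (bisect O N w lo hi y) in
  exists lo', [/\ lo <= lo', lo' <= r.1, r.1 <= hi & r.1 - lo' <= (hi - lo) / 2 ^+ N] /\
    C (r.1^-1 *: w) /\ forall v, C v -> dot r.2 v < dot r.2 (lo'^-1 *: w).
Proof.
move=> sep; elim: N lo hi y => [|N IH] lo hi y lo0 lohi Chi sy /=.
  by exists lo; rewrite expr0 divr1; do !split.
set mid := (lo + hi) / 2.
have E (k : R) : k / 2 / 2 ^+ N = k / 2 ^+ N.+1 by rewrite -mulrA -invfM -exprS.
have := sep (mid^-1 *: w); case: (O _) => [y' sy'|Cm] /=.
  have [||lo' [[h1 h2 h3 h4] h]] := IH mid hi y' _ _ Chi sy'; [rewrite /mid; lra..|].
  exists lo'; split=> //; split=> //; first by apply: le_trans h1; rewrite /mid; lra.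
  by rewrite -E (_ : (hi - lo) / 2 = hi - mid)// /mid; lra.
have [||lo' [[h1 h2 h3 h4] h]] := IH lo mid y _ _ Cm sy; [by []|rewrite /mid; lra|].
exists lo'; split=> //; split=> //; first by apply: (le_trans h3); rewrite /mid; lra.
by rewrite -E (_ : (hi - lo) / 2 = mid - lo)// /mid; lra.
Qed.

Section Separation.
Variables (C : set V) (O : V -> option V) (N : nat) (dl : R).
Hypotheses (sep : separation_oracle C O) (bC : eball (1 / Num.sqrt d) `<=` C).
Hypothesis dlP : (Num.sqrt d - 1) / 2 ^+ N <= dl.

Let sqrt_d_ge1 : 1 <= Num.sqrt d.
Proof. by rewrite -[leLHS]sqrtr1 ler_sqrt ?ltr0n// ler1n. Qed.

Let C_0 : C 0.
Proof. by apply: bC; rewrite /eball/= enorm0 divr_ge0// sqrtr_ge0. Qed.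

Lemma nu_separationP w : enorm w <= 1 ->
  let nu := value (nu_separation O N w) in
  (nu = 0 /\ C w) \/
  exists hi, [/\ 1 <= hi, dot nu w = hi, C (hi^-1 *: w) & forall v, C v -> dot nu v <= 1 + dl].
Proof.
move=> w1; rewrite /nu_separation/=.
have := sep w; case: (O w) => [y0 sy0|Cw] /=; last by left.
have Ctop : C ((Num.sqrt d)^-1 *: w).
  apply: bC; rewrite /eball/= enormZ ger0_norm ?invr_ge0 ?sqrtr_ge0// div1r.
  by rewrite ler_piMr// invr_ge0 sqrtr_ge0.
have sy1 v : C v -> dot y0 v < dot y0 (1^-1 *: w) by rewrite invr1 scale1r; exact: sy0.
have [lo [[lo1 lohi hitop hilo] [Chi sy]]] := bisectP N sep ltr01 sqrt_d_ge1 Ctop sy1.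
right; set r := value _ in lohi hitop hilo Chi sy *.
have lo0 : 0 < lo by apply: lt_le_trans lo1.
have q0 : 0 < dot r.2 w.
  have := sy 0 C_0; rewrite dot0r dotZr pmulr_rgt0 ?invr_gt0//.
have hi0 : 0 < r.1 by apply: lt_le_trans lohi.
exists r.1; split=> //; first exact: le_trans lohi.
  by rewrite dotZl divfK ?gt_eqF.
move=> v Cv; rewrite dotZl; have := sy v Cv; rewrite dotZr => h.
(* After normalisation the separator is at most the ratio of the two ends on [C]; as the lower end
   is at least 1, the interval length bounds the excess over 1. *)
have h1 : r.1 / dot r.2 w * dot r.2 v <= r.1 / lo.
  have -> : r.1 / lo = r.1 / dot r.2 w * (lo^-1 * dot r.2 w).
    by field; rewrite !gt_eqF.
  by rewrite ler_pM2l ?divr_gt0// ltW.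
apply: (le_trans h1); rewrite ler_pdivrMr//.
have := le_trans hilo dlP; nra.
Qed.

Hypothesis sC : C = -%R @` C.

Let dl_ge0 : 0 <= dl.
Proof. by apply: le_trans dlP; rewrite divr_ge0 ?exprn_ge0// subr_ge0. Qed.

Lemma nu_separation_admissible w : enorm w <= 1 ->
  let nu := value (nu_separation O N w) in
  admissible C dl w nu /\ enorm nu <= Num.sqrt d * (1 + dl).
Proof.
move=> w1 nu; have [[nu0 Cw]|[hi [hi1 hiE Chi nuC]]] := nu_separationP w1.
  have sd0 := sqrtr_ge0 d.
  rewrite /nu nu0 enorm0; split; last by rewrite mulr_ge0// addr_ge0.
  split=> [v _|_ v _]; rewrite dot0l ?normr0; last by rewrite oppr_le0.
  by rewrite addr_ge0.
split; last by rewrite mulrC; apply: (polar_norm bC) => //; rewrite addr_ge0.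
split=> [v Cv|]; last by rewrite hiE; move: hi1; case: leP.
by rewrite ler_norml nuC// andbT lerNl -dotNr nuC//; exact: symmetric_opp.
Qed.

(** For [y = l *: z + x] with [z] and [x] in [C], the claim becomes [dot nu y <= l + 1 + eps],
    because [S w <= hi - 1] and [dot nu w = hi]. *)
Lemma nu_separation_subdiff (eps : R) w y : dl * Num.sqrt d <= eps -> enorm w <= 1 -> eball 1 y ->
  (inf_conv C (gauge C) w + (dot (value (nu_separation O N w)) (y - w))%:E - eps%:E
    <= inf_conv C (gauge C) y)%E.
Proof.
move=> dleps w1 y1; set S := inf_conv _ _; set nu := value _.
have eps0 : 0 <= eps by apply: le_trans dleps; rewrite mulr_ge0 ?sqrtr_ge0.
have Sge0 z : (0 <= S z)%E by apply: inf_conv_ge0; exact: gauge_ge0.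
have [_ nun] := nu_separation_admissible w1.
have [[nu0 Cw]|[hi [hi1 hiE Chi nuC]]] := nu_separationP w1.
  rewrite /nu nu0 dot0l adde0; apply: le_trans (Sge0 y).
  have Sw : (S w <= 0)%E.
    by apply: (inf_conv_le Cw); rewrite subrr; apply: gauge0; exists 0.
  by rewrite leeBlDr// add0e; apply: (le_trans Sw).
have hi0 : 0 < hi by apply: lt_le_trans hi1.
have Sw : (S w <= (hi - 1)%:E)%E.
  apply: (inf_conv_le Chi); apply: (gauge_le _ Chi); first by rewrite subr_ge0.
  by rewrite scalerBl scale1r scalerA divff ?gt_eqF// scale1r.
apply: le_ereal_inf_tmp => _ [x Cx <-]; apply: le_ereal_inf_tmp => _ [l [l0 [z Cz yE]] <-].
apply: (@le_trans _ _ ((hi - 1)%:E + (dot nu (y - w))%:E - eps%:E)%E).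
  by rewrite leeD2r// leeD2r.
rewrite -EFinD lee_fin dotBr hiE.
have hy : dot nu y <= (l + 1) * (1 + dl).
  have -> : y = l *: z + x by rewrite -yE subrK.
  rewrite dotDr dotZr; have := nuC z Cz; have := nuC x Cx.
  by rewrite -/nu; nra.
have hy' : dot nu y <= Num.sqrt d * (1 + dl).
  apply: (le_trans (ler_norm _)); apply: (le_trans (dot_le_enorm _ _)).
  by have := y1; rewrite /eball/=; have := enorm_ge0 nu; have := enorm_ge0 y; move: nun; rewrite -/nu; nra.
(* For small [l] the polar bound loses only [(l + 1) * dl <= eps]; for large [l] the norm bound on
   [nu] over the unit ball takes over. *)
have [hl|hl] := leP (l + 1) (Num.sqrt d); nra.
Qed.

End Separation.

End Oracles.

(* The two hypotheses on the surrogate losses required by the guarantee for OQNS: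
   [1 + s * b0] bounds their norm when [enorm (w t) = s]. *)
Section NormConditions.
Context {R : realType}.
Variables (eta x s : R).
Hypotheses (eta_ge : 11 <= eta) (x1 : 1 <= x) (s0 : 0 <= s) (s1 : s < 1).

Let quot_ge (k : R) : 0 <= k -> k * (1 - s ^+ 2) <= 22 * x ^+ 2 ->
  k <= 2 * (eta * x ^+ 2) / (1 - s ^+ 2).
Proof.
move=> k0 h; rewrite ler_pdivlMr ?subr_gt0 ?expr_lt1//; apply: (le_trans h).
by have := eta_ge; have := x1; nra.
Qed.

Lemma dist_condition :
  (1 + s * 1) ^+ 2 <= x ^+ 2 + eta * 1 ^+ 2 /\
  16 * (1 + s * 1) ^+ 2 <= 2 * (eta * x ^+ 2) / (1 - s ^+ 2) + (x ^+ 2 + eta * 1 ^+ 2).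
Proof.
rewrite mulr1 expr1n mulr1; have e11 := eta_ge; have hs := s0; have hs1 := s1.
have xx : 1 <= x ^+ 2 by have := x1; nra.
split; first nra.
have [h|h] := leP (16 * (1 + s) ^+ 2) 12; first by have := quot_ge (lexx 0); rewrite mul0r; nra.
have : 16 * (1 + s) ^+ 2 - 12 <= 2 * (eta * x ^+ 2) / (1 - s ^+ 2).
  apply: quot_ge; first by rewrite subr_ge0 ltW.
  apply: (@le_trans _ _ 22); last lra.
  (* the difference is [(4 s^2 + 4 s - 7/2)^2 + 23/4 - 4 s] *)
  have := sqr_ge0 (4 * s ^+ 2 + 4 * s - 7 / 2); rewrite !expr2; nra.
lra.
Qed.

Lemma gauge_condition b0 : 0 <= b0 -> b0 <= x + 4 / 27 ->
  (1 + s * b0) ^+ 2 <= x ^+ 2 + eta * (1 + x) ^+ 2 /\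
  16 * (1 + s * b0) ^+ 2
    <= 2 * (eta * x ^+ 2) / (1 - s ^+ 2) + (x ^+ 2 + eta * (1 + x) ^+ 2).
Proof.
move=> b00 b0x; have e11 := eta_ge; have hs := s0; have hs1 := s1; have hx := x1.
have X0 : 11 * (1 + x) ^+ 2 <= eta * (1 + x) ^+ 2 by rewrite ler_wpM2r// sqr_ge0.
have sb0 : 0 <= s * b0 by rewrite mulr_ge0.
have sq k : s * b0 <= k -> (1 + s * b0) ^+ 2 <= (1 + k) ^+ 2.
  by move=> h; rewrite ler_sqr ?nnegrE; lra.
have b1 : s * b0 <= x + 4 / 27 by nra.
have h1 := sq _ b1.
split; first nra.
(* Near the sphere [1 - s ^+ 2 <= 1 / 2] doubles the barrier curvature; further inside, [s <= 3 / 4]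
   shrinks the correction. *)
have [s2|s2] := leP (1 / 2) (s ^+ 2).
  have := @quot_ge (44 * x ^+ 2); rewrite mulr_ge0 ?sqr_ge0// => /(_ isT).
  have -> : 44 * x ^+ 2 * (1 - s ^+ 2) <= 22 * x ^+ 2 by nra.
  by move/(_ isT); nra.
have s3 : s <= 3 / 4 by nra.
(* 1/9 is 3/4 of the 4/27 allowed for the bisection error. *)
have b2 : s * b0 <= 3 / 4 * x + 1 / 9 by nra.
have h2 := sq _ b2.
have := @quot_ge (22 * x ^+ 2); rewrite mulr_ge0 ?sqr_ge0// => /(_ isT).
have -> : 22 * x ^+ 2 * (1 - s ^+ 2) <= 22 * x ^+ 2 by nra.
by move=> /(_ isT); nra.
Qed.

End NormConditions.

(** * Computational cost *)

Section OperationCounts.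
Context {R : realType} {n : nat}.
Local Notation V := 'cV[R]_n.+1.
Variable O : V -> option V.

Lemma nu_projection_cost (w : V) :
  (ops (nu_projection O w) <= 7 * n.+1)%N /\ calls (nu_projection O w) = 1%N.
Proof.
rewrite /nu_projection/=; case: (O w) => [p|] /=; last by [].
by case: eqP => _ /=; split; lia.
Qed.

Lemma bisect_cost N (w : V) lo hi y :
  ops (bisect O N w lo hi y) = (N * (n.+1 + 3))%N /\ calls (bisect O N w lo hi y) = N.
Proof.
elim: N lo hi y => [//|N IH] lo hi y /=; case: (O _) => [y'|] /=.
  by have [-> ->] := IH ((lo + hi) / 2) hi y'; split; lia.
by have [-> ->] := IH lo ((lo + hi) / 2) y; split; lia.
Qed.

Lemma nu_separation_cost N (w : V) :
  (ops (nu_separation O N w) <= (4 * N + 5) * n.+1)%N /\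
  (calls (nu_separation O N w) <= N.+1)%N.
Proof.
rewrite /nu_separation/=; case: (O w) => [p|] /=; last by [].
by have [-> ->] := bisect_cost N w 1 (Num.sqrt n.+1%:R) p; split; nia.
Qed.

Lemma neumann_cost j theta (H : 'M[R]_n.+1) (y acc : V) :
  ops (neumann j theta H y acc) = (j * (2 * n.+1 ^ 2 + 2 * n.+1))%N /\
  calls (neumann j theta H y acc) = 0%N.
Proof.
elim: j y acc => [//|j IH] y acc /=.
by have [-> ->] := IH (theta *: (H *m y)) (acc + theta *: (H *m y)); split; lia.
Qed.

Variables (B eta beta c : R) (T : nat).
Let terms := oqns_terms (n := n) B eta beta c T.

(** Each Neumann term costs [2 d ^ 2 + 2 d] operations; the cubic term is charged only in rounds
    that invert. *)
Lemma oqns_update_cost (st : state) (u g : V) :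
  (ops (oqns_update B eta beta c T st u g)
     <= (4 * terms + 80) * n.+1 ^ 2 + (~~ st_same st) * n.+1 ^ 3)%N /\
  calls (oqns_update B eta beta c T st u g) = 0%N.
Proof.
rewrite /oqns_update -/terms; move: terms => j.
have m1 : (n.+1 <= n.+1 ^ 2)%N by nia.
by case: (st_same st) => /=; rewrite (neumann_cost j _ _ _ _).1 (neumann_cost j _ _ _ _).2; split=> //;
  move: m1 (n.+1 ^ 3)%N; set D := (n.+1 ^ 2)%N; move: D => D m1 E; nia.
Qed.

Lemma play_cost (w nu : V) :
  (ops (play w nu) <= 5 * n.+1)%N /\ calls (play w nu) = 0%N.
Proof. by rewrite /play/=; case: ifP => _ /=; split; lia. Qed.

Lemma feedback_cost (w nu u zeta : V) :
  (ops (feedback w nu u zeta) <= 7 * n.+1)%N /\ calls (feedback w nu u zeta) = 0%N.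
Proof. by rewrite /feedback/=; case: ifP => _ /=; split; lia. Qed.

Variables (nu_prog : V -> Defs.comp V) (zeta : nat -> V) (a b : nat).
Let w := program_w B eta beta c T nu_prog zeta.
Let st t := value (program_state B eta beta c T nu_prog zeta t).
Hypothesis nu_cost : forall x, (ops (nu_prog x) <= a * n.+1)%N /\ (calls (nu_prog x) <= b)%N.

Lemma program_state_cost t :
  (ops (program_state B eta beta c T nu_prog zeta t)
     <= 6 * n.+1 ^ 2 + t * ((a + 4 * terms + 92) * n.+1 ^ 2)
        + (\sum_(s < t) ~~ st_same (st s)) * n.+1 ^ 3)%N /\
  (calls (program_state B eta beta c T nu_prog zeta t) <= t * b)%N.
Proof.
have m1 : (n.+1 <= n.+1 ^ 2)%N by nia.
elim: t => [|t [IHo IHc]]; first by rewrite big_ord0 /=; split=> //; nia.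
set s := st t; set x := st_w s; set v := value (nu_prog x).
set u := value (play x v); set g := value (feedback x v u (zeta t)).
have -> : ops (program_state B eta beta c T nu_prog zeta t.+1) =
  (ops (program_state B eta beta c T nu_prog zeta t) + (ops (nu_prog x) + (ops (play x v)
    + (ops (feedback x v u (zeta t)) + ops (oqns_update B eta beta c T s u g)))))%N by [].
have -> : calls (program_state B eta beta c T nu_prog zeta t.+1) =
  (calls (program_state B eta beta c T nu_prog zeta t) + (calls (nu_prog x) + (calls (play x v)
    + (calls (feedback x v u (zeta t)) + calls (oqns_update B eta beta c T s u g)))))%N by [].
have [no nc] := nu_cost x; have [po ->] := play_cost x v.
have [fo ->] := feedback_cost x v u (zeta t); have [oo ->] := oqns_update_cost s u g.
split; last by lia.
rewrite [(\sum_(s < t.+1) _)%N]big_ord_recr [nat_of_ord _]/= -/s; move: IHo no po fo oo.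
move: (ops (program_state _ _ _ _ _ _ _ _)) (ops (nu_prog _)) (ops (play _ _)) (ops (feedback _ _ _ _)) (ops (oqns_update _ _ _ _ _ _ _ _)) => o1 o2 o3 o4 o5.
move: (\sum_(_ < _) _)%N m1 => ch.
rewrite (mulSn t) (mulnDl ch); move: (n.+1 ^ 2)%N ((_ : bool) * n.+1 ^ 3)%N (ch * n.+1 ^ 3)%N => D E1 E2 m1.
have aD : (a * n.+1 <= a * D)%N by rewrite leq_mul2l m1 orbT.
move: (t * _)%N => t1; lia.
Qed.

Lemma program_cost : (forall t, (t < T)%N -> st_v (st t) = landmark c w t) ->
  (ops (program B eta beta c T nu_prog zeta)
     <= 8 * n.+1 ^ 2 + T * ((a + 4 * terms + 92) * n.+1 ^ 2)
        + (\sum_(t < T) ~~ keep_landmark c (w t.+1) (landmark c w t)) * n.+1 ^ 3)%N /\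
  (calls (program B eta beta c T nu_prog zeta) <= T * b)%N.
Proof.
move=> vE; have [ho hc] := program_state_cost T.
have -> : ops (program B eta beta c T nu_prog zeta)
  = (ops (program_state B eta beta c T nu_prog zeta T) + n.+2)%N by [].
have -> : calls (program B eta beta c T nu_prog zeta)
  = (calls (program_state B eta beta c T nu_prog zeta T) + 0)%N by [].
split; last by rewrite addn0.
(* The flag read in round [s] was set at the end of the previous round and is true initially, so
   inversions are landmark moves shifted by one round. *)
have ch N : (forall t, (t < N)%N -> st_v (st t) = landmark c w t) ->
    (\sum_(s < N) ~~ st_same (st s)
     <= \sum_(t < N) ~~ keep_landmark c (w t.+1) (landmark c w t))%N.
  case: N => [|N] hv; first by rewrite !big_ord0.
  rewrite [leqLHS]big_ord_recl big_ord_recr; apply: leq_trans (leq_addr _ _).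
  rewrite [X in (X + _ <= _)%N](_ : _ = 0%N)// add0n.
  apply: leq_sum => s _; have -> : lift ord0 s = s.+1 :> nat by [].
  by rewrite /st (landmark_kept (t := s))// hv// leqW.
have m1 : (n.+1 <= n.+1 ^ 2)%N by nia.
have chE := leq_mul (ch T vE) (leqnn (n.+1 ^ 3)).
move: ho chE; set t1 := (T * _)%N; set t2 := (_ * n.+1 ^ 3)%N; set t3 := (_ * n.+1 ^ 3)%N.
move: t1 t2 t3 m1 => t1 t2 t3; move: (n.+1 ^ 2)%N => D; lia.
Qed.

End OperationCounts.

(** * Poly-logarithmic cost bounds *)

Section CostBound.
Context {R : realType}.
Variables (n : nat) (eps alpha eta am em B : R).
Local Notation d := (n.+1%:R : R).
Hypotheses (eps_gt0 : 0 < eps) (eps_le : eps <= 1 / d) (alpha_gt0 : 0 < alpha)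
  (alpha_le : alpha <= am) (eta_ge : 11 <= eta) (eta_le : eta <= em)
  (B_ge0 : 0 <= B) (B_le : B <= 1 + Num.sqrt d).
Let beta := Num.min (1 / 8) (alpha / 2).
Let L0 := ln (d / eps).
Let T := nceil (d * L0 / (alpha * eps)).
Let L := d / (alpha * eps).
Let lam := 1 + ln (1 + L).
Let q := d / eps.
Let terms := oqns_terms (n := n) B eta beta (1 / 4) T.

Let d1 : 1 <= d. Proof. by rewrite ler1n. Qed.
Let d0 : 0 < d. Proof. by rewrite ltr0n. Qed.
Let am0 : 0 < am. Proof. exact: lt_le_trans alpha_le. Qed.
Let em0 : 11 <= em. Proof. exact: le_trans eta_le. Qed.
Let q1 : 1 <= q. Proof. exact: ratio_ge1. Qed.
Let b_gt0 : 0 < beta. Proof. exact: beta_gt0. Qed.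

Let ln_le (x : R) : 0 < x -> ln x <= x.
Proof. by move=> x0; apply/ltW/ln_sublinear. Qed.

Let L_gt0 : 0 < L. Proof. by rewrite divr_gt0// mulr_gt0. Qed.

Let lam_ge1 : 1 <= lam.
Proof. by rewrite lerDl ln_ge0// lerDl ltW. Qed.

Let qL : q = alpha * L.
Proof. by rewrite /q /L; field; rewrite !gt_eqF. Qed.

(** The cost is measured in logarithms of d / (alpha eps), while the horizon involves ln (d / eps);
    [q = alpha * L] relates the two. *)
Lemma log_ratio_polylog : L0 <= am + ln (1 + L).
Proof.
have L1 : 0 < 1 + L by rewrite addr_gt0.
have h : q <= am * (1 + L).
  rewrite qL; apply: (@le_trans _ _ (am * L)); first by rewrite ler_pM2r.
  by rewrite ler_pM2l// lerDr.
apply: (@le_trans _ _ (ln (am * (1 + L)))).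
  by rewrite ler_ln ?posrE ?mulr_gt0 ?invr_gt0.
by rewrite lnM ?posrE// lerD2r ln_le.
Qed.

Lemma horizon_polylog : T%:R <= (2 * am + 1) * lam * (q / alpha).
Proof.
apply: (le_trans (horizon_le eps_gt0 eps_le alpha_gt0)).
have -> : d * ln (d / eps) / (alpha * eps) = L0 * (q / alpha).
  by rewrite /q -/L0; field; rewrite !gt_eqF.
have qa : 0 < q / alpha by rewrite divr_gt0//; exact: (lt_le_trans ltr01 q1).
have h1 : 1 <= am * (q / alpha).
  rewrite mulrA ler_pdivlMr// mul1r; apply: (le_trans alpha_le).
  by rewrite ler_peMr// ltW.
have := log_ratio_polylog; have := lam_ge1; rewrite /lam; move: (ln _) => l l0 hl.
have l1 : 0 <= l by lra.
have h2 : L0 * (q / alpha) <= (am + l) * (q / alpha) by rewrite ler_pM2r.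
have h3 : (2 * am + l) * (q / alpha) <= (2 * am + 1) * (1 + l) * (q / alpha).
  by rewrite ler_pM2r//; have := am0; nra.
by move: h1 h2 h3; move: (q / alpha) => z; lra.
Qed.

Lemma log_horizon_polylog : (0 < T)%N -> ln T%:R <= 1 + am + 2 * ln (1 + L).
Proof.
move=> T0; have L1 : 0 < 1 + L by rewrite addr_gt0.
have h : T%:R <= (1 + am) * (1 + L) ^+ 2.
  apply: (le_trans (horizon_le eps_gt0 eps_le alpha_gt0)).
  have -> : d * ln (d / eps) / (alpha * eps) = L0 * L by rewrite /L /L0; field; rewrite !gt_eqF.
  have h1 : L0 * L <= q * L by rewrite ler_pM2r//; exact: log_ratio_le.
  have h2 : q * L <= am * L ^+ 2 by rewrite qL expr2 mulrA !ler_pM2r.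
  have := L_gt0; have := am0; nra.
have -> : 1 + am + 2 * ln (1 + L) = (1 + am) + ln ((1 + L) ^+ 2).
  by rewrite lnXn// mulr_natl.
apply: (@le_trans _ _ (ln ((1 + am) * (1 + L) ^+ 2))).
  by rewrite ler_ln ?posrE ?mulr_gt0 ?exprn_gt0 ?addr_gt0 ?ltr0n.
by rewrite lnM ?posrE ?exprn_gt0 ?addr_gt0// lerD2r ln_le// addr_gt0.
Qed.

Lemma terms_polylog : terms%:R <= (360 * em + 5 * am + 9) * lam.
Proof.
have lam1 := lam_ge1; have l4 : 0 < ln (4 : R) by rewrite ln_gt0//; lra.
have l41 : 1 <= ln (4 : R).
  have -> : 4 = 2 ^+ 2 :> R by rewrite expr2; ring.
  by rewrite lnXn// mulr2n; have := @ln2_ge R; lra.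
rewrite /terms /oqns_terms; set X := 12 * _ * _ * _ / _.
have -> : - (ln X / ln (1 / 4)) = ln X / ln 4.
  by rewrite div1r lnV ?posrE// invrN mulrN opprK.
have [T0|T0] := posnP T.
  (* For a zero horizon the logarithm of 0 is 0 by convention. *)
  have -> : X = 0 by rewrite /X T0 mulr0 mul0r.
  rewrite ln0// mul0r; apply: (le_trans (nceil_le (lexx 0))).
  by have := am0; have := em0; nra.
have T1 : (1 : R) <= T%:R by rewrite ler1n.
have X1 : 4 ^+ 4 <= X by exact: oqns_terms_arg_ge.
have lX : 0 <= ln X by rewrite ln_ge0// (le_trans _ X1)// exprn_ege1//; lra.
apply: (le_trans (nceil_le _)); first by rewrite divr_ge0// ltW.
(* 180 is 5 * 4 * 9: from [4 + 32 / eta ^+ 2], from the square root of 12 / (1 - 1/4), and from the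
   bracket. *)
have hX : X <= (180 * em * (d * T%:R)) ^+ 2 * T%:R.
  have a5 : 4 + 32 / eta ^+ 2 <= 5.
    have : 32 / eta ^+ 2 <= 1 by rewrite ler_pdivrMr ?exprn_gt0//; have := eta_ge; nra.
    lra.
  have a0 : 0 <= 32 / eta ^+ 2 by rewrite divr_ge0// sqr_ge0.
  have x1 : 1 <= Num.sqrt d by rewrite -[leLHS]sqrtr1 ler_sqrt ?ltr0n.
  have xd : Num.sqrt d ^+ 2 = d by rewrite sqr_sqrtr.
  have B2 : B ^+ 2 <= 4 * d by rewrite -xd; have := B_le; have := B_ge0; nra.
  have Bd : B <= 2 * d by rewrite -xd; have := B_le; nra.
  have bB : 2 * beta * B ^+ 2 <= d.
    have : beta * B ^+ 2 <= 1 / 8 * (4 * d).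
      by apply: ler_pM => //; [exact: ltW|exact: sqr_ge0|exact: beta_le8].
    lra.
  have bB0 : 0 <= 2 * beta * B ^+ 2 by rewrite mulr_ge0 ?sqr_ge0// mulr_ge0// ltW.
  have p0 : 0 <= 2 * eta * d + B ^+ 2 * eta + (B + 2 * beta * B ^+ 2) * T%:R.
    have e0 : 0 <= eta by have := eta_ge; lra.
    by rewrite !addr_ge0 ?mulr_ge0 ?addr_ge0 ?sqr_ge0.
  have p9 : 2 * eta * d + B ^+ 2 * eta + (B + 2 * beta * B ^+ 2) * T%:R <= 9 * (em * (d * T%:R)).
    have h1 : eta * d <= em * d by rewrite ler_pM2r.
    have h2 : B ^+ 2 * eta <= 4 * d * em.
      by apply: ler_pM => //; [exact: sqr_ge0|have := eta_ge; lra].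
    have h3 : (B + 2 * beta * B ^+ 2) * T%:R <= 3 * d * T%:R by rewrite ler_pM2r ?ltr0n//; lra.
    have h4 : em * d * 1 <= em * d * T%:R by rewrite ler_pM2l// mulr_gt0//; have := em0; lra.
    have h5 : 1 * (d * T%:R) <= em * (d * T%:R).
      by rewrite ler_wpM2r ?mulr_ge0//; have := em0; lra.
    lra.
  rewrite /X; move: p0 p9; set p := _ + _ + _; move: p => p p0 p9.
  have -> : 180 * em * (d * T%:R) = 5 * (4 * (9 * (em * (d * T%:R)))) by ring.
  move: (9 * _) p9 => z p9.
  have -> : 12 * (4 + 32 / eta ^+ 2) ^+ 2 * p ^+ 2 * T%:R / (1 - 1 / 4)
    = ((4 + 32 / eta ^+ 2) * (4 * p)) ^+ 2 * T%:R.
    by rewrite !exprMn; move: (_ ^+ 2) => u; field.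
  rewrite ler_pM2r ?ltr0n// ler_sqr ?nnegrE ?mulr_ge0//; [|lra..].
  by apply: ler_pM; lra.
move: X X1 lX hX => X X1 lX hX.
have k0 : 0 < 180 * em by have := em0; lra.
have [k kE] : exists k, k = 180 * em by exists (180 * em).
rewrite -kE in k0 hX.
have dT0 : 0 < d * T%:R by rewrite mulr_gt0 ?ltr0n.
have : ln X <= ln ((k * (d * T%:R)) ^+ 2 * T%:R).
  have X0 : 0 < X by apply: lt_le_trans X1; rewrite exprn_gt0.
  rewrite ler_ln// posrE; apply: mulr_gt0; last by rewrite ltr0n.
  by apply: exprn_gt0; exact: mulr_gt0.
have kdT : 0 < k * (d * T%:R) by exact: mulr_gt0.
rewrite lnM ?posrE ?ltr0n//; last exact: exprn_gt0.
rewrite lnXn// lnM ?posrE// lnM ?posrE ?ltr0n//.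
have := ln_le k0; move: (ln k) => l1 h1 hlX.
have hd : ln d <= L0.
  have e1 : eps <= 1 by apply: (le_trans eps_le); rewrite ler_pdivrMr// mul1r.
  by rewrite ler_ln ?posrE ?divr_gt0// ler_pdivlMr// ler_piMr// ltW.
have hT := log_horizon_polylog T0; have hL := log_ratio_polylog.
apply: (@le_trans _ _ (ln X + 1)); first by rewrite lerD2r ler_pdivrMr// ler_peMr.
move: hlX hL hT hd lam1; rewrite /lam; move: (ln X) (ln (1 + L)) (ln d) (ln T%:R) L0 => y2 y3 y4 y5 y6.
rewrite mulr2n => g1 g2 g3 g4 g5.
have y30 : 0 <= y3 by lra.
have a1 := am0; have a2 := em0.
have p1 : 0 <= am * y3 by rewrite mulr_ge0// ltW.
have p2 : 0 <= em * y3 by rewrite mulr_ge0//; lra.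
lra.
Qed.

Lemma bisections_polylog : (nceil (L0 / ln 2))%:R <= (2 * am + 3) * lam.
Proof.
have l2 := @ln2_ge R; have l20 : 0 < ln (2 : R) by lra.
have L00 : 0 <= L0 by exact: log_ratio_ge0.
apply: (le_trans (nceil_le _)); first by rewrite divr_ge0// ltW.
have h : L0 / ln 2 <= 2 * L0 by rewrite ler_pdivrMr//; nra.
have := log_ratio_polylog; have := lam_ge1; rewrite /lam; move: (ln (1 + _)) => l l0 hl.
have := am0; nra.
Qed.

(** The log-determinant part contributes $d^4L_0/\beta$, absorbed by $d^2\le q$; the part $T/(\eta
    d)$ contributes at most $Td^2$. *)
Lemma inversions_polylog (ch : nat) : (ch <= T)%N ->
  ((0 < T)%N -> ch%:R / 5 <= 3 * (d / beta * ln (d * (1 + beta * T%:R))) + T%:R / (eta * d)) ->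
  ch%:R * d ^+ 3
    <= (45 * (8 * am + 2) * (am + 1) + (2 * am + 1)) * lam * (q / alpha * d ^+ 2).
Proof.
move=> chT hch; have hT := horizon_polylog; have lam1 := lam_ge1.
have qa : 0 < q / alpha by rewrite divr_gt0//; exact: (lt_le_trans ltr01 q1).
have chT' : ch%:R <= T%:R :> R by rewrite ler_nat.
have ep1 : eps * d <= 1 by rewrite -ler_pdivlMr.
have dq : d ^+ 2 <= q by rewrite /q ler_pdivlMr// expr2 -mulrA ler_piMr// 1?mulrC// ltW.
have K0 : 0 <= 45 * (8 * am + 2) * (am + 1) by have := am0; nra.
(* With [d ^+ 2 <= q] this forces d = 1; an inversion then costs one operation and [ch <= T] is
   enough. *)
have [small|large] := leP q 2.
  have n0 : d = 1.
    have : d < 2 by have := d1; nra.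
    by rewrite ltr_nat !ltnS leqn0 => /eqP ->.
  rewrite n0 !expr1n !mulr1; apply: (le_trans chT'); apply: (le_trans hT).
  by rewrite ler_pM2r// ler_wpM2r ?lerDr//; lra.
have T0 : (0 < T)%N by exact: horizon_gt0.
have e11 : 0 < eta by have := eta_ge; lra.
have hl := log_det_le eps_gt0 eps_le alpha_gt0 large.
have L0l : L0 <= (am + 1) * lam.
  have := log_ratio_polylog; have := lam_ge1; rewrite /lam; move: (ln (1 + _)) => l.
  by have := am0; nra.
have h1 : ch%:R * d ^+ 3
    <= 15 * (d / beta * (3 * L0)) * d ^+ 3 + 5 * (T%:R / (eta * d)) * d ^+ 3.
  have u1 := hch T0; have u2 : d / beta * ln (d * (1 + beta * T%:R)) <= d / beta * (3 * L0).
    by rewrite ler_pM2l// divr_gt0.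
  rewrite -mulrDl ler_pM2r ?exprn_gt0//; move: u1 u2.
  move: (d / beta * (3 * L0)) (d / beta * _) (T%:R / _) => x1 x2 x3; lra.
have h2 : 5 * (T%:R / (eta * d)) * d ^+ 3 <= T%:R * d ^+ 2.
  have -> : 5 * (T%:R / (eta * d)) * d ^+ 3 = 5 / eta * (T%:R * d ^+ 2).
    by field; rewrite !gt_eqF.
  rewrite ler_piMl ?mulr_ge0 ?sqr_ge0// ler_pdivrMr//; have := eta_ge; lra.
have h3 : 15 * (d / beta * (3 * L0)) * d ^+ 3
    = 45 * (alpha / beta * (L0 * (d ^+ 2 / alpha * d ^+ 2))).
  by field; rewrite !gt_eqF.
have h4 : alpha / beta * (L0 * (d ^+ 2 / alpha * d ^+ 2))
    <= (8 * am + 2) * ((am + 1) * lam * (q / alpha * d ^+ 2)).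
  have L00 : 0 <= L0 by exact: log_ratio_ge0.
  have z0 : 0 <= d ^+ 2 / alpha * d ^+ 2 by rewrite mulr_ge0 ?divr_ge0 ?sqr_ge0// ltW.
  apply: ler_pM; [by rewrite divr_ge0// ltW|by rewrite mulr_ge0| |].
    exact: beta_inv_le.
  apply: ler_pM => //; rewrite ler_pM2r ?exprn_gt0// ler_pM2r ?invr_gt0//.
have h5 : T%:R * d ^+ 2 <= (2 * am + 1) * lam * (q / alpha) * d ^+ 2.
  by rewrite ler_pM2r ?exprn_gt0.
apply: (le_trans h1); rewrite h3; move: h2 h4 h5.
move: (alpha / beta * (L0 * _)) (5 * (T%:R / (eta * d)) * d ^+ 3) => x2 x3.
move: (T%:R * d ^+ 2) => x4 g2 g4 g5; lra.
Qed.

(** Serves both oracles: [N] is the number of bisections per round, zero for projections. *)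
Lemma program_cost_polylog (N b o k ch : nat) (Torc : R) : 0 <= Torc ->
  N%:R <= (2 * am + 3) * lam -> (b <= N.+1)%N -> (ch <= T)%N ->
  ((0 < T)%N -> ch%:R / 5 <= 3 * (d / beta * ln (d * (1 + beta * T%:R))) + T%:R / (eta * d)) ->
  (o <= 8 * n.+1 ^ 2 + T * ((4 * N + 7 + 4 * terms + 92) * n.+1 ^ 2) + ch * n.+1 ^ 3)%N ->
  (k <= T * b)%N ->
  o%:R + k%:R * Torc
    <= ((2 * am + 1) * (4 * (360 * em + 5 * am + 9) + 4 * (2 * am + 3) + 99) + 8 * am
        + (45 * (8 * am + 2) * (am + 1) + (2 * am + 1)))
       / alpha * lam ^+ 2 * (q * (d ^+ 2 + Torc)).
Proof.
move=> To0 hN hb chT hch ho hk.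
have hT := horizon_polylog; have lam1 := lam_ge1; have ht := terms_polylog.
have hi := inversions_polylog chT hch.
have qa : 0 < q / alpha by rewrite divr_gt0//; exact: (lt_le_trans ltr01 q1).
have aq : 1 <= am * (q / alpha).
  rewrite mulrA ler_pdivlMr// mul1r; apply: (le_trans alpha_le).
  by rewrite ler_peMr// ltW.
have ho' : o%:R <= 8 * d ^+ 2 + T%:R * ((4 * N%:R + 7 + 4 * terms%:R + 92) * d ^+ 2)
    + ch%:R * d ^+ 3.
  rewrite -!natrX; move: ho; rewrite -(ler_nat R).
  move: (n.+1 ^ 2)%N (n.+1 ^ 3)%N => D2 D3; rewrite !(natrD, natrM); lra.
have hk' : k%:R <= T%:R * (N%:R + 1) :> R.
  have : (k <= T * N.+1)%N by apply: (leq_trans hk); rewrite leq_mul2l hb orbT.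
  by rewrite -(ler_nat R) natrM -natr1.
have am_gt0 := am0; have em_ge := em0.
set c1 := 4 * (360 * em + 5 * am + 9) + 4 * (2 * am + 3) + 99.
set c2 := 45 * (8 * am + 2) * (am + 1) + (2 * am + 1) in hi *.
have c10 : 0 <= c1 by rewrite /c1; lra.
have c20 : 0 <= c2 by rewrite /c2; nra.
have D0 : 0 < d ^+ 2 by rewrite exprn_gt0.
have ll : lam <= lam ^+ 2 by rewrite expr2 ler_peMr//; lra.
have l1 : 1 <= lam ^+ 2 by apply: le_trans ll.
have N0 : 0 <= N%:R :> R by [].
have T0 : 0 <= T%:R :> R by [].
have t0 : 0 <= terms%:R :> R by [].
have m1 : 4 * N%:R + 7 + 4 * terms%:R + 92 <= c1 * lam by rewrite /c1; lra.
have m2 : N%:R + 1 <= c1 * lam by rewrite /c1; lra.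
have s1 : T%:R * ((4 * N%:R + 7 + 4 * terms%:R + 92) * d ^+ 2)
    <= (2 * am + 1) * lam * (q / alpha) * (c1 * lam * d ^+ 2).
  apply: ler_pM; [exact: T0| |exact: hT|by rewrite ler_pM2r].
  by apply: mulr_ge0; [lra|exact: ltW].
have s2 : k%:R * Torc <= (2 * am + 1) * lam * (q / alpha) * (c1 * lam * Torc).
  apply: (@le_trans _ _ (T%:R * (N%:R + 1) * Torc)); first by rewrite ler_wpM2r.
  rewrite -mulrA; apply: ler_pM; [exact: T0| |exact: hT|by rewrite ler_wpM2r].
  by apply: mulr_ge0 => //; lra.
have s3 : 8 * d ^+ 2 <= 8 * (am * (q / alpha)) * lam ^+ 2 * d ^+ 2.
  rewrite ler_pM2r//; have : 1 * 1 <= am * (q / alpha) * lam ^+ 2 by apply: ler_pM.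
  by rewrite mulr1 -[8 * _ * _]mulrA; lra.
have s4 : c2 * lam * (q / alpha * d ^+ 2) <= c2 * lam ^+ 2 * (q / alpha * d ^+ 2).
  apply: ler_wpM2r; last exact: ler_wpM2l.
  by apply: mulr_ge0; exact: ltW.
have s5 : 0 <= (8 * am + c2) * lam ^+ 2 * (q / alpha) * Torc.
  have : 0 <= 8 * am + c2 by lra.
  move=> c0; apply: mulr_ge0 => //; apply: mulr_ge0; last exact: ltW.
  by apply: mulr_ge0 => //; exact: le_trans l1.
have -> : ((2 * am + 1) * c1 + 8 * am + c2) / alpha * lam ^+ 2 * (q * (d ^+ 2 + Torc))
  = (2 * am + 1) * lam * (q / alpha) * (c1 * lam * d ^+ 2)
    + (2 * am + 1) * lam * (q / alpha) * (c1 * lam * Torc)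
    + 8 * (am * (q / alpha)) * lam ^+ 2 * d ^+ 2
    + c2 * lam ^+ 2 * (q / alpha * d ^+ 2)
    + (8 * am + c2) * lam ^+ 2 * (q / alpha) * Torc by ring.
move: ho' s1 s2 s3 s4 s5 hi.
move: (T%:R * _) (k%:R * _) (8 * d ^+ 2) (ch%:R * _) => y1 y2 y3 y4.
move: ((2 * am + 1) * _ * _ * _) ((2 * am + 1) * _ * _ * _) (8 * _ * _ * _) (c2 * lam ^+ 2 * _)
  ((8 * am + c2) * _ * _ * _) (c2 * lam * _) => z1 z2 z3 z4 z5 z6.
lra.
Qed.

End CostBound.

(** * Guarantees for the program, given admissible oracle subgradients *)

Section ProgramGuarantee.
Context {R : realType} {n : nat}.
Local Notation V := 'cV[R]_n.+1.
Local Notation d := (n.+1%:R : R).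
Variables (eps alpha eta am em B b0 ep : R) (C dom : set V) (loss : nat -> V -> R)
  (nu_prog : V -> Defs.comp V) (zeta : nat -> V) (N : nat).
Let beta := Num.min (1 / 8) (alpha / 2).
Let T := nceil (d * ln (d / eps) / (alpha * eps)).
Let e := eta * d.
Let reg := d + eta * B ^+ 2.
Let lam := 1 + ln (1 + d / (alpha * eps)).
Let w := program_w B eta beta (1 / 4) T nu_prog zeta.
Let nu := program_nu B eta beta (1 / 4) T nu_prog zeta.
Let run := program B eta beta (1 / 4) T nu_prog zeta.
Hypotheses (eps_gt0 : 0 < eps) (eps_le : eps <= 1 / d) (alpha_gt0 : 0 < alpha)
  (alpha_le : alpha <= am) (eta_ge : 11 <= eta) (eta_le : eta <= em)
  (B_ge0 : 0 <= B) (B_le : B <= 1 + Num.sqrt d).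
Hypothesis b0P : forall s, 0 <= s -> s < 1 ->
  (1 + s * b0) ^+ 2 <= reg /\ 16 * (1 + s * b0) ^+ 2 <= 2 * e / (1 - s ^+ 2) + reg.
Hypothesis zetaP : forall t, (t < T)%N ->
  subdiff (ext dom (loss t)) (played (w t) (nu t)) (zeta t) /\ enorm (zeta t) <= 1.
Hypothesis nuP : forall x, enorm x <= 1 ->
  admissible C ep x (value (nu_prog x)) /\ enorm (value (nu_prog x)) <= b0.

Let e_ge : 11 <= e.
Proof. by have := eta_ge; have : 1 <= d; [rewrite ler1n|rewrite /e; nra]. Qed.

Let reg_ge0 : 0 <= reg.
Proof. by rewrite addr_ge0// mulr_ge0 ?sqr_ge0//; have := eta_ge; lra. Qed.

Let b_gt0 : 0 < beta. Proof. exact: beta_gt0. Qed.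

Let run_prefix k : (k <= T)%N -> good_run B eta beta ep b0 T C dom loss k w nu zeta /\
  state_inv B eta beta (1 / 4) T nu_prog zeta k.
Proof.
apply: program_good_run => //; first exact: ltW.
move=> t tT; have [h1 h2] := zetaP tT; split=> // w1.
by apply: nuP; rewrite enorm_le// expr1n ltW.
Qed.

Lemma program_is_run : good_run B eta beta ep b0 T C dom loss T w nu zeta.
Proof. exact: (run_prefix (leqnn T)).1. Qed.

Lemma program_in_ball t : (t < T)%N -> enorm (w t) <= 1.
Proof.
move=> tT; rewrite enorm_le// expr1n ltW//.
exact: (run_in_ball eta_ge b_gt0 B_ge0 (leq_ltn_trans (leq0n _) tT) b0P program_is_run (ltnW tT)).
Qed.

Lemma program_averages : value run = average T (fun t => played (w t) (nu t)).
Proof. exact: program_value (run_prefix (leqnn T)).2. Qed.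

Hypothesis nu_cost : forall x,
  (ops (nu_prog x) <= (4 * N + 7) * n.+1)%N /\ (calls (nu_prog x) <= N.+1)%N.
Hypothesis N_le : N%:R <= (2 * am + 3) * lam.

Lemma program_cost_bound (Torc : R) : 0 <= Torc ->
  cost Torc run
    <= ((2 * am + 1) * (4 * (360 * em + 5 * am + 9) + 4 * (2 * am + 3) + 99) + 8 * am
        + (45 * (8 * am + 2) * (am + 1) + (2 * am + 1)))
       / alpha * lam ^+ 2 * (d / eps * (d ^+ 2 + Torc)).
Proof.
move=> To0.
have vE t : (t < T)%N ->
    st_v (value (program_state B eta beta (1 / 4) T nu_prog zeta t)) = landmark (1 / 4) w t.
  by move=> tT; have [_ []] := run_prefix (ltnW tT).
have [ho hc] := program_cost nu_cost vE.
apply: (program_cost_polylog eps_gt0 eps_le alpha_gt0 alpha_le eta_ge eta_le B_ge0 B_le To0 N_le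
  (leqnn _) _ _ ho hc).
  rewrite -[leqRHS](card_ord T) -sum1_card; apply: leq_sum => t _; exact: leq_b1.
move=> T0; exact: (run_changes eta_ge b_gt0 B_ge0 T0 b0P program_is_run).
Qed.

End ProgramGuarantee.

Section Constants.
Context {R : realType}.

Lemma bisection_accuracy (x : R) : 0 < x -> x <= 2 ^+ nceil (ln x / ln 2).
Proof.
move=> x0; have l2 : 0 < ln (2 : R) by have := @ln2_ge R; lra.
rewrite -ler_ln ?posrE ?exprn_gt0// lnXn// -[ln 2 *+ _]mulr_natl -ler_pdivrMr//; exact: nceil_ge.
Qed.

(* [27 (x - 1) <= 4 x^3] is [0 <= (2 x - 3)^2 (x + 3)]. *)
Lemma separation_error (x eps : R) : 1 <= x -> 0 < eps -> eps <= 1 / x ^+ 2 ->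
  let dl := (x - 1) * (eps / x ^+ 2) in
  [/\ 0 <= dl, dl <= eps, dl * x <= eps & x * (1 + dl) <= x + 4 / 27].
Proof.
move=> x1 e0 ex dl; have x0 : 0 < x by lra.
have dlE : dl * x = (x - 1) / x * eps by rewrite /dl; field; rewrite gt_eqF.
have dl0 : 0 <= dl by rewrite mulr_ge0 ?divr_ge0 ?sqr_ge0 ?subr_ge0// ltW.
have dlx : dl * x <= eps.
  rewrite dlE ler_piMl//; first exact: ltW.
  by rewrite ler_pdivrMr//; lra.
split=> //; first by nra.
rewrite mulrDr mulr1 lerD2l mulrC dlE.
apply: (@le_trans _ _ ((x - 1) / x * (1 / x ^+ 2))).
  by rewrite ler_wpM2l// divr_ge0 ?subr_ge0// ltW.
have -> : (x - 1) / x * (1 / x ^+ 2) = (x - 1) / x ^+ 3 by field; rewrite gt_eqF.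
rewrite ler_pdivrMr ?exprn_gt0//.
have : 0 <= (2 * x - 3) ^+ 2 * (x + 3) by rewrite mulr_ge0 ?sqr_ge0//; lra.
have -> : (2 * x - 3) ^+ 2 * (x + 3) = 4 * x ^+ 3 - 27 * (x - 1) by ring.
lra.
Qed.

End Constants.

Theorem theorem11 (R : realType) (alpha_max eta_max : R) :
  exists (K : R) (p : nat),
  forall (n : nat) (eps alpha eta : R) (C dom : set 'cV[R]_n.+1)
    (dX dO : measure_display) (Xi : measurableType dX)
    (Omega : measurableType dO) (P : probability Omega R)
    (mu : probability Xi R) (xi : nat -> Omega -> Xi)
    (f : 'cV[R]_n.+1 -> Xi -> R),
  let d : R := n.+1%:R in
  let beta := Num.min (1 / 8) (alpha / 2) in
  let c : R := 1 / 4 in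
  let T := nceil (d * ln (d / eps) / (alpha * eps)) in
  let polylog := (1 + ln (1 + d / (alpha * eps))) ^+ p in
  let loss (x : nat -> Xi) (t : nat) := ext dom (f^~ (x t)) in
  0 < eps -> eps <= 1 / d ->
  0 < alpha -> alpha <= alpha_max ->
  11 <= eta -> eta <= eta_max ->
  closed C -> convex_set C -> C !=set0 -> C `<=` eball 1 ->
  convex_set dom ->
  iid P mu xi ->
  loss_family mu alpha dom f ->
  (eball 1 `<=` dom ->
    let B := 1 in
    let S := inf_conv C (fun x => (enorm x)%:E) in
    let alg := oqns B eta beta c T in
    (forall w nu zeta : nat -> Omega -> 'cV[R]_n.+1,
       nonanticipating xi T nu zeta ->
       (forall om, reduction_run alg (subdiff S) (loss (xi^~ om)) T
                     (w^~ om) (nu^~ om) (zeta^~ om)) ->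
       ('E_P[fun om => excess_risk mu f C
               (average T (fun t => played (w t om) (nu t om)))]
          <= (K * eps)%:E)%E)
    /\
    (forall (O : 'cV[R]_n.+1 -> option 'cV[R]_n.+1) (T_proj : R)
        (x : nat -> Xi) (zeta : nat -> 'cV[R]_n.+1),
       let nu_prog := nu_projection O in
       let w := program_w B eta beta c T nu_prog zeta in
       let nu := program_nu B eta beta c T nu_prog zeta in
       let run := program B eta beta c T nu_prog zeta in
       projection_oracle C O -> 0 <= T_proj ->
       (forall t, (t < T)%N ->
          subdiff (loss x t) (played (w t) (nu t)) (zeta t)) ->
       [/\ reduction_run alg (subdiff S) (loss x) T w nu zeta,
           value run = average T (fun t => played (w t) (nu t)) &
           cost T_proj run
             <= K / alpha * polylog * (d / eps * (d ^+ 2 + T_proj))]))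
  /\
  (C = -%R @` C -> eball (1 / Num.sqrt d) `<=` C -> C `<=` dom ->
    let B := 1 + Num.sqrt d in
    let S := inf_conv C (gauge C) in
    let alg := oqns B eta beta c T in
    (forall w nu zeta : nat -> Omega -> 'cV[R]_n.+1,
       nonanticipating xi T nu zeta ->
       (forall om, reduction_run alg (subdiff S) (loss (xi^~ om)) T
                     (w^~ om) (nu^~ om) (zeta^~ om)) ->
       ('E_P[fun om => excess_risk mu f C
               (average T (fun t => played (w t om) (nu t om)))]
          <= (K * eps)%:E)%E)
    /\
    (forall O : 'cV[R]_n.+1 -> option 'cV[R]_n.+1,
       separation_oracle C O ->
       let nu_prog := nu_separation O (nceil (ln (d / eps) / ln 2)) in
       let w := program_w B eta beta c T nu_prog in
       let nu := program_nu B eta beta c T nu_prog in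
       let run := program B eta beta c T nu_prog in
       (forall zeta : nat -> Omega -> 'cV[R]_n.+1,
          nonanticipating xi T (fun t om => nu (zeta^~ om) t) zeta ->
          (forall om t, (t < T)%N ->
             subdiff (loss (xi^~ om) t)
               (played (w (zeta^~ om) t) (nu (zeta^~ om) t)) (zeta t om)) ->
          ('E_P[fun om => excess_risk mu f C (value (run (zeta^~ om)))]
             <= (K * eps)%:E)%E)
       /\
       (forall (T_sep : R) (x : nat -> Xi) (zeta : nat -> 'cV[R]_n.+1),
          0 <= T_sep ->
          (forall t, (t < T)%N ->
             subdiff (loss x t) (played (w zeta t) (nu zeta t)) (zeta t)) ->
          [/\ reduction_run alg
                (fun w0 nu0 => forall y, eball 1 y ->
                   (S w0 + (dot nu0 (y - w0))%:E - eps%:E <= S y)%E)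
                (loss x) T (w zeta) (nu zeta) zeta,
              value (run zeta)
                = average T (fun t => played (w zeta t) (nu zeta t)) &
              cost T_sep (run zeta)
                <= K / alpha * polylog * (d / eps * (d ^+ 2 + T_sep))]))).
Proof.
pose K1 : R := 7 * (eta_max * alpha_max) + 18 * (8 * alpha_max + 2) + 9.
pose K2 : R := (2 * alpha_max + 1)
    * (4 * (360 * eta_max + 5 * alpha_max + 9) + 4 * (2 * alpha_max + 3) + 99)
  + 8 * alpha_max + (45 * (8 * alpha_max + 2) * (alpha_max + 1) + (2 * alpha_max + 1)).
(* One logarithm comes from the horizon, the other from the number of Neumann terms and of
   bisections. *)
exists (Num.max K1 K2), 2%N.
move=> n eps alpha eta C dom dX dO Xi Omega P mu xi f d beta c T polylog loss eps0 eps_le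
  alpha0 alpha_le eta_ge eta_le _ cC C0 CB cdom xi_iid floss.
have x1 : 1 <= Num.sqrt d by rewrite -[leLHS]sqrtr1 ler_sqrt ?ltr0n// ler1n.
have xd : Num.sqrt d ^+ 2 = d by rewrite sqr_sqrtr.
have d1 : 1 <= d by rewrite ler1n.
have ded : d <= eta * d by rewrite ler_peMl//; lra.
have fb t x u z : subdiff (loss x t) u z -> enorm z <= 1 by have [_ h _] := floss; exact: h.
have expK (E : \bar R) : (E <= (K1 * eps)%:E)%E -> (E <= (Num.max K1 K2 * eps)%:E)%E.
  by move/le_trans; apply; rewrite lee_fin ler_pM2r// le_max lexx.
have costK (c0 Torc : R) : 0 <= Torc ->
    c0 <= K2 / alpha * polylog * (d / eps * (d ^+ 2 + Torc)) ->
    c0 <= Num.max K1 K2 / alpha * polylog * (d / eps * (d ^+ 2 + Torc)).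
  move=> To0 /le_trans; apply; apply: ler_wpM2r.
    by rewrite mulr_ge0 ?addr_ge0 ?sqr_ge0// divr_ge0// ltW.
  by rewrite ler_wpM2r ?sqr_ge0// ler_wpM2r ?invr_ge0 ?(ltW alpha0)// le_max lexx orbT.
split=> [ball_dom B S alg|sC bC Cdom B S alg].
- have b0P s : 0 <= s -> s < 1 -> (1 + s * 1) ^+ 2 <= d + eta * B ^+ 2 /\
      16 * (1 + s * 1) ^+ 2 <= 2 * (eta * d) / (1 - s ^+ 2) + (d + eta * B ^+ 2).
    by move=> s0 s1; rewrite -xd; exact: dist_condition.
  have reg_le : d + eta * B ^+ 2 <= 5 * (eta * d) by rewrite expr1n; nra.
  have Cdom : C `<=` dom := subset_trans CB ball_dom.
  have adm x nu : subdiff S x nu -> admissible C 0 x nu /\ enorm nu <= 1.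
    exact: subdiff_dist_admissible.
  split=> [w nu zeta nonant run|O T_proj x zeta nu_prog w nu run PO Tp0 hz].
    apply/expK/(reduction_expectation eps0 eps_le alpha0 alpha_le eta_ge eta_le xi_iid floss
      cdom C0 CB Cdom ler01 reg_le (lexx 0) (ltW eps0) ltr01 ball_dom b0P nonant) => om.
    have [h1 h2] := run om; split=> // t tT; have [h3 h4] := h2 t tT.
    by split=> // [|_]; [exact: fb h4|exact: adm].
  have nuS y : subdiff S y (value (nu_prog y)) by exact: nu_projection_subdiff.
  have zP t : (t < T)%N -> subdiff (loss x t) (played (w t) (nu t)) (zeta t) /\ enorm (zeta t) <= 1.
    by move=> tT; have h := hz t tT; split=> //; exact: fb h.
  have nP y : enorm y <= 1 -> admissible C 0 y (value (nu_prog y)) /\ enorm (value (nu_prog y)) <= 1.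
    by move=> _; exact: adm.
  have B_le : B <= 1 + Num.sqrt d by rewrite /B lerDl sqrtr_ge0.
  have good := program_is_run alpha0 eta_ge ler01 b0P zP nP.
  split.
  + by split=> [|t tT]; [exact: good.1|split; [exact: nuS|exact: hz]].
  + exact: (program_averages alpha0 eta_ge ler01 b0P zP nP).
  (* A projection needs a single oracle call and no bisection. *)
  + apply: costK => //; apply: (program_cost_bound (N := 0) eps0 eps_le alpha0 alpha_le eta_ge eta_le
      ler01 B_le b0P zP nP) => //.
      by move=> y; have [h1 ->] := nu_projection_cost O y; rewrite muln0 add0n.
    by apply: le_trans (bisections_polylog eps0 eps_le alpha0 alpha_le).
- have b0P b0 : 0 <= b0 -> b0 <= Num.sqrt d + 4 / 27 -> forall s, 0 <= s -> s < 1 ->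
      (1 + s * b0) ^+ 2 <= d + eta * B ^+ 2 /\
      16 * (1 + s * b0) ^+ 2 <= 2 * (eta * d) / (1 - s ^+ 2) + (d + eta * B ^+ 2).
    by move=> b00 b0x s s0 s1; have := gauge_condition eta_ge x1 s0 s1 b00 b0x; rewrite xd.
  have B0 : 0 <= B by rewrite /B; lra.
  have reg_le : d + eta * B ^+ 2 <= 5 * (eta * d).
    have : B ^+ 2 <= 4 * d by rewrite -xd /B; move: x1; nra.
    by rewrite -(ler_pM2l (lt_le_trans (_ : 0 < 11) eta_ge))//; lra.
  have r00 : 0 < 1 / Num.sqrt d by rewrite divr_gt0//; lra.
  have rdom : eball (1 / Num.sqrt d) `<=` dom := subset_trans bC Cdom.
  have b0x : Num.sqrt d <= Num.sqrt d + 4 / 27 by lra.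
  split=> [w nu zeta nonant run|O sep nu_prog w nu run].
    apply/expK/(reduction_expectation eps0 eps_le alpha0 alpha_le eta_ge eta_le xi_iid floss
      cdom C0 CB Cdom B0 reg_le (lexx 0) (ltW eps0) r00 rdom (b0P _ (sqrtr_ge0 d) b0x) nonant) => om.
    have [h1 h2] := run om; split=> // t tT; have [h3 h4] := h2 t tT.
    by split=> // [|_]; [exact: fb h4|exact: subdiff_gauge_admissible].
  pose N := nceil (ln (d / eps) / ln 2).
  (* Bounds the final bisection interval: the initial length is [Num.sqrt d - 1], and [2 ^+ N] is at
     least [d / eps]. *)
  pose dl := (Num.sqrt d - 1) * (eps / d).
  have [dl0 dl_eps dlx b0_le] : [/\ 0 <= dl, dl <= eps, dl * Num.sqrt d <= eps &
      Num.sqrt d * (1 + dl) <= Num.sqrt d + 4 / 27].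
    by rewrite /dl -[in eps / d]xd; apply: separation_error => //; rewrite xd.
  have dlP : (Num.sqrt d - 1) / 2 ^+ N <= dl.
    rewrite ler_wpM2l ?subr_ge0// -[eps / d]invf_div lef_pV2 ?posrE ?exprn_gt0 ?divr_gt0 ?ltr0n//.
    by apply: bisection_accuracy; rewrite divr_gt0 ?ltr0n.
  have nuP y : enorm y <= 1 -> admissible C dl y (value (nu_prog y)) /\
      enorm (value (nu_prog y)) <= Num.sqrt d * (1 + dl).
    exact: nu_separation_admissible.
  have b0P' := b0P _ (mulr_ge0 (sqrtr_ge0 d) (addr_ge0 ler01 dl0)) b0_le.
  have zP x zeta : (forall t, (t < T)%N ->
        subdiff (loss x t) (played (w zeta t) (nu zeta t)) (zeta t)) ->
      forall t, (t < T)%N -> subdiff (loss x t) (played (w zeta t) (nu zeta t)) (zeta t) /\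
        enorm (zeta t) <= 1.
    by move=> hz t tT; have h := hz t tT; split=> //; exact: fb h.
  split=> [zeta nonant hz|T_sep x zeta Ts0 hz].
    have -> : (fun om => excess_risk mu f C (value (run (zeta^~ om))))
        = (fun om => excess_risk mu f C
             (average T (fun t => played (w (zeta^~ om) t) (nu (zeta^~ om) t)))).
      apply/funext => om; congr excess_risk.
      exact: (program_averages alpha0 eta_ge B0 b0P' (zP _ _ (hz om)) nuP).
    apply/expK/(reduction_expectation (w := fun t om => w (zeta^~ om) t) eps0 eps_le alpha0
      alpha_le eta_ge eta_le xi_iid floss cdom C0 CB Cdom B0 reg_le dl0 dl_eps r00 rdom b0P'
      nonant) => om.
    exact: (program_is_run alpha0 eta_ge B0 b0P' (zP _ _ (hz om)) nuP).
  have zx := zP x zeta hz; have good := program_is_run alpha0 eta_ge B0 b0P' zx nuP.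
  split.
  + split=> [|t tT]; first exact: good.1.
    split; last exact: hz.
    move=> y y1; apply: (nu_separation_subdiff sep bC dlP) => //.
    exact: (program_in_ball alpha0 eta_ge B0 b0P' zx nuP).
  + exact: (program_averages alpha0 eta_ge B0 b0P' zx nuP).
  + apply: costK => //; apply: (program_cost_bound (N := N) eps0 eps_le alpha0 alpha_le eta_ge
      eta_le B0 (lexx _) b0P' zx nuP) => //; last exact: bisections_polylog.
    move=> y; have [h1 h2] := nu_separation_cost O N y; split=> //.
    by apply: (leq_trans h1); rewrite leq_mul2r leq_add2l.
Qed.
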